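(* Let $n\ge2$, $G=\mathrm{Sp}(2n,\mathbb{C})$, let $T_G$ be a maximal torus of $G$, and let $P^{\alpha_1}\supset T_G$ be the maximal parabolic subgroup of $G$ corresponding to the simple root $\alpha_1$. Then the GIT quotient $T_G\backslash\backslash (G/P^{\alpha_1})^{ss}_{T_G}(\mathcal{L}(2\omega_1))$ is projectively normal with respect to the descent of the $T_G$-linearized very ample line bundle $\mathcal{L}(2\omega_1)$, and it is isomorphic to the projective space $(\mathbb{P}^{n-1},\mathcal{O}_{\mathbb{P}^{n-1}}(1))$ as a polarized variety.
   Context: Root conventions for $\mathrm{Sp}(2n,\mathbb{C})$ (Bourbaki numbering): simple roots $\alpha_i=\epsilon_i-\epsilon_{i+1}$ for $1\le i\le n-1$ and $\alpha_n=2\epsilon_n$; $\omega_i$ is the fundamental weight dual to the simple coroot of $\alpha_i$. $P^{\alpha_i}$ is the maximal parabolic subgroup for which the very ample generator of $\mathrm{Pic}(G/P^{\alpha_i})$ is $\mathcal{L}(\omega_i)$. Line bundles $\mathcal{L}(\lambda)$ on $G/P^{\alpha_i}$ carry the $T_G$-linearization restricted from their natural $G$-linearization. For a projective $T_G$-variety $X$ with $T_G$-linearized ample line bundle $\mathcal{L}$, a point $p$ is semi-stable if some $s\in H^0(X,\mathcal{L}^{\otimes m})^{T_G}$, $m>0$, has $s(p)\ne 0$; $X^{ss}_{T_G}(\mathcal{L})$ is the set of semi-stable points, and the GIT quotient is $T_G\backslash\backslash X^{ss}_{T_G}(\mathcal{L})=\mathrm{Proj}\bigoplus_{k\ge0}H^0(X,\mathcal{L}^{\otimes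 k})^{T_G}$. The bundle $\mathcal{L}$ descends to the quotient if there is a line bundle $\mathcal{M}$ (the descent of $\mathcal{L}$) on the quotient whose pullback to $X^{ss}_{T_G}(\mathcal{L})$ is, $T_G$-equivariantly, $\mathcal{L}|_{X^{ss}_{T_G}(\mathcal{L})}$. By a theorem of Kumar, $\mathcal{L}(2\omega_1)$ descends in the present case. One then has $H^0(T_G\backslash\backslash X^{ss}_{T_G}(\mathcal{L}),\mathcal{M}^{\otimes k})=H^0(X,\mathcal{L}^{\otimes k})^{T_G}$. A polarized variety $(Z,\mathcal{M})$ is projectively normal if $\bigoplus_{k\ge0}H^0(Z,\mathcal{M}^{\otimes k})$ is integrally closed and generated as a $\mathbb{C}$-algebra by $H^0(Z,\mathcal{M})$. The quotient is viewed as polarized by the descent of the line bundle; an isomorphism of polarized varieties is an isomorphism identifying the polarizing line bundles. *)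

(* Defs.v *)
From HB Require Import structures.
From mathcomp Require Import all_boot all_order all_algebra.
From mathcomp Require Import mathcomp_extra boolp classical_sets functions reals.
From mathcomp Require Import complex mpoly.

Set Implicit Arguments.
Unset Strict Implicit.
Unset Printing Implicit Defensive.
Import GRing.Theory.
Local Open Scope classical_set_scope.
Local Open Scope ring_scope.

(** * Varieties over a field [K] as spaces with functions

    A classical variety is given by its [K]-points, the Zariski topology and,
    for every open set [U], the regular functions [U -> K].  A function on [U]
    is represented by a function on the whole space, of which only the values
    on [U] matter. *)

Record space (K : fieldType) := Space {
  pt :> Type;
  opn : set (set pt);
  reg : set pt -> set (pt -> K) }.

Definition morphism (K : fieldType) (X Y : space K) (f : X -> Y) : Prop :=
  (forall V, opn V -> opn (f @^-1` V)) /\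
  (forall V g, opn V -> reg V g -> reg (f @^-1` V) (g \o f)).

Definition isomorphism (K : fieldType) (X Y : space K) (f : X -> Y) : Prop :=
  morphism f /\
  exists g : Y -> X, [/\ morphism g, cancel f g & cancel g f].

(* Meant for an open subset [W] of [X]. *)
Definition subspace (K : fieldType) (X : space K) (W : set X) : space K :=
  @Space K (set_type W)
    [set U | opn ((val : set_type W -> X) @` U)]
    (fun U => [set f | exists2 g : X -> K,
       reg ((val : set_type W -> X) @` U) g &
       forall x : set_type W, U x -> f x = g (val x)]).

(** * Line bundles

    A line bundle is given by its fibres and, for every open set [U], its
    regular sections over [U] (of which, again, only the values on [U]
    matter). *)

Record bundle (K : fieldType) (X : space K) := Bundle {
  fib : X -> lmodType K;
  sect : set X -> set (forall x, fib x) }.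

Definition frame_at (K : fieldType) (X : space K) (L : bundle X) (x : X) :=
  {v : fib L x | v != 0}.

Definition frame (K : fieldType) (X : space K) (L : bundle X) :=
  {x : X & frame_at L x}.

Definition line_bundle (K : fieldType) (X : space K) (L : bundle X) : Prop :=
  [/\ forall x, exists2 v : fib L x, v != 0 & forall w, exists c : K, w = c *: v,
      forall (U : set X) (s s' : forall x, fib L x), opn U ->
        (forall x, U x -> s x = s' x) -> sect U s -> sect U s',
      forall (U : set X) (s : forall x, fib L x), opn U ->
        (sect U s <->
         forall x, U x -> exists V, [/\ opn V, V x, V `<=` U & sect V s]) &
      forall x, exists U (e : forall y, frame_at L y),
        [/\ opn U, U x &
            forall (V : set X) (f : X -> K), opn V -> V `<=` U ->
              (sect V (fun y => f y *: val (e y)) <-> reg V f)]].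

Definition pullback (K : fieldType) (X Y : space K) (f : X -> Y) (N : bundle Y) :
    bundle X :=
  @Bundle K X (fun x => fib N (f x))
    (fun U => [set s | forall x, U x -> exists V W g t,
       [/\ opn V, W `<=` f @^-1` V, [/\ opn W, W x & W `<=` U],
           reg W g /\ sect V t &
           forall y, W y -> s y = g y *: t (f y)]]).

Definition bundle_iso (K : fieldType) (X : space K) (L N : bundle X)
    (psi : forall x, {linear fib L x -> fib N x}) : Prop :=
  (forall x, bijective (psi x)) /\
  (forall (U : set X) (s : forall x, fib L x), opn U ->
     (sect U s <-> sect U (fun x => psi x (s x)))).

Definition polarized_isomorphic (K : fieldType) (X Y : space K)
    (M : bundle X) (N : bundle Y) : Prop :=
  exists2 f : X -> Y, isomorphism f &
    exists psi : forall x, {linear fib M x -> fib (pullback f N) x},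
      bundle_iso psi.

(* [H^0(X, L^k)].  For [v] a nonzero vector of the line [L_x], the vector
   [v^(tensor k)] is a basis of the fibre of the [k]-th tensor power of [L] at
   [x]; a section [sigma] of that power is represented by the function [F] on
   nonzero vectors such that [sigma(x) = F(x, v) v^(tensor k)].  The product
   of sections is then the product of functions. *)
Definition power_section (K : fieldType) (X : space K) (L : bundle X) (k : nat) :
    set (frame L -> K) :=
  [set F | (forall (x : X) (v w : frame_at L x) (c : K), val w = c *: val v ->
              F (existT _ x w) = c ^- k * F (existT _ x v)) /\
           (forall (U : set X) (e : forall x, frame_at L x), opn U ->
              sect U (fun x => val (e x)) ->
              reg U (fun x => F (existT _ x (e x))))].

(** * Graded algebras of functions *)

(* The sum of the graded pieces [gr k], inside the ring of functions [Y -> K].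
   For sections of the powers of a line bundle and [K] infinite it is direct,
   since functions with distinct degrees of homogeneity are linearly
   independent. *)
Definition graded_sum (K : fieldType) (Y : Type) (gr : nat -> set (Y -> K)) :
    set (Y -> K) :=
  [set f | exists N (s : nat -> Y -> K),
     (forall k, gr k (s k)) /\ f = \sum_(k < N) s k].

Definition subalgebra (K : fieldType) (Y : Type) (B : set (Y -> K)) : Prop :=
  [/\ forall c : K, B (cst c),
      forall f g, B f -> B g -> B (f + g) &
      forall f g, B f -> B g -> B (f * g)].

Definition domain (K : fieldType) (Y : Type) (S : set (Y -> K)) : Prop :=
  (1 : Y -> K) <> 0 /\
  (forall a b, S a -> S b -> a * b = 0 -> a = 0 \/ b = 0).

(* An element [a / b] of the fraction field that is a root of the monic
   polynomial [X^m + \sum_(i < m) c_i X^i] over [S] belongs to [S]; the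
   equation is multiplied by [b^m]. *)
Definition integrally_closed (K : fieldType) (Y : Type) (S : set (Y -> K)) : Prop :=
  domain S /\
  forall (a b : Y -> K) (m : nat) (c : 'I_m -> Y -> K),
    S a -> S b -> b <> 0 -> (forall i, S (c i)) ->
    a ^+ m + \sum_(i < m) c i * a ^+ i * b ^+ (m - i) = 0 ->
    exists2 d, S d & a = d * b.

Definition projectively_normal (K : fieldType) (Z : space K) (M : bundle Z) : Prop :=
  let S := graded_sum (@power_section K Z M) in
  integrally_closed S /\
  S `<=` \bigcap_(B in [set B | subalgebra B /\ @power_section K Z M 1 `<=` B]) B.

(** ** Proj *)

(* The [K]-points of [Proj]: the relevant homogeneous primes with residue field
   [K].  For a finitely generated algebra over an algebraically closed field
   these are the closed points. *)
Definition proj_point (K : fieldType) (Y : Type) (gr : nat -> set (Y -> K)) :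
    set (set (Y -> K)) :=
  let S := graded_sum gr in
  [set p |
    [/\ [/\ p `<=` S, p 0,
            forall f g, p f -> p g -> p (f + g) &
            forall a f, S a -> p f -> p (a * f)],
        forall N (s : nat -> Y -> K), (forall k, gr k (s k)) ->
          p (\sum_(k < N) s k) -> forall k, (k < N)%N -> p (s k),
        forall a b, S a -> S b -> p (a * b) -> p a \/ p b,
        exists k a, [/\ (0 < k)%N, gr k a & ~ p a] &
        forall k a b, gr k a -> gr k b -> ~ p b ->
          exists c : K, p (a - cst c * b)]].

Definition proj_open (K : fieldType) (Y : Type) (gr : nat -> set (Y -> K)) :
    set (set (proj_point gr)) :=
  [set U | forall z, U z -> exists k a,
     [/\ (0 < k)%N, gr k a, ~ val z a & forall z', ~ val z' a -> U z']].

(* Regular functions are locally of the form [a / b] with [a], [b] homogeneous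
   of the same degree; [(a / b)(z) = c] means that [a - c b] lies in [z]. *)
Definition Proj (K : fieldType) (Y : Type) (gr : nat -> set (Y -> K)) : space K :=
  @Space K (proj_point gr) (@proj_open K Y gr)
    (fun U => [set f | forall z, U z -> exists V k a b,
       [/\ proj_open V, V z, V `<=` U, gr k a /\ gr k b &
           forall z' : proj_point gr, V z' ->
             ~ val z' b /\ val z' (a - cst (f z') * b)]]).

(** * GIT quotients

    [Gam] acts on [X] by [act] and on the line bundle [L] by [lin]; the quotient
    is taken by the subgroup [T] of [Gam]. *)

Section GIT.
Variables (K : fieldType) (Gam : Type) (X : space K) (L : bundle X).
Variables (act : Gam -> X -> X) (lin : forall t x, fib L x -> fib L (act t x)).
Variable T : set Gam.

Definition invariant_section (k : nat) : set (frame L -> K) :=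
  [set F | power_section k F /\
     forall t, T t -> forall (x : X) (v : frame_at L x) (w : frame_at L (act t x)),
       val w = lin t (val v) -> F (existT _ (act t x) w) = F (existT _ x v)].

Definition semistable : set X :=
  [set x | exists k F (v : frame_at L x),
     [/\ (0 < k)%N, invariant_section k F & F (existT _ x v) <> 0]].

Definition ss_incl (x : subspace semistable) : X := val x.

Definition git_quotient : space K := Proj invariant_section.

(* The quotient map sends [x] to the ideal generated by the homogeneous
   invariants vanishing at [x]. *)
Definition git_map (pi : subspace semistable -> git_quotient) : Prop :=
  forall x, val (pi x) =
    [set f | graded_sum invariant_section f /\
             forall v : frame_at L (ss_incl x), f (existT _ (ss_incl x) v) = 0].

(* [M] is a descent of [L].  In the equivariance clause, [m] ranges over
   set-theoretic sections of [M], so [m (pi x)] is an arbitrary vector of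
   [M_(pi x)]; as [pi x' = pi x], it is the same vector as [m (pi x')].  The
   action on the pullback of [M] is the trivial one on [M_(pi x)]. *)
Definition is_descent (M : bundle git_quotient) : Prop :=
  line_bundle M /\
  exists (pi : subspace semistable -> git_quotient)
         (psi : forall x, {linear fib (pullback pi M) x -> fib (pullback ss_incl L) x}),
    [/\ git_map pi, morphism pi, bundle_iso psi &
        forall t, T t -> forall x x' : subspace semistable,
          ss_incl x' = act t (ss_incl x) ->
          forall m : forall z, fib M z,
            existT (fib L) (ss_incl x') (psi x' (m (pi x'))) =
            existT (fib L) (act t (ss_incl x)) (lin t (psi x (m (pi x))))].

End GIT.

(** * Zariski topology and regular functions on subsets of matrix spaces *)

Definition mxeval (K : fieldType) (a b : nat) (p : {mpoly K[a * b]}) (y : 'M[K]_(a, b)) : K :=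
  p.@[fun i => mxvec y 0 i].

Definition zopen (K : fieldType) (a b : nat) (Y W : set 'M[K]_(a, b)) : Prop :=
  W `<=` Y /\
  forall y, W y -> exists2 p : {mpoly K[a * b]}, mxeval p y <> 0 &
    forall y', Y y' -> mxeval p y' <> 0 -> W y'.

Definition zregular (K : fieldType) (a b : nat) (W : set 'M[K]_(a, b))
    (f : 'M[K]_(a, b) -> K) : Prop :=
  forall y, W y -> exists2 pq : {mpoly K[a * b]} * {mpoly K[a * b]},
    mxeval pq.2 y <> 0 &
    forall y', W y' -> mxeval pq.2 y' <> 0 ->
      f y' = mxeval pq.1 y' / mxeval pq.2 y'.

Definition zregular_mx (K : fieldType) (a b c d : nat) (W : set 'M[K]_(a, b))
    (f : 'M[K]_(a, b) -> 'M[K]_(c, d)) : Prop :=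
  forall i j, zregular W (fun y => f y i j).

(** * Quotients [Y / H] and the line bundles attached to characters of [H]

    [H] acts on [Y] from the right by [ract], and [chi] is a character of [H].
    The points of [Y / H] are the orbits, the topology and the regular functions
    are the quotient ones. *)

Section Quotient.
Variables (K : fieldType) (a b : nat) (H : Type).
Variables (Y : set 'M[K]_(a, b)) (D : set H).
Variables (ract : 'M[K]_(a, b) -> H -> 'M[K]_(a, b)) (chi : H -> K).

Definition orbits : set (set 'M[K]_(a, b)) :=
  [set A | exists2 y, Y y & A = [set ract y h | h in D]].

Definition orbits_union (U : set orbits) : set 'M[K]_(a, b) :=
  [set y | exists2 A : orbits, U A & val A y].

Definition orbit_space : space K :=
  @Space K orbits
    [set U | zopen Y (orbits_union U)]
    (fun U => [set f | exists2 g, zregular (orbits_union U) g &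
       forall A : orbits, U A -> forall y, val A y -> g y = f A]).

(* The fibre at the orbit [A]: the functions [h] on [A] such that
   [h (y p) = chi p * h y], extended by [0] outside [A]. *)
Definition fibre_pred (A : set 'M[K]_(a, b)) : {pred 'M[K]_(a, b) -> K^o} :=
  [pred h | `[< (forall y, ~ A y -> h y = 0) /\
                (forall y p, A y -> D p -> h (ract y p) = chi p * h y) >]].

Lemma fibre_submod_closed A : submod_closed (fibre_pred A).
Proof.
split=> [|c f g]; first by apply/asboolP; split=> // y p _ _; rewrite mulr0.
move=> /asboolP[f0 f1] /asboolP[g0 g1]; apply/asboolP; split.
  by move=> y nA; rewrite -[LHS]/(c * f y + g y) f0 // g0 // mulr0 addr0.
move=> y p Ay Dp; rewrite -[LHS]/(c * f (ract y p) + g (ract y p)) f1 // g1 //.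
by rewrite mulrCA -mulrDr.
Qed.

HB.instance Definition _ A :=
  GRing.isSubmodClosed.Build K ('M[K]_(a, b) -> K^o) (fibre_pred A)
    (fibre_submod_closed A).

Definition fibre (A : set 'M[K]_(a, b)) := {h | h \in fibre_pred A}.
HB.instance Definition _ A := SubChoice.on (fibre A).
HB.instance Definition _ A := [SubChoice_isSubLmodule of fibre A by <:].

(* The line bundle [Y x^H K_(chi^-1)]: its sections are the regular functions
   [f] on open subsets of [Y] such that [f (y p) = chi p * f y]. *)
Definition assoc_bundle : bundle orbit_space :=
  @Bundle K orbit_space (fun A => fibre (val A))
    (fun U => [set s | exists2 f, zregular (orbits_union U) f &
       forall A : orbits, U A -> forall y, val A y -> f y = val (s A) y]).

End Quotient.

(** * The polarized variety [(P^(n-1), O(1))] *)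

Definition proj_space (K : fieldType) (n : nat) : space K :=
  @orbit_space K 1 n K [set v | v != 0] [set c | c != 0] (fun v c => c *: v).

Definition O1 (K : fieldType) (n : nat) : bundle (proj_space K n) :=
  @assoc_bundle K 1 n K [set v | v != 0] [set c | c != 0] (fun v c => c *: v) id.

(** * The symplectic group *)

Definition symp_form (K : fieldType) (n : nat) : 'M[K]_(n + n) :=
  block_mx 0 1%:M (- 1%:M) 0.

Definition Sp (K : fieldType) (n : nat) : set 'M[K]_(n + n) :=
  [set g | g^T *m symp_form K n *m g = symp_form K n].

Definition sp_lie (K : fieldType) (n : nat) : set 'M[K]_(n + n) :=
  [set x | x^T *m symp_form K n + symp_form K n *m x = 0].

Definition subgroup (K : fieldType) (n : nat) (H : set 'M[K]_(n + n)) : Prop :=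
  [/\ H `<=` @Sp K n, H 1%:M,
      forall g h, H g -> H h -> H (g *m h) &
      forall g, H g -> H (invmx g)].

Definition Gm (K : fieldType) (r : nat) : set 'rV[K]_r :=
  [set z | forall i, z 0 i != 0].

(* [T] is a closed subgroup of [Sp], isomorphic to [Gm^r] as an algebraic
   group for some [r]. *)
Definition torus (K : fieldType) (n : nat) (T : set 'M[K]_(n + n)) : Prop :=
  [/\ subgroup T, zopen (@Sp K n) (@Sp K n `\` T) &
      exists r (tau : 'rV[K]_r -> 'M[K]_(n + n)) (sigma : 'M[K]_(n + n) -> 'rV[K]_r),
        [/\ (forall z, Gm z -> T (tau z)) /\ (forall t, T t -> Gm (sigma t)),
            (forall z, Gm z -> sigma (tau z) = z) /\
            (forall t, T t -> tau (sigma t) = t),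
            forall z w, Gm z -> Gm w ->
              tau (map2_mx *%R z w) = tau z *m tau w,
            zregular_mx (@Gm K r) tau & zregular_mx T sigma]].

Definition maximal_torus (K : fieldType) (n : nat) (T : set 'M[K]_(n + n)) : Prop :=
  torus T /\ forall T' : set 'M[K]_(n + n), torus T' -> T `<=` T' -> T' = T.

Definition is_character (K : fieldType) (n : nat) (H : set 'M[K]_(n + n))
    (chi : 'M[K]_(n + n) -> K) : Prop :=
  [/\ forall g, H g -> chi g != 0,
      forall g h, H g -> H h -> chi (g *m h) = chi g * chi h &
      zregular H chi].

Definition weight_vector (K : fieldType) (n : nat) (T : set 'M[K]_(n + n))
    (beta : 'M[K]_(n + n) -> K) : set 'M[K]_(n + n) :=
  [set x | sp_lie x /\ forall t, T t -> t *m x *m invmx t = beta t *: x].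

Definition is_root (K : fieldType) (n : nat) (T : set 'M[K]_(n + n))
    (beta : 'M[K]_(n + n) -> K) : Prop :=
  [/\ is_character T beta, exists2 t, T t & beta t != 1 &
      exists2 x, x != 0 & weight_vector T beta x].

(** ** Roots and weights in Bourbaki coordinates

    A weight is the row of its coordinates in the basis
    [epsilon_1, ..., epsilon_n]; indices start from [0], so that
    [simple_root i] is [alpha_(i+1)]. *)

Definition eps_vec (n : nat) (i : 'I_n) : 'rV[int]_n := delta_mx 0 i.

Definition roots_C (n : nat) : set 'rV[int]_n :=
  [set v | v != 0 /\ exists (i j : 'I_n) (s s' : bool),
     v = (-1) ^+ s *: eps_vec i + (-1) ^+ s' *: eps_vec j].

Definition simple_root (n : nat) (i : 'I_n) : 'rV[int]_n :=
  match insub i.+1 : option 'I_n with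
  | Some j => eps_vec i - eps_vec j
  | None => 2 *: eps_vec i
  end.

Definition positive_root (n : nat) : set 'rV[int]_n :=
  [set v | roots_C v /\ exists c : 'I_n -> nat, v = \sum_i simple_root i *+ c i].

Definition dotz (n : nat) (u v : 'rV[int]_n) : int := (u *m v^T) 0 0.

(* [<omega, alpha_j^vee> = delta_ij], where
   [<omega, alpha^vee> = 2 (omega, alpha) / (alpha, alpha)]. *)
Definition fundamental_weight (n : nat) (i : 'I_n) (omega : 'rV[int]_n) : Prop :=
  forall j, 2 * dotz omega (simple_root j) =
            (i == j)%:R * dotz (simple_root j) (simple_root j).

Definition weight_char (K : fieldType) (n : nat) (eps : 'I_n -> 'M[K]_(n + n) -> K)
    (v : 'rV[int]_n) (t : 'M[K]_(n + n)) : K :=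
  \prod_i eps i t ^ v 0 i.

(* The characters [eps i] of [T] are coordinates in which the roots of [(Sp, T)]
   take Bourbaki's form; their choice fixes a system of simple roots, hence a
   Borel subgroup containing [T]. *)
Definition bourbaki_coordinates (K : fieldType) (n : nat) (T : set 'M[K]_(n + n))
    (eps : 'I_n -> 'M[K]_(n + n) -> K) : Prop :=
  (forall i, is_character T (eps i)) /\
  (forall beta, is_root T beta <->
     exists2 v, roots_C v & forall t, T t -> beta t = weight_char eps v t).

(* The root subgroup [exp (g_v)]; a root vector [x] of the symplectic Lie
   algebra satisfies [x *m x = 0], so that [exp x = 1 + x]. *)
Definition root_subgroup (K : fieldType) (n : nat) (T : set 'M[K]_(n + n))
    (eps : 'I_n -> 'M[K]_(n + n) -> K) (v : 'rV[int]_n) : set 'M[K]_(n + n) :=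
  [set 1%:M + x | x in weight_vector T (weight_char eps v)].

(* [P^(alpha_i)]: generated by the Borel subgroup and the root subgroups of
   [- alpha_j] for [j != i]. *)
Definition parabolic (K : fieldType) (n : nat) (T : set 'M[K]_(n + n))
    (eps : 'I_n -> 'M[K]_(n + n) -> K) (i : 'I_n) : set 'M[K]_(n + n) :=
  \bigcap_(H in [set H | [/\ subgroup H, T `<=` H,
       forall v, positive_root v -> root_subgroup T eps v `<=` H &
       forall j, j != i -> root_subgroup T eps (- simple_root j) `<=` H]]) H.

(** ** Homogeneous line bundles on [Sp / P] and their natural linearization *)

Section Homogeneous.
Variables (K : fieldType) (n : nat).
Variables (P : set 'M[K]_(n + n)) (chi : 'M[K]_(n + n) -> K).

Definition flag_variety : space K := orbit_space (@Sp K n) P mulmx.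

(* [L(lambda)], where [chi] is the character of [P] extending [lambda]; with
   this sign [L(omega_i)] is the ample generator of [Pic(G/P)] when [P] is
   [P^(alpha_i)]. *)
Definition hom_bundle : bundle flag_variety :=
  assoc_bundle (@Sp K n) P mulmx chi.

Lemma Sp_unitmx (g : 'M[K]_(n + n)) : Sp g -> g \in unitmx.
Proof.
move=> gSp; have detJ : \det (symp_form K n) != 0.
  have : symp_form K n *m (- symp_form K n) = 1%:M.
    rewrite /symp_form opp_block_mx !oppr0 opprK mulmx_block.
    rewrite !mulmx0 !mul0mx mulmxN mulNmx !mulmx1 opprK !addr0 !add0r.
    by rewrite -scalar_mx_block.
  move=> /(congr1 determinant); rewrite det_mulmx det1 => e.
  by apply/eqP => d0; move: e; rewrite d0 mul0r => /esym/eqP; rewrite oner_eq0.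
have := congr1 determinant gSp; rewrite !det_mulmx => e.
rewrite unitmxE unitfE; apply/eqP => d0.
by move: e; rewrite d0 mulr0 => /esym/eqP; rewrite (negPf detJ).
Qed.

Lemma Sp_mul (g h : 'M[K]_(n + n)) : Sp g -> Sp h -> Sp (g *m h).
Proof.
by move=> gS hS; rewrite /Sp /= trmx_mul -!mulmxA (mulmxA g^T) (mulmxA _ g)
  gS mulmxA hS.
Qed.

Definition flag_act_proof (g : @Sp K n) (A : flag_variety) :
  [set val g *m y | y in val A] \in orbits (@Sp K n) P mulmx.
Proof.
case: g A => g /set_mem gS [A /= /set_mem[y yS ->]]; apply/mem_set.
exists (g *m y); first exact: Sp_mul.
apply/seteqP; split=> z /=.
  by move=> [_ [p pP <-] <-]; exists p; rewrite ?mulmxA.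
by move=> [p pP <-]; exists (y *m p); rewrite ?mulmxA //; exists p.
Qed.

Definition flag_act (g : @Sp K n) (A : flag_variety) : flag_variety :=
  exist (fun B => B \in orbits (@Sp K n) P mulmx) _ (flag_act_proof g A).

Lemma flag_lin_proof (g : @Sp K n) (A : flag_variety) (h : fib hom_bundle A) :
  (fun y => val h (invmx (val g) *m y)) \in
    fibre_pred P mulmx chi (val (flag_act g A)).
Proof.
case: h => h /= /asboolP[h0 h1]; apply/asboolP.
have gU : val g \in unitmx by apply/Sp_unitmx/set_mem/valP.
split=> [y nA|y p [z zA <-] pP] /=.
  by apply: h0 => Ay; apply: nA; exists (invmx (val g) *m y); rewrite ?mulKVmx.
by rewrite -mulmxA !mulKmx // h1.
Qed.

(* [(g h)(y) = h (g^-1 y)] *)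
Definition flag_lin (g : @Sp K n) (A : flag_variety) (h : fib hom_bundle A) :
    fib hom_bundle (flag_act g A) :=
  exist (fun f => f \in fibre_pred P mulmx chi (val (flag_act g A))) _
    (flag_lin_proof g h).

End Homogeneous.

(* Main.v *)
(** In suitable symplectic coordinates [T] consists of the diagonal matrices
    [diag(z, z^-1)], and [P] is the stabilizer of the line of [v0], the first
    vector of the symplectic basis, so that [G / P] is the space of lines of
    [K^(2n)].  A section of [L(2 k omega_1)] is a function on [G] that is
    homogeneous of degree [2 k] in [y v0 = (x_1, ..., x_2n)].  The [T]-invariant
    ones are the homogeneous polynomials of degree [k] in the products
    [w_i = x_i x_(n+i)]: indeed, if no [x_(n+i)] vanishes, the torus moves
    [(x_i, x_(n+i))] to [(w_i, 1)], hence an invariant is determined by its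
    restriction to the slice of points [(w, 1)], and the general case follows by
    continuity along a curve.  The ring of invariants is therefore
    [K[w_1, ..., w_n]], generated in degree one and integrally closed, and the
    quotient is [P^(n-1)] with [O(1)] as a descent.  The same slice shows that a
    section of any descent is determined by its values at the points [(w, 1)], so
    that every descent is isomorphic to [O(1)]. *)

Require Import Defs.
From HB Require Import structures.
From mathcomp Require Import all_boot all_order all_algebra all_field.
From mathcomp Require Import mathcomp_extra boolp classical_sets functions reals.
From mathcomp Require Import complex mpoly ring.
Set Implicit Arguments.
Unset Strict Implicit.
Unset Printing Implicit Defensive.
Import Order.TTheory GRing.Theory Num.Theory.
Local Open Scope classical_set_scope.
Local Open Scope ring_scope.

(** * Regular functions and the Zariski topology *)

(** Regular functions are only local quotients of polynomials, and sections of powers of a descent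
    live on [K^n] minus the origin. They become polynomials through one variable: along a line
    avoiding the origin the denominator has no zero, homogeneity bounds the degree, and Lagrange
    interpolation in one coordinate after the other does the rest. Of [T] only the abstract
    definition is known. Its one-parameter subgroups are diagonalized through their torsion points,
    a Gram-Schmidt process makes the eigenbasis symplectic, maximality turns an inclusion of tori
    into an equality, and the shape of the roots matches the characters [eps] with coordinates up to
    a permutation and exchanges within symplectic pairs. That [P] is the whole stabilizer of a line
    is shown by elimination with root elements. Sections of powers of a line bundle are functions on
    its frames. Both the invariants of [L] and the sections of a descent turn out to be pullbacks of
    forms under a map from frames to [K^n], so one study of such graded rings serves twice. *)

Section OneVariable.
Variable K : numClosedFieldType.
Implicit Types (p q d : {poly K}) (h : K -> K).

Lemma poly_eq0_fun p : (forall s, p.[s] = 0) -> p = 0.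
Proof.
move=> p0; apply/eqP; apply/negPn/negP => pN0.
have := @max_poly_roots _ p [seq i%:R | i <- iota 0 (size p)] pN0.
rewrite size_map size_iota ltnn => H; suff: false by [].
apply: H; first by apply/allP => x _; apply/eqP.
by rewrite map_inj_uniq ?iota_uniq// => i j /eqP; rewrite eqr_nat => /eqP.
Qed.

Lemma poly_eq0_cofinite d p :
  d != 0 -> (forall s, d.[s] != 0 -> p.[s] = 0) -> p = 0.
Proof.
move=> dN0 p0; have /eqP : d * p = 0.
  apply: poly_eq0_fun => s; rewrite hornerM.
  by have [->|/p0 ->] := eqVneq d.[s] 0; rewrite (mul0r, mulr0).
by rewrite mulf_eq0 (negPf dN0) => /eqP.
Qed.

Lemma poly_eq_cofinite d p q :
  d != 0 -> (forall s, d.[s] != 0 -> p.[s] = q.[s]) -> p = q.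
Proof.
move=> dN0 pq; apply/eqP; rewrite -subr_eq0; apply/eqP.
apply: (poly_eq0_cofinite dN0) => s ds.
by rewrite hornerD hornerN pq // subrr.
Qed.

Lemma poly_neq0_ex p : p != 0 -> exists s, p.[s] != 0.
Proof.
move=> pN0; apply: contrapT => H; move/eqP: pN0; apply.
by apply: poly_eq0_fun => s; apply/eqP/negPn/negP => ps; apply: H; exists s.
Qed.

Lemma horner_neq0 p s : p.[s] != 0 -> p != 0.
Proof. by apply: contraNneq => ->; rewrite horner0. Qed.

Definition locally_rational (D : set K) h := forall s, D s ->
  exists p q, q.[s] != 0 /\
    forall s', D s' -> q.[s'] != 0 -> h s' = p.[s'] / q.[s'].

(** Two local fractions agree off finitely many points, so their cross products are equal
    polynomials. A zero of the reduced denominator at a point where another fraction is defined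
    would then be a zero of the numerator too, against coprimality. *)
Lemma locally_rational_frac d h : d != 0 ->
  locally_rational [set s | d.[s] != 0] h ->
  exists p q, coprimep p q /\
    forall s, d.[s] != 0 -> q.[s] != 0 /\ h s = p.[s] / q.[s].
Proof.
move=> dN0 hP; have [s0 ds0] := poly_neq0_ex dN0.
have [p0 [q0 [q0s0 h0]]] := hP _ ds0.
have q0N0 := horner_neq0 q0s0.
pose g := gcdp p0 q0.
have gN0 : g != 0 by rewrite gcdp_eq0 (negPf q0N0) andbF.
have pE : p0 = p0 %/ g * g by rewrite divpK // dvdp_gcdl.
have qE : q0 = q0 %/ g * g by rewrite divpK // dvdp_gcdr.
have cop : coprimep (p0 %/ g) (q0 %/ g) by apply: coprimep_div_gcd; rewrite q0N0 orbT.
exists (p0 %/ g), (q0 %/ g); split=> // s ds.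
have [p1 [q1 [q1s h1]]] := hP _ ds.
have q1N0 := horner_neq0 q1s.
have E : p0 %/ g * q1 = p1 * (q0 %/ g).
  apply: (mulIf gN0); rewrite mulrAC -pE -mulrA -qE.
  have dqN0 : d * q0 * q1 != 0 by rewrite !mulf_neq0.
  apply: (poly_eq_cofinite dqN0) => s'.
  rewrite !hornerM !mulf_eq0 !negb_or => /andP[/andP[ds' qs'] q1s'].
  have := h1 _ ds' q1s'; rewrite (h0 _ ds' qs') => /eqP.
  by rewrite eqr_div // => /eqP.
have qs : (q0 %/ g).[s] != 0.
  apply/negP => /eqP qs; have := congr1 (horner^~ s) E.
  rewrite !hornerM qs mulr0 => /eqP; rewrite mulf_eq0 (negPf q1s) orbF => ps.
  by have := coprimep_root cop ps; rewrite qs eqxx.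
split=> //; rewrite h1 //; apply/eqP; rewrite eqr_div // -!hornerM.
by rewrite -E.
Qed.

(** A reduced denominator without zeros is constant over an algebraically closed field. *)
Lemma locally_rational_poly h :
  locally_rational setT h -> exists p, forall s, h s = p.[s].
Proof.
move=> hP; have [|p [q [_ pq]]] := @locally_rational_frac 1 h (oner_neq0 _).
  move=> s _; have [//|p [q [qs H]]] := hP s.
  by exists p, q; split=> // s' _; apply: H.
have qC : size q == 1%N.
  apply: contraT => /closed_rootP[s /eqP qs].
  by have [] := pq s; rewrite ?hornerC ?oner_eq0 // qs eqxx.
have [c cN0 qE] := size_poly1P _ qC.
exists (c^-1 *: p) => s; have [] := pq s; rewrite ?hornerC ?oner_eq0 //.
by rewrite qE hornerC hornerZ mulrC.
Qed.

End OneVariable.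

Section ZariskiRegular.
Variable K : numClosedFieldType.
Variables a b : nat.
Implicit Types (W : set 'M[K]_(a, b)) (f g : 'M[K]_(a, b) -> K).

(** An induction principle for substitution into polynomials: [A] will be a class of regular or
    polynomial functions, a subalgebra, or the congruence of two functions modulo an ideal. *)
Lemma mxeval_ind (X : Type) (A : set (X -> K)) (G : X -> 'M[K]_(a, b))
    (p : {mpoly K[a * b]}) :
  (forall c, A (fun=> c)) ->
  (forall h h', A h -> A h' -> A (fun x => h x + h' x)) ->
  (forall h h', A h -> A h' -> A (fun x => h x * h' x)) ->
  (forall i j, A (fun x => G x i j)) -> A (fun x => mxeval p (G x)).
Proof.
move=> Ac Aa Am AG; rewrite /mxeval.
have -> : (fun x => p.@[fun i => mxvec (G x) 0 i]) =
    (fun x => \sum_(m <- msupp p) p@_m * \prod_i mxvec (G x) 0 i ^+ m i).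
  by apply/funext => x; rewrite mevalE.
elim: (msupp p : seq _) => [|m s IH].
  by under eq_fun do rewrite big_nil; exact: Ac.
under eq_fun do rewrite big_cons.
apply: (Aa _ _ _ IH); apply: (Am); first exact: Ac.
elim: (index_enum _) => [|i r IHr].
  by under eq_fun do rewrite big_nil; exact: Ac.
under eq_fun do rewrite big_cons.
apply: (Am _ _ _ IHr) => {IHr}; elim: (m i) => [|k IHk].
  by under eq_fun do rewrite expr0; exact: Ac.
under eq_fun do rewrite exprS.
apply: (Am _ _ _ IHk) => {IHk}; case: (mxvec_indexP i) => i1 i2.
by under eq_fun do rewrite mxvecE; exact: AG.
Qed.

Definition polyfun f := exists p, forall y, f y = mxeval p y.

Lemma mxevalD p q (y : 'M[K]_(a, b)) : mxeval (p + q) y = mxeval p y + mxeval q y.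
Proof. exact: mevalD. Qed.

Lemma mxevalM p q (y : 'M[K]_(a, b)) : mxeval (p * q) y = mxeval p y * mxeval q y.
Proof. exact: mevalM. Qed.

Lemma mxevalC c (y : 'M[K]_(a, b)) : mxeval c%:MP y = c.
Proof. exact: mevalC. Qed.

Lemma polyfun_const c : polyfun (fun=> c).
Proof. by exists c%:MP => y; rewrite mxevalC. Qed.

Lemma polyfunD f g : polyfun f -> polyfun g -> polyfun (fun y => f y + g y).
Proof. by move=> [p fE] [q gE]; exists (p + q) => y; rewrite mxevalD fE gE. Qed.

Lemma polyfunM f g : polyfun f -> polyfun g -> polyfun (fun y => f y * g y).
Proof. by move=> [p fE] [q gE]; exists (p * q) => y; rewrite mxevalM fE gE. Qed.

Lemma polyfun_sum I (r : seq I) (P : pred I) (f : I -> 'M[K]_(a, b) -> K) :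
  (forall i, polyfun (f i)) -> polyfun (fun y => \sum_(i <- r | P i) f i y).
Proof.
move=> fP; elim: r => [|i r IH].
  by under eq_fun do rewrite big_nil; exact: polyfun_const.
under eq_fun do rewrite big_cons.
by case: (P i) => //; exact: polyfunD.
Qed.

Lemma polyfunX f k : polyfun f -> polyfun (fun y => f y ^+ k).
Proof.
move=> fP; elim: k => [|k IH]; first exact: polyfun_const.
by under eq_fun do rewrite exprS; exact: polyfunM.
Qed.

Lemma polyfun_entry i j : polyfun (fun y => y i j).
Proof. by exists 'X_(mxvec_index i j) => y; rewrite /mxeval mevalXU mxvecE. Qed.

Lemma zregularP W f : zregular W f <-> forall y, W y ->
  exists p q, [/\ polyfun p, polyfun q, q y <> 0 &
    forall y', W y' -> q y' <> 0 -> f y' = p y' / q y'].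
Proof.
split=> fP y /fP.
  move=> [[p q] /= qy fE]; exists (mxeval p), (mxeval q).
  by split=> //; [exists p|exists q].
move=> [p [q [[p' pE] [q' qE] qy fE]]]; exists (p', q') => /=; rewrite -?qE //.
by move=> y' Wy'; rewrite -pE -qE; exact: fE.
Qed.

Lemma zregular_polyfun W f : polyfun f -> zregular W f.
Proof.
move=> fP; apply/zregularP => y _; exists f, (fun=> 1); split=> //.
- exact: polyfun_const.
- by apply/eqP; rewrite oner_eq0.
- by move=> y' _ _; rewrite divr1.
Qed.

Lemma zregular_sub W W' f : W `<=` W' -> zregular W' f -> zregular W f.
Proof.
move=> WW' fP y /WW' /fP[pq qy fE]; exists pq => // y' /WW'; exact: fE.
Qed.

Lemma zregular_eq W f g : (forall y, W y -> f y = g y) -> zregular W f -> zregular W g.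
Proof.
move=> fg fP y Wy; have [pq qy fE] := fP _ Wy; exists pq => // y' Wy' qy'.
by rewrite -fg // fE.
Qed.

Lemma zregularD W f g : zregular W f -> zregular W g -> zregular W (fun y => f y + g y).
Proof.
move=> fP gP y Wy.
have [[p q] /= qy fE] := fP _ Wy; have [[p' q'] /= qy' gE] := gP _ Wy.
exists (p * q' + p' * q, q * q') => /=.
  by rewrite mxevalM; apply/eqP/mulf_neq0; apply/eqP.
move=> y' Wy'; rewrite mxevalM => /eqP; rewrite mulf_eq0 negb_or => /andP[/eqP h1 /eqP h2].
by rewrite fE // gE // addf_div ?mxevalD ?mxevalM //; apply/eqP.
Qed.

Lemma zregularM W f g : zregular W f -> zregular W g -> zregular W (fun y => f y * g y).
Proof.
move=> fP gP y Wy.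
have [[p q] /= qy fE] := fP _ Wy; have [[p' q'] /= qy' gE] := gP _ Wy.
exists (p * p', q * q') => /=.
  by rewrite mxevalM; apply/eqP/mulf_neq0; apply/eqP.
move=> y' Wy'; rewrite mxevalM => /eqP; rewrite mulf_eq0 negb_or => /andP[/eqP h1 /eqP h2].
by rewrite fE // gE // mulf_div ?mxevalM //; apply/eqP.
Qed.

Lemma zregularV W f : (forall y, W y -> f y != 0) ->
  zregular W f -> zregular W (fun y => (f y)^-1).
Proof.
move=> fN0 fP y Wy.
have [[p q] /= qy fE] := fP _ Wy; exists (q * q, p * q) => /=.
  rewrite mxevalM; apply/eqP/mulf_neq0; last exact/eqP.
  by have := fN0 _ Wy; rewrite fE // mulf_eq0 negb_or => /andP[].
move=> y' Wy'; rewrite mxevalM => /eqP; rewrite mulf_eq0 negb_or => /andP[/eqP h1 /eqP h2].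
by rewrite fE // invf_div !mxevalM -mulf_div divff ?mulr1 //; apply/eqP.
Qed.

Lemma zregularX W f k : zregular W f -> zregular W (fun y => f y ^+ k).
Proof.
move=> fP; elim: k => [|k IH]; first by apply: zregular_polyfun; exact: polyfun_const.
by under eq_fun do rewrite exprS; exact: zregularM.
Qed.

End ZariskiRegular.

Section Composition.
Variable K : numClosedFieldType.
Variables a b c d : nat.
Implicit Types (W : set 'M[K]_(a, b)) (G : 'M[K]_(a, b) -> 'M[K]_(c, d)).

Definition polymap G := forall i j, polyfun (fun y => G y i j).

Lemma zregular_mxeval (p : {mpoly K[c * d]}) W G :
  zregular_mx W G -> zregular W (fun y => mxeval p (G y)).
Proof.
move=> GP; apply: (@mxeval_ind _ _ _ _ (zregular W)) => //.
- by move=> e; apply: zregular_polyfun; exact: polyfun_const.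
- exact: zregularD.
- exact: zregularM.
Qed.

Lemma polyfun_comp (f : 'M[K]_(c, d) -> K) G :
  polymap G -> polyfun f -> polyfun (f \o G).
Proof.
move=> GP [p fE]; have -> : f \o G = fun y => mxeval p (G y).
  by apply/funext => y /=; rewrite fE.
apply: (@mxeval_ind _ _ _ _ (@polyfun K a b)) => //.
- exact: polyfun_const.
- exact: polyfunD.
- exact: polyfunM.
Qed.

Lemma zregular_comp W (W' : set 'M[K]_(c, d)) (f : 'M[K]_(c, d) -> K) G :
  polymap G -> (forall y, W y -> W' (G y)) -> zregular W' f -> zregular W (f \o G).
Proof.
move=> GP GW /zregularP fP; apply/zregularP => y Wy.
have [p [q [pP qP qy fE]]] := fP _ (GW _ Wy).
exists (p \o G), (q \o G); split=> //; try exact: polyfun_comp.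
by move=> y' Wy' /=; apply: fE; exact: GW.
Qed.

End Composition.

Section Curves.
Variable K : numClosedFieldType.
Variables a b : nat.
Implicit Types (W : set 'M[K]_(a, b)) (M : K -> 'M[K]_(a, b)).

Definition polycurve M := forall i j, exists p : {poly K}, forall s, M s i j = p.[s].

Lemma polyfun_curve f M : polycurve M -> polyfun f ->
  exists p : {poly K}, forall s, f (M s) = p.[s].
Proof.
move=> MP [q fE].
have -> : (exists p : {poly K}, forall s, f (M s) = p.[s]) =
          (exists p : {poly K}, forall s, mxeval q (M s) = p.[s]).
  by under eq_fun do under eq_forall do rewrite fE.
apply: (@mxeval_ind K a b K (fun h => exists p : {poly K}, forall s, h s = p.[s])).
- by move=> c; exists c%:P => s; rewrite hornerC.
- by move=> f1 f2 [p1 E1] [p2 E2]; exists (p1 + p2) => s; rewrite hornerD E1 E2.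
- by move=> f1 f2 [p1 E1] [p2 E2]; exists (p1 * p2) => s; rewrite hornerM E1 E2.
- exact: MP.
Qed.

Lemma zregular_curve W f M (D : set K) : polycurve M -> (forall s, D s -> W (M s)) ->
  zregular W f -> locally_rational D (f \o M).
Proof.
move=> MP DW /zregularP fP s Ds; have [p [q [pP qP qy fE]]] := fP _ (DW _ Ds).
have [p' pE] := polyfun_curve MP pP; have [q' qE] := polyfun_curve MP qP.
exists p', q'; rewrite -qE; split; first exact/eqP.
by move=> s' Ds'; rewrite -qE -pE => /eqP; apply: fE; exact: DW.
Qed.

End Curves.

Section ZariskiOpen.
Variable K : numClosedFieldType.
Variables a b : nat.
Implicit Types (Y W : set 'M[K]_(a, b)) (f : 'M[K]_(a, b) -> K).

Lemma zopenP Y W : zopen Y W <-> W `<=` Y /\ forall y, W y ->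
  exists p, [/\ polyfun p, p y <> 0 & forall y', Y y' -> p y' <> 0 -> W y'].
Proof.
split=> -[WY WP]; split=> // y /WP.
  by move=> [p py pW]; exists (mxeval p); split=> //; exists p.
move=> [p [[q pE] py pW]]; exists q; first by rewrite -pE.
by move=> y' Yy'; rewrite -pE; exact: pW.
Qed.

Lemma zopenI Y W W' : zopen Y W -> zopen Y W' -> zopen Y (W `&` W').
Proof.
move=> /zopenP[WY WP] /zopenP[W'Y W'P]; apply/zopenP; split=> [y [/WY]//|y [Wy W'y]].
have [p [pP py pW]] := WP _ Wy; have [q [qP qy qW]] := W'P _ W'y.
exists (fun y => p y * q y); split; first exact: polyfunM.
  by apply/eqP/mulf_neq0; apply/eqP.
move=> y' Yy' /eqP; rewrite mulf_eq0 negb_or => /andP[/eqP h1 /eqP h2].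
by split; [exact: pW|exact: qW].
Qed.

Lemma zopenT Y : zopen Y Y.
Proof.
apply/zopenP; split=> // y Yy; exists (fun=> 1); split=> //.
  exact: polyfun_const.
by apply/eqP; rewrite oner_eq0.
Qed.

Lemma zopen_local Y W : (forall y, W y -> exists W', [/\ zopen Y W', W' y & W' `<=` W]) ->
  zopen Y W.
Proof.
move=> H; apply/zopenP; split=> [y /H[W' [[W'Y _] W'y _]]|y /H[W' [/zopenP[_ W'P] W'y W'W]]].
  exact: W'Y.
have [p [pP py pW]] := W'P _ W'y; exists p; split=> // y' Yy' py'.
by apply: W'W; exact: pW.
Qed.

Lemma zopen_poly Y f : polyfun f -> zopen Y [set y | Y y /\ f y != 0].
Proof.
move=> fP; apply/zopenP; split=> [y []//|y [Yy fy]]; exists f; split=> //.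
  exact/eqP.
by move=> y' Yy' /eqP.
Qed.

Lemma zregular_local Y W f :
  (forall y, W y -> exists W' g, [/\ zopen Y W', W' y, zregular (W `&` W') g &
    forall y', W y' -> W' y' -> f y' = g y']) -> W `<=` Y -> zregular W f.
Proof.
move=> H WY; apply/zregularP => y Wy; have [W' [g [/zopenP[_ W'P] W'y gP fg]]] := H _ Wy.
have [p [pP py pW]] := W'P _ W'y.
have /zregularP/(_ _ (conj Wy W'y))[u [v [uP vP vy gE]]] := gP.
(* The fraction [u / v] is valid only inside [W']. The factor [p], which vanishes on [Y] outside
   [W'], makes the denominator exclude the rest of [W]. *)
exists (fun y => u y * p y), (fun y => v y * p y); split; try exact: polyfunM.
  by apply/eqP/mulf_neq0; apply/eqP.
move=> y' Wy' /eqP; rewrite mulf_eq0 negb_or => /andP[/eqP h1 /eqP h2].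
have W'y' : W' y' by apply: pW => //; exact: WY.
rewrite fg // gE // -mulf_div divff ?mulr1 //; exact/eqP.
Qed.

Lemma zopen_trans Y Y' W : zopen Y Y' -> zopen Y' W -> zopen Y W.
Proof.
move=> /zopenP[Y'Y Y'P] /zopenP[WY WP]; apply/zopenP; split=> [y /WY/Y'Y//|y Wy].
have [p [pP py pW]] := WP _ Wy; have [q [qP qy qW]] := Y'P _ (WY _ Wy).
exists (fun y => p y * q y); split; first exact: polyfunM.
  by apply/eqP/mulf_neq0; apply/eqP.
move=> y' Yy' /eqP; rewrite mulf_eq0 negb_or => /andP[/eqP h1 /eqP h2].
by apply: pW => //; exact: qW.
Qed.

End ZariskiOpen.

Lemma zopen_preimage (K : numClosedFieldType) (a b c d : nat) (Y' W' : set 'M[K]_(c, d))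
    (Y : set 'M[K]_(a, b)) (G : 'M[K]_(a, b) -> 'M[K]_(c, d)) :
  polymap G -> zopen Y' W' -> zopen [set y | Y y /\ Y' (G y)] [set y | Y y /\ W' (G y)].
Proof.
move=> GP /zopenP[WY WP]; apply/zopenP; split=> [y [Yy /WY]//|y [Yy /WP[p [pP py pW]]]].
exists (p \o G); split=> //; first exact: polyfun_comp.
by move=> y' [Yy' Y'y'] py'; split=> //; exact: pW.
Qed.


(** * Polynomial functions *)

Section MpolyFunctions.
Variable K : numClosedFieldType.
Variable m : nat.
Implicit Types (p q : {mpoly K[m]}) (v : 'I_m -> K).

Lemma coef_sum_Xn (I : eqType) (r : seq I) (c : I -> K) (e : I -> nat) d :
  (\sum_(i <- r) c i *: 'X^(e i) : {poly K})`_d = \sum_(i <- r | e i == d) c i.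
Proof.
rewrite coef_sum [RHS]big_mkcond /=; apply: eq_bigr => i _.
by rewrite coefZ coefXn eq_sym; case: eqP => _; rewrite ?mulr1 ?mulr0.
Qed.

Lemma horner_sum_Xn (I : eqType) (r : seq I) (c : I -> K) (e : I -> nat) s :
  (\sum_(i <- r) c i *: 'X^(e i) : {poly K}).[s] = \sum_(i <- r) c i * s ^+ e i.
Proof. by rewrite horner_sum; apply: eq_bigr => i _; rewrite hornerZ hornerXn. Qed.

(** The variables are separated one at a time: scaling the variable of index [j] by [s] gives a
    polynomial in [s] that vanishes identically, and its coefficient of degree [t0 j] is the partial
    sum over the exponents that agree with [t0] up to [j]. *)
Lemma monomial_sum_inj (r : seq 'X_{1..m}) (c : 'X_{1..m} -> K) :
  uniq r -> (forall v, \sum_(t <- r) c t * \prod_i v i ^+ t i = 0) ->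
  forall t, t \in r -> c t = 0.
Proof.
move=> ur r0 t0 t0r.
have H j : (j <= m)%N -> forall v,
    \sum_(t <- r | [forall i : 'I_m, (i < j)%N ==> (t i == t0 i)])
      c t * \prod_i v i ^+ t i = 0.
  elim: j => [_ v|j IH jm v].
    rewrite -[RHS](r0 v); apply: eq_bigl => t; apply/forallP => i.
    by rewrite ltn0.
  pose jo := Ordinal jm.
  pose Q := [pred t : 'X_{1..m} | [forall i : 'I_m, (i < j)%N ==> (t i == t0 i)]].
  pose A : {poly K} := \sum_(t <- [seq t <- r | Q t])
    (c t * \prod_i v i ^+ t i) *: 'X^(t jo).
  have A0 : A = 0.
    apply: poly_eq0_fun => s; rewrite horner_sum_Xn big_filter.
    rewrite -[RHS](IH (ltnW jm) (fun i => if i == jo then s * v i else v i)).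
    apply: eq_bigr => t _; rewrite -mulrA; congr (_ * _).
    rewrite (bigD1 jo) //= [in RHS](bigD1 jo) //= eqxx exprMn mulrC mulrA.
    by congr (_ * _); apply: eq_bigr => i /negPf ->.
  have := congr1 (fun P : {poly K} => P`_(t0 jo)) A0.
  rewrite coef0 coef_sum_Xn big_filter_cond => {2}<-.
  apply: eq_bigl => t; apply/forallP/andP => [tP|[/forallP tP tj] i].
    split; last by have := tP jo; rewrite ltnS leqnn.
    by apply/forallP => i; apply/implyP => ij; have := tP i; rewrite ltnS (ltnW ij).
  apply/implyP; rewrite ltnS leq_eqVlt => /orP[/eqP ij|ij].
    by have -> : i = jo by apply: val_inj.
  by have := tP i; rewrite ij.
have := H _ (leqnn m) (fun=> 1).
rewrite (eq_bigl (pred1 t0)) => [|t] /=; last first.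
  apply/forallP/eqP => [tP|-> i]; last by rewrite eqxx implybT.
  by apply/mnmP => i; have := tP i; rewrite ltn_ord => /eqP.
rewrite -big_filter filter_pred1_uniq // big_seq1.
by rewrite big1 ?mulr1 // => i _; rewrite expr1n.
Qed.

Lemma meval_inj0 p : (forall v, p.@[v] = 0) -> p = 0.
Proof.
move=> p0; apply/mpolyP => t; rewrite mcoeff0.
have [tp|] := boolP (t \in msupp p); last exact: memN_msupp_eq0.
apply: (monomial_sum_inj (c := fun t => p@_t) (msupp_uniq p) _ tp) => v.
by rewrite -[RHS](p0 v) mevalE.
Qed.

Lemma meval_pihomog d p v :
  (pihomog mdeg d p).@[v] = \sum_(t <- msupp p | mdeg t == d) p@_t * \prod_i v i ^+ t i.
Proof.
by rewrite pihomogE rmorph_sum /=; apply: eq_bigr => t _; rewrite mevalZ mevalX.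
Qed.

(** The restriction of [p] to the line of [v]. Its coefficients are the values at [v] of the
    homogeneous components of [p], which reduces questions of homogeneity to one variable. *)
Definition ray_poly p v : {poly K} :=
  \sum_(t <- msupp p) (p@_t * \prod_i v i ^+ t i) *: 'X^(mdeg t).

Lemma horner_ray_poly p v s : (ray_poly p v).[s] = p.@[fun i => s * v i].
Proof.
rewrite horner_sum_Xn mevalE; apply: eq_bigr => t _.
rewrite -mulrA; congr (_ * _); rewrite mdegE expr_sum -big_split /=.
by apply: eq_bigr => i _; rewrite exprMn mulrC.
Qed.

Lemma coef_ray_poly p v d : (ray_poly p v)`_d = (pihomog mdeg d p).@[v].
Proof. by rewrite coef_sum_Xn meval_pihomog. Qed.

Lemma meval_homog_scale d p v c : p \is d.-homog ->
  p.@[fun i => c * v i] = c ^+ d * p.@[v].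
Proof.
move=> /dhomogP hp; rewrite !mevalE mulr_sumr !big_seq; apply: eq_bigr => t tp.
have <- : mdeg t = d := hp t tp.
rewrite mulrCA; congr (_ * _); rewrite mdegE expr_sum -big_split /=.
by apply: eq_bigr => i _; rewrite exprMn.
Qed.

End MpolyFunctions.

(** * Interpolation of functions that are polynomial along lines *)

Section Interpolation.
Variable K : numClosedFieldType.
Variable m : nat.
Implicit Types (v w : 'rV[K]_m) (phi psi : 'rV[K]_m -> K) (s : K).

Definition upd v (j : 'I_m) s : 'rV[K]_m := \row_i (if i == j then s else v 0 i).

Definition mpolyfun phi := exists p : {mpoly K[m]}, forall v, phi v = p.@[v 0].

Lemma mpolyfun_const c : mpolyfun (fun=> c).
Proof. by exists c%:MP => v; rewrite mevalC. Qed.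

Lemma mpolyfunM phi psi : mpolyfun phi -> mpolyfun psi -> mpolyfun (fun v => phi v * psi v).
Proof. by move=> [p pE] [q qE]; exists (p * q) => v; rewrite mevalM pE qE. Qed.

Lemma mpolyfun_sum I (r : seq I) (F : I -> 'rV[K]_m -> K) :
  (forall i, mpolyfun (F i)) -> mpolyfun (fun v => \sum_(i <- r) F i v).
Proof.
move=> FP; elim: r => [|i r [p pE]].
  by under eq_fun do rewrite big_nil; exact: mpolyfun_const.
have [q qE] := FP i; exists (q + p) => v; by rewrite big_cons mevalD qE pE.
Qed.

Lemma mpolyfun_horner (P : {poly K}) j : mpolyfun (fun v => P.[v 0 j]).
Proof.
exists ((map_poly (@mpolyC m K) P).['X_j]) => v.
rewrite -(horner_map (meval (v 0))) /= mevalXU -map_poly_comp /=.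
by rewrite map_poly_id // => c _ /=; rewrite mevalC.
Qed.

(** The bound [k] is uniform, so the same [k + 1] nodes serve on every coordinate line: Lagrange
    interpolation in one variable expresses [phi] through its values at the nodes, which are
    functions of fewer variables. *)
Lemma mpolyfun_interpolation (k : nat) phi :
  (forall v j, exists2 p : {poly K}, (size p <= k.+1)%N &
     forall s, phi (upd v j s) = p.[s]) ->
  mpolyfun phi.
Proof.
move=> phiP.
(* Induction on the number [j] of leading coordinates on which the function depends. *)
suff H j : (j <= m)%N -> forall psi, (forall v i, exists2 p : {poly K},
     (size p <= k.+1)%N & forall s, psi (upd v i s) = p.[s]) ->
   (forall v w, (forall i : 'I_m, (i < j)%N -> v 0 i = w 0 i) -> psi v = psi w) ->
   mpolyfun psi.
  apply: (H m (leqnn m) phi phiP) => v w vw; congr phi.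
  by apply/rowP => i; exact: vw.
elim: j => [_|j IH jm] psi psiP psiE.
  have [p pE] := mpolyfun_const (psi 0); exists p => v; rewrite -pE.
  by apply: psiE => i; rewrite ltn0.
pose jo := Ordinal jm; pose x (i : nat) : K := i%:R.
have xI : injective x by move=> a b /eqP; rewrite eqr_nat => /eqP.
have [q qE] : mpolyfun (fun v => \sum_(i < k.+1) psi (upd v jo (x i)) *
    (tnth (lagrange k.+1 x) i : {poly K}).[v 0 jo]).
  apply: mpolyfun_sum => i; apply: mpolyfunM; last exact: mpolyfun_horner.
  apply: IH (ltnW jm) _ _ _ => [v l|v w vw].
    have [->|lj] := eqVneq l jo.
      exists (psi (upd v jo (x i)))%:P; first by rewrite (leq_trans (size_polyC_leq1 _)).
      by move=> s; rewrite hornerC; congr psi; apply/rowP => a; rewrite !mxE; case: eqP.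
    have [p sp pE] := psiP (upd v jo (x i)) l; exists p => // s; rewrite -pE; congr psi.
    apply/rowP => a; rewrite !mxE; have [->|//] := eqVneq a jo.
    by rewrite eq_sym (negPf lj).
  apply: psiE => a; rewrite !mxE ltnS leq_eqVlt.
  have [//|aj] := eqVneq a jo; case/orP => [/eqP e|/vw//].
  by move: aj; rewrite -val_eqE /= e eqxx.
exists q => v; rewrite -qE; have [p sp pE] := psiP v jo.
have -> : psi v = p.[v 0 jo].
  rewrite -pE; congr psi; apply/rowP => a; rewrite !mxE.
  by case: eqP => // ->.
rewrite [in LHS](lagrange_gen (ltn0Sn k) xI sp) horner_sum; apply: eq_bigr => i _.
by rewrite hornerM hornerC pE.
Qed.

End Interpolation.

Section HomogeneousInterpolation.
Variable K : numClosedFieldType.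
Variable m : nat.
Hypothesis m0 : (0 < m)%N.
Variables (k : nat) (phi : 'rV[K]_m -> K).
Implicit Types (a b v : 'rV[K]_m).
Hypothesis phiZ : forall c v, c != 0 -> v != 0 -> phi (c *: v) = c ^+ k * phi v.
Hypothesis phi_line : forall a b, (forall s : K, a + s *: b != 0) ->
  exists p : {poly K}, forall s, phi (a + s *: b) = p.[s].

(* By homogeneity, [s |-> phi (a + s b)] and [s |-> phi (b + s a)] are exchanged by
   [s |-> s^-1] up to the factor [s^k]; as both are polynomials, their degrees are
   at most [k]. *)
Lemma phi_line_size a b : a != 0 -> (forall s : K, b + s *: a != 0) ->
  exists2 p : {poly K}, (size p <= k.+1)%N & forall s, phi (a + s *: b) = p.[s].
Proof.
move=> aN0 baN0.
have abN0 s : a + s *: b != 0.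
  have [->|sN0] := eqVneq s 0; first by rewrite scale0r addr0.
  have -> : a + s *: b = s *: (b + s^-1 *: a).
    by rewrite scalerDr scalerA divff // scale1r addrC.
  by rewrite scaler_eq0 (negPf sN0) baN0.
have [p pE] := phi_line abN0; have [q qE] := phi_line baN0.
exists p => //; rewrite leqNgt; apply/negP => kp.
have pN0 : p != 0 by apply: contraTneq kp => ->; rewrite size_poly0.
set d := size p in kp.
pose r : {poly K} := \poly_(i < d) p`_(d.-1 - i).
have dP : (0 < d)%N by apply: leq_trans kp.
have rE : r = 'X^(d.-1 - k) * q.
  apply: (@poly_eq_cofinite _ 'X) => [|s]; first by rewrite polyX_eq0.
  rewrite hornerX => sN0; rewrite hornerM hornerXn -qE.
  have -> : b + s *: a = s *: (a + s^-1 *: b).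
    by rewrite scalerDr scalerA divff // scale1r addrC.
  rewrite phiZ // pE mulrA -exprD subnK; last by rewrite -ltnS prednK // ltnW.
  rewrite horner_poly [p.[_]]horner_coef mulr_sumr (reindex_inj rev_ord_inj) /=.
  apply: eq_bigr => i _; have id : (i <= d.-1)%N by rewrite -ltnS prednK.
  have -> : (d - i.+1 = d.-1 - i)%N by rewrite subnS -subn1 -subn1 subnAC.
  rewrite subKn // mulrCA; congr (_ * _).
  rewrite exprVn; apply: (mulIf (expf_neq0 i sN0)).
  by rewrite mulfVK ?expf_neq0 // -exprD subnK.
have := congr1 (fun P : {poly K} => P`_0) rE.
rewrite /= coef_poly dP subn0 coefXnM.
have -> : (0 < d.-1 - k)%N by rewrite subn_gt0 -ltnS prednK.
by move/eqP; rewrite -/(lead_coef p) lead_coef_eq0 (negPf pN0).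
Qed.

(** Coordinate lines that avoid the origin are covered by [phi_line_size]; those through it are
    coordinate axes, on which homogeneity gives a monomial. The interpolating polynomial agrees with
    [phi] off the origin, hence so does its component of degree [k]. *)
Lemma homog_line_mpoly : exists q : {mpoly K[m]}, q \is k.-homog /\
  forall v, v != 0 -> phi v = q.@[v 0].
Proof.
pose e j : 'rV[K]_m := delta_mx 0 j.
have updE v j s : upd v j s = upd v j 0 + s *: e j.
  apply/rowP => i; rewrite !mxE eqxx /=; case: eqP => _ /=.
    by rewrite mulr1 add0r.
  by rewrite mulr0 addr0.
have eN0 j : e j != 0.
  by apply/eqP => /rowP/(_ j); rewrite !mxE !eqxx => /eqP; rewrite oner_eq0.
have indep v j : upd v j 0 != 0 -> forall s : K, e j + s *: upd v j 0 != 0.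
  move=> _ s; apply/eqP => /rowP/(_ j); rewrite !mxE !eqxx mulr0 addr0 => /eqP.
  by rewrite oner_eq0.
(* The value at the origin has to extend the monomial found on each axis: [0] if [k > 0], the common
   constant if [k = 0]. *)
pose phi' v := if v == 0 then (if k == 0%N then phi (e (Ordinal m0)) else 0) else phi v.
have [q qE] : mpolyfun phi'.
  apply: (@mpolyfun_interpolation _ _ k) => v j.
  have [v0|vN0] := eqVneq (upd v j 0) 0; last first.
    have [p sp pE] := phi_line_size vN0 (indep _ _ vN0); exists p => // s.
    rewrite -pE updE /phi' ifN //; apply/eqP => H.
    have [i vi] : exists i, upd v j 0 0 i != 0.
      apply: contrapT => H'; move/eqP: vN0; apply; apply/rowP => i; rewrite [RHS]mxE.
      by apply/eqP/negPn/negP => ?; apply: H'; exists i.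
    have ij : i != j by apply: contraNneq vi => ->; rewrite mxE eqxx.
    move/rowP/(_ i): H; rewrite [LHS]mxE [RHS]mxE [X in _ + X]mxE [X in s * X]mxE /= (negPf ij).
    by rewrite mulr0 addr0 => /eqP; apply/negP.
  have ve s : upd v j s = s *: e j by rewrite updE v0 add0r.
  have [k0|kN0] := eqVneq k 0%N.
    (* Along the line through [e i] and [e j] the degree is at most [k = 0], so [phi] takes the same
       value at all basis vectors. *)
    have phie : phi (e j) = phi (e (Ordinal m0)).
      set i := Ordinal m0; have [-> //|ji] := eqVneq j i.
      have [|p] := @phi_line_size (e i) (e j - e i) (eN0 i).
        move=> s; apply/eqP => /rowP/(_ j); rewrite !mxE !eqxx /= (negPf ji).
        by rewrite oppr0 mulr0 !addr0 => /eqP; rewrite oner_eq0.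
      rewrite k0 => /size1_polyC -> pE.
      have := pE 1; rewrite scale1r addrCA subrr addr0 => ->.
      by have := pE 0; rewrite scale0r addr0 !hornerC => ->.
    exists (phi (e (Ordinal m0)))%:P; first by rewrite (leq_trans (size_polyC_leq1 _)).
    move=> s; rewrite ve hornerC /phi' k0 eqxx.
    have [//|] := eqVneq (s *: e j) 0; rewrite scaler_eq0 negb_or => /andP[sN0 _].
    by rewrite phiZ // k0 mul1r.
  exists (phi (e j) *: 'X^k); first by rewrite (leq_trans (size_scale_leq _ _)) ?size_polyXn.
  move=> s; rewrite ve hornerZ hornerXn /phi' scaler_eq0 (negPf (eN0 j)) orbF (negPf kN0).
  have [->|sN0] := eqVneq s 0; first by rewrite expr0n (negPf kN0) mulr0.
  by rewrite phiZ // mulrC.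
exists (pihomog mdeg k q); split; first exact: pihomogP.
move=> v vN0; rewrite -coef_ray_poly.
have -> : ray_poly q (v 0) = phi v *: 'X^k.
  apply: (@poly_eq_cofinite _ 'X) => [|s]; first by rewrite polyX_eq0.
  rewrite hornerX horner_ray_poly hornerZ hornerXn => sN0.
  rewrite mulrC -phiZ //.
  have -> : phi (s *: v) = phi' (s *: v) by rewrite /phi' ifN // scaler_eq0 negb_or sN0.
  by rewrite qE; apply: meval_eq => i; rewrite mxE.
by rewrite coefZ coefXn eqxx mulr1.
Qed.

End HomogeneousInterpolation.

(** * Integral closedness of polynomial rings *)

Section IntegrallyClosed.
Variable K : numClosedFieldType.

Lemma rmorph_integral (A B : comNzRingType) (f : {rmorphism A -> B}) (a b : A) m
    (c : 'I_m -> A) : a ^+ m + \sum_(i < m) c i * a ^+ i * b ^+ (m - i) = 0 ->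
  f a ^+ m + \sum_(i < m) f (c i) * f a ^+ i * f b ^+ (m - i) = 0.
Proof.
move=> /(congr1 f); rewrite rmorph0 rmorphD rmorphXn rmorph_sum => E.
rewrite -[RHS]E; congr (_ + _).
by apply: eq_bigr => i _; rewrite !rmorphM !rmorphXn.
Qed.

(** The rational root argument: after division by the gcd, [b'] divides a power of [a'], to which it
    is coprime, so it is a unit. *)
Lemma poly_integral_dvd (a b : {poly K}) m (c : 'I_m -> {poly K}) : b != 0 ->
  a ^+ m + \sum_(i < m) c i * a ^+ i * b ^+ (m - i) = 0 -> b %| a.
Proof.
move=> bN0 E; pose g := gcdp a b.
have gN0 : g != 0 by rewrite gcdp_eq0 (negPf bN0) andbF.
have aE : a = a %/ g * g by rewrite divpK // dvdp_gcdl.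
have bE : b = b %/ g * g by rewrite divpK // dvdp_gcdr.
have cop : coprimep (a %/ g) (b %/ g) by apply: coprimep_div_gcd; rewrite bN0 orbT.
set a' := a %/ g in aE cop; set b' := b %/ g in bE cop.
have E' : a' ^+ m + \sum_(i < m) c i * a' ^+ i * b' ^+ (m - i) = 0.
  apply: (mulIf (expf_neq0 m gN0)); rewrite mul0r -[RHS]E mulrDl -exprMn -aE.
  congr (_ + _); rewrite mulr_suml; apply: eq_bigr => i _.
  have -> : g ^+ m = g ^+ (m - i) * g ^+ i by rewrite -exprD subnK // ltnW.
  rewrite [in RHS]aE [in RHS]bE !exprMn; ring.
have : b' %| a' ^+ m.
  move/eqP: E'; rewrite addr_eq0 => /eqP ->; rewrite dvdpNr.
  apply: (big_ind (fun p => b' %| p)); [exact: dvdp0|exact: dvdp_add|] => i _.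
  by rewrite dvdp_mull // dvdp_exp // subn_gt0.
rewrite -[a' ^+ m]mul1r mulrC Gauss_dvdpr; last by rewrite coprimep_sym coprimep_expl.
by move=> b'1; rewrite aE bE dvdp_mul2r // (dvdp_trans b'1) // dvd1p.
Qed.

Variable m : nat.
Implicit Types (p q : {mpoly K[m]}) (u v : 'I_m -> K).

(* [p(v + s u)] as a polynomial in [s] over the polynomials in [v]. *)
Definition line_poly u p : {poly {mpoly K[m]}} :=
  mmap (polyC \o @mpolyC m K) (fun i => ('X_i)%:P + (u i)%:MP%:P * 'X) p.

HB.instance Definition _ u := GRing.RMorphism.on (mmap (polyC \o @mpolyC m K)
  (fun i => ('X_i)%:P + (u i)%:MP%:P * 'X : {poly {mpoly K[m]}})).
HB.instance Definition _ u := GRing.RMorphism.copy (line_poly u)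
  (mmap (polyC \o @mpolyC m K) (fun i => ('X_i)%:P + (u i)%:MP%:P * 'X)).

Lemma line_polyE u p : line_poly u p =
  \sum_(t <- msupp p) (p@_t)%:MP%:P * \prod_i (('X_i)%:P + (u i)%:MP%:P * 'X) ^+ t i.
Proof. by []. Qed.

Lemma horner_line_poly u p v s :
  (map_poly (meval v) (line_poly u p)).[s] = p.@[fun i => v i + s * u i].
Proof.
rewrite line_polyE rmorph_sum horner_sum mevalE; apply: eq_bigr => t _.
rewrite rmorphM hornerM /= map_polyC hornerC /= mevalC; congr (_ * _).
rewrite rmorph_prod horner_prod; apply: eq_bigr => i _.
rewrite rmorphXn horner_exp rmorphD rmorphM /= !map_polyC map_polyX !hornerE /=.
by rewrite mevalXU mevalC [u i * s]mulrC.
Qed.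

(** The size is only bounded, so that [c = 0] is allowed and the relation is closed under sums with
    a common [d]. *)
Definition top_coef (P : {poly {mpoly K[m]}}) d (c : K) :=
  (size P <= d.+1)%N /\ P`_d = c%:MP.

Lemma top_coefM P Q d e c c' :
  top_coef P d c -> top_coef Q e c' -> top_coef (P * Q) (d + e) (c * c').
Proof.
move=> [sP Pd] [sQ Qe]; split.
  rewrite (leq_trans (size_polyMleq _ _)) //.
  by rewrite -subn1 leq_subLR add1n -addnS -addSn leq_add.
rewrite coefM (bigD1 (inord d : 'I_(d + e).+1)) //= inordK ?ltnS ?leq_addr //.
rewrite addKn Pd Qe -mpolyCM big1 ?addr0 // => i.
rewrite -val_eqE /= inordK ?ltnS ?leq_addr // neq_ltn => /orP[id|di].
  rewrite [X in _ * X]nth_default ?mulr0 // (leq_trans sQ) //.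
  by rewrite ltn_subRL ltn_add2r.
by rewrite nth_default ?mul0r // (leq_trans sP).
Qed.

Lemma top_coef_prod (I : Type) (r : seq I) (F : I -> {poly {mpoly K[m]}}) (d : I -> nat)
    (c : I -> K) : (forall i, top_coef (F i) (d i) (c i)) ->
  top_coef (\prod_(i <- r) F i) (\sum_(i <- r) d i) (\prod_(i <- r) c i).
Proof.
move=> H; elim: r => [|i r IH]; last by rewrite !big_cons; exact: top_coefM.
by rewrite !big_nil; split; rewrite ?size_poly1 // coef1 mpolyC1.
Qed.

Lemma top_coefX P d c k : top_coef P d c -> top_coef (P ^+ k) (k * d) (c ^+ k).
Proof.
move=> H; elim: k => [|k IH]; last by rewrite !exprS mulSn; exact: top_coefM.
by rewrite !expr0 mul0n; split; rewrite ?size_poly1 // coef1 mpolyC1.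
Qed.

Lemma top_coef_leq P d e c : top_coef P d c -> (d < e)%N -> top_coef P e 0.
Proof.
move=> [sP _] de; split; first by rewrite (leq_trans sP) // ltnS ltnW.
by rewrite nth_default ?mpolyC0 // (leq_trans sP).
Qed.

Lemma top_coef_sum (I : eqType) (r : seq I) (F : I -> {poly {mpoly K[m]}}) d
    (c : I -> K) : (forall i, i \in r -> top_coef (F i) d (c i)) ->
  top_coef (\sum_(i <- r) F i) d (\sum_(i <- r) c i).
Proof.
elim: r => [|i r IH] H.
  by rewrite !big_nil; split; rewrite ?size_poly0 // coef0 mpolyC0.
rewrite !big_cons; have [si ci] := H i (mem_head _ _).
have [|sr cr] := IH; first by move=> j jr; apply: H; rewrite inE jr orbT.
split; last by rewrite coefD ci cr mpolyCD.
by rewrite (leq_trans (size_polyD _ _)) // geq_max si.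
Qed.

(** In each factor ['X_i + u_i s] the coefficient of [s] is constant, so the coefficient of [s^d] is
    the value at [u] of the component of degree [d] and does not involve the variables. *)
Lemma top_coef_line_poly u p d : (msize p <= d.+1)%N ->
  top_coef (line_poly u p) d (\sum_(t <- msupp p) (if mdeg t == d then
     p@_t * \prod_i u i ^+ t i else 0)).
Proof.
move=> pd; rewrite line_polyE; apply: top_coef_sum => t tp.
have td : (mdeg t <= d)%N by rewrite -ltnS (leq_trans (msize_mdeg_lt tp)).
have H : top_coef ((p@_t)%:MP%:P * \prod_i (('X_i)%:P + (u i)%:MP%:P * 'X) ^+ t i)
    (0 + mdeg t) (p@_t * \prod_i u i ^+ t i).
  apply: top_coefM.
    by split; rewrite ?size_polyC_leq1 // coefC eqxx.
  rewrite mdegE; apply: top_coef_prod => i; rewrite -[X in top_coef _ X]muln1.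
  apply: top_coefX; split.
    rewrite (leq_trans (size_polyD _ _)) // geq_max (leq_trans (size_polyC_leq1 _)) //=.
    by rewrite (leq_trans (size_polyMleq _ _)) // size_polyX addn2 /= ltnS size_polyC_leq1.
  by rewrite coefD coefC /= add0r coefMX coefC.
case: eqP => [<-|/eqP]; first by rewrite -[X in top_coef _ X]add0n.
by move=> ne; apply: top_coef_leq H _; rewrite ltn_neqAle ne add0n.
Qed.

(** The component of highest degree is a nonzero polynomial, hence nonzero at some direction [u]. *)
Lemma top_direction p : p != 0 ->
  exists u c, c != 0 /\ top_coef (line_poly u p) (msize p).-1 c.
Proof.
move=> pN0; have sp : (0 < msize p)%N by rewrite lt0n msize_poly_eq0.
suff [u uP] : exists u, \sum_(t <- msupp p) (if mdeg t == (msize p).-1 then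
     p@_t * \prod_i u i ^+ t i else 0) != 0.
  by eexists u, _; split; [exact: uP|apply: top_coef_line_poly; rewrite prednK].
apply: contrapT => H.
have : (if mdeg (mlead p) == (msize p).-1 then p@_(mlead p) else 0) = 0.
  apply: (monomial_sum_inj (c := fun t => if mdeg t == (msize p).-1 then p@_t else 0)
    (msupp_uniq p)); last exact: mlead_supp.
  move=> u; apply/eqP/negPn/negP => /negP uP; apply: H; exists u.
  apply/negP => /eqP E; apply: uP; rewrite -[X in _ == X]E; apply/eqP.
  by apply: eq_bigr => t _; case: ifP; rewrite ?mul0r.
rewrite -(mlead_deg pN0) eqxx /= => /eqP.
by rewrite mleadc_eq0 (negPf pN0).
Qed.

(* Along a direction [u] in which [b] has constant leading coefficient, divide
   [a(v + s u)] by [b(v + s u)] as polynomials in [s]; for each fixed [v] the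
   remainder vanishes since [K[s]] is integrally closed. *)
Lemma mpoly_integral_dvd (a b : {mpoly K[m]}) k (c : 'I_k -> {mpoly K[m]}) : b != 0 ->
  a ^+ k + \sum_(i < k) c i * a ^+ i * b ^+ (k - i) = 0 -> exists d, a = d * b.
Proof.
move=> bN0 E; have [u [l [lN0 [sB Bl]]]] := top_direction bN0.
set D := (msize b).-1 in sB Bl.
pose B := line_poly u b; pose A := line_poly u a.
(* A monic divisor allows division with remainder although the coefficients form only a ring. *)
pose B' := (l^-1)%:MP%:P * B.
have B'D : B'`_D = 1 by rewrite coefCM Bl -mpolyCM mulVf.
have sB' : size B' = D.+1.
  apply/eqP; rewrite eqn_leq; apply/andP; split.
    rewrite (leq_trans (size_polyMleq _ _)) //.
    rewrite (@leq_trans (1 + size B).-1) //.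
    by rewrite -!subn1 leq_sub2r // leq_add2r size_polyC_leq1.
  by rewrite ltnNge; apply/negP => /leq_sizeP/(_ _ (leqnn _)); rewrite B'D => /eqP; rewrite oner_eq0.
have B'mon : B' \is monic by rewrite monicE lead_coefE sB' /= B'D.
have AE := Pdiv.RingMonic.rdivp_eq B'mon A.
set q := Pdiv.Ring.rdivp A B' in AE; set r := Pdiv.Ring.rmodp A B' in AE.
have sr : (size r < size B')%N by apply: Pdiv.Ring.ltn_rmodpN0; exact: monic_neq0.
have r0 : r = 0.
  apply/polyP => i; rewrite coef0; apply: meval_inj0 => v.
  rewrite -coef_map; suff -> : map_poly (meval v) r = 0 by rewrite coef0.
  pose B'v := map_poly (meval v) B'.
  have sB'v : size B'v = D.+1.
    by rewrite /B'v size_map_poly_id0 // lead_coefE sB' /= B'D rmorph1 oner_eq0.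
  have BvN0 : map_poly (meval v) B != 0.
    apply: contra_eqN sB'v => /eqP Bv; rewrite /B'v rmorphM /= Bv mulr0 size_poly0 //.
  have : B'v %| map_poly (meval v) A.
    have : map_poly (meval v) B %| map_poly (meval v) A.
      apply: (@poly_integral_dvd _ _ k (fun i => map_poly (meval v) (line_poly u (c i)))) => //.
      exact: (rmorph_integral (map_poly (meval v) \o line_poly u) E).
    rewrite /B'v rmorphM /= map_polyC /= mevalC mul_polyC.
    by rewrite dvdpZl // invr_eq0.
  rewrite AE rmorphD rmorphM /= dvdp_addr ?dvdp_mull // => /dvdp_leq H.
  apply/eqP; apply: contraT => /H; rewrite leqNgt sB'v ltnS.
  by rewrite (leq_trans (size_poly _ _)) // -ltnS -sB'.
(* At [s = 0] the polynomials in [s] give back [a] and [b]. *)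
exists (q.[0] * (l^-1)%:MP); apply/eqP; rewrite -subr_eq0; apply/eqP.
apply: meval_inj0 => v; rewrite mevalB !mevalM.
have ev p : (line_poly u p).[0].@[v] = p.@[v].
  have := horner_line_poly u p v 0.
  rewrite -[X in _.[X]](rmorph0 (meval v)) horner_map /= => ->.
  by apply: meval_eq => i; rewrite mul0r addr0.
rewrite -(ev a) -(ev b) -/A AE r0 addr0 hornerM mevalM /B' hornerM mevalM hornerC.
by rewrite mulrA subrr.
Qed.

End IntegrallyClosed.

(** * Orbit spaces *)

Section Orbits.
Variables (K : fieldType) (a b : nat) (H : Type).
Variables (Y : set 'M[K]_(a, b)) (D : set H).
Variables (ract : 'M[K]_(a, b) -> H -> 'M[K]_(a, b)) (chi : H -> K).
Local Notation orb := (orbits Y D ract).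
Local Notation OS := (orbit_space Y D ract).
Local Notation AB := (assoc_bundle Y D ract chi).

(** [H] carries no group structure, so the group laws are asked only through their effect on the
    points of [Y]. This covers both scalars acting on vectors and a subgroup of matrices acting on
    [Sp]. *)
Definition orbit_action := [/\ exists y, Y y,
  forall y h, Y y -> D h -> Y (ract y h),
  forall y, Y y -> exists2 h, D h & ract y h = y,
  forall y h, Y y -> D h -> exists2 h', D h' & ract (ract y h) h' = y &
  forall y h h', Y y -> D h -> D h' ->
    exists2 h'', D h'' & ract (ract y h) h' = ract y h''].

Hypothesis actP : orbit_action.

Lemma orbit_of_proof y : Y y -> [set ract y h | h in D] \in orb.
Proof. by move=> Yy; apply/mem_set; exists y. Qed.

Lemma orbit_nonempty : exists y, Y y. Proof. by case: actP. Qed.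

(* An arbitrary orbit when [y] is not in [Y]. *)
Definition cls (y : 'M[K]_(a, b)) : orb :=
  match pselect (Y y) with
  | left Yy => exist (fun A => A \in orb) _ (orbit_of_proof Yy)
  | right _ => exist (fun A => A \in orb) _ (orbit_of_proof (projT2 (cid orbit_nonempty)))
  end.

Lemma clsP y : Y y -> val (cls y) y.
Proof.
move=> Yy; rewrite /cls; case: pselect => //= Yy'.
by have [_ _ /(_ _ Yy)[h Dh e] _ _] := actP; exists h.
Qed.

Lemma orbit_rep (A : orb) : exists2 y, Y y & val A = [set ract y h | h in D].
Proof. by case: A => A /= /set_mem[y Yy ->]; exists y. Qed.

Lemma orbit_inY (A : orb) y : val A y -> Y y.
Proof.
by have [z Yz ->] := orbit_rep A; case: actP => _ cl _ _ _ [h Dh <-]; exact: cl.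
Qed.

Lemma orbit_elt (A : orb) : exists y, val A y.
Proof.
have [z Yz ->] := orbit_rep A; case: actP => _ _ /(_ _ Yz)[h Dh e] _ _.
by exists z, h.
Qed.

Lemma orbit_valE (A : orb) y : val A y -> val A = [set ract y h | h in D].
Proof.
have [z Yz ->] := orbit_rep A; case: actP => _ cl _ si tr [h Dh <-].
apply/seteqP; split=> x [h' Dh' <-]; last first.
  by have [h'' Dh'' ->] := tr _ _ _ Yz Dh Dh'; exists h''.
have [k Dk kE] := si _ _ Yz Dh.
have [k' Dk' kE'] := tr _ _ _ (cl _ _ Yz Dh) Dk Dh'.
by exists k' => //; rewrite -kE' kE.
Qed.

Lemma orbit_same (A : orb) y x : val A y -> val A x -> exists2 p, D p & x = ract y p.
Proof. by move=> Ay; rewrite (orbit_valE Ay) => -[p Dp <-]; exists p. Qed.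

Lemma orbit_eq (A B : orb) y : val A y -> val B y -> A = B.
Proof. by move=> Ay By; apply: val_inj; rewrite (orbit_valE Ay) (orbit_valE By). Qed.

Lemma cls_eq (A : orb) y : val A y -> cls y = A.
Proof. by move=> Ay; apply: orbit_eq (clsP (orbit_inY Ay)) Ay. Qed.

Lemma orbit_act (A : orb) y h : val A y -> D h -> val A (ract y h).
Proof. by move=> Ay Dh; rewrite (orbit_valE Ay); exists h. Qed.

Lemma cls_act y h : Y y -> D h -> cls (ract y h) = cls y.
Proof. by move=> Yy Dh; apply: cls_eq; apply: orbit_act Dh; exact: clsP. Qed.

Lemma orbits_unionE (U : set orb) :
  orbits_union U = [set y | Y y /\ U (cls y)].
Proof.
apply/seteqP; split=> y [].
  by move=> A UA Ay; split; [exact: orbit_inY Ay|rewrite (cls_eq Ay)].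
by move=> Yy Uy; exists (cls y) => //; exact: clsP.
Qed.

Lemma orbit_opnE (U : set OS) : opn U = zopen Y [set y | Y y /\ U (cls y)].
Proof. by rewrite -orbits_unionE. Qed.

Lemma fibre_actE (A : orb) (h : fib AB A) y p :
  val A y -> D p -> val h (ract y p) = chi p * val h y.
Proof. by case: h => h /= /asboolP[_ H1]; exact: H1. Qed.

Lemma fibre_offE (A : orb) (h : fib AB A) y : ~ val A y -> val h y = 0.
Proof. by case: h => h /= /asboolP[H1 _]; exact: H1. Qed.

Lemma fibre_ext (A : orb) (h h' : fib AB A) y : val A y -> val h y = val h' y -> h = h'.
Proof.
move=> Ay e; apply: val_inj; apply/funext => x.
have [Ax|nAx] := pselect (val A x); last by rewrite !fibre_offE.
have [p Dp ->] := orbit_same Ay Ax.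
by rewrite !fibre_actE // e.
Qed.

Lemma fibre_neq0 (A : orb) (h : fib AB A) y : val A y -> (h != 0) = (val h y != 0).
Proof.
move=> Ay; congr (~~ _); apply/eqP/eqP => [->//|e].
exact: (fibre_ext Ay).
Qed.

Definition equivariant_on (A : orb) (G : 'M[K]_(a, b) -> K) :=
  forall y p, val A y -> D p -> G (ract y p) = chi p * G y.

(** The zero vector when [G] is not equivariant on the orbit, so that no proof of equivariance is
    part of the term. *)
Definition mkfib (A : orb) (G : 'M[K]_(a, b) -> K) : fib AB A :=
  insubd 0 (fun y => if `[< val A y >] then G y else 0).

Lemma mkfibE (A : orb) G y : equivariant_on A G -> val A y -> val (mkfib A G) y = G y.
Proof.
move=> GP Ay; rewrite val_insubd ifT; first by rewrite asboolT.
apply/asboolP; split=> [x nAx|x p Ax Dp]; first by rewrite asboolF.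
by rewrite !asboolT //; [exact: GP|exact: orbit_act].
Qed.

Lemma fibre_scale (A : orb) (c : K) (h : fib AB A) y : val (c *: h) y = c * val h y.
Proof. by []. Qed.

Lemma fibre_addE (A : orb) (h h' : fib AB A) y : val (h + h') y = val h y + val h' y.
Proof. by []. Qed.

Lemma fibre_colinear (A : orb) (v w : fib AB A) : v != 0 -> exists c : K, w = c *: v.
Proof.
move=> vN0; have [y Ay] := orbit_elt A; have vy := vN0; rewrite (fibre_neq0 _ Ay) in vy.
by exists (val w y / val v y); apply: (fibre_ext Ay); rewrite fibre_scale divfK.
Qed.

End Orbits.

Section OrbitsZ.
Variables (K : numClosedFieldType) (a b : nat) (H : Type).
Variables (Y : set 'M[K]_(a, b)) (D : set H).
Variables (ract : 'M[K]_(a, b) -> H -> 'M[K]_(a, b)) (chi : H -> K).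
Hypothesis actP : orbit_action Y D ract.
Local Notation orb := (orbits Y D ract).
Local Notation OS := (orbit_space Y D ract).
Local Notation AB := (assoc_bundle Y D ract chi).
Local Notation cls := (cls actP).

Lemma orbit_regE (U : set OS) (f : OS -> K) :
  reg U f <-> zregular [set y | Y y /\ U (cls y)] (fun y => f (cls y)).
Proof.
rewrite -orbits_unionE; split=> [[g gP gE]|fP].
  apply: zregular_eq gP => y; rewrite orbits_unionE => -[Yy Uy].
  by apply: gE => //; exact: clsP.
by exists (fun y => f (cls y)) => // A UA y Ay; rewrite (cls_eq actP Ay).
Qed.

Lemma orbit_sectE (U : set OS) (s : forall A, fib AB A) :
  sect U s <-> zregular [set y | Y y /\ U (cls y)] (fun y => val (s (cls y)) y).
Proof.
rewrite -orbits_unionE; split=> [[g gP gE]|fP].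
  apply: zregular_eq gP => y; rewrite orbits_unionE => -[Yy Uy].
  by apply: gE => //; exact: clsP.
exists (fun y => val (s (cls y)) y) => // A UA y Ay.
by rewrite (cls_eq actP Ay).
Qed.

End OrbitsZ.

Section ProjectiveSpace.
Variables (K : numClosedFieldType) (n : nat).
Hypothesis n_gt0 : (0 < n)%N.
Local Notation Y := [set v : 'M[K]_(1, n) | v != 0].
Local Notation D := [set c : K | c != 0].

Lemma scale_orbit_action : orbit_action Y D (fun v c => c *: v).
Proof.
split=> [|y h yN0 hN0|y _|y h yN0 hN0|y h h' yN0 hN0 h'N0] /=.
- exists (delta_mx 0 (Ordinal n_gt0)); apply/eqP => /matrixP/(_ 0 (Ordinal n_gt0)).
  by rewrite !mxE !eqxx => /eqP; rewrite oner_eq0.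
- by rewrite scaler_eq0 negb_or hN0.
- by exists 1; rewrite /= ?oner_eq0 // scale1r.
- by exists h^-1; rewrite /= ?invr_eq0 // scalerA mulVf // scale1r.
- by exists (h' * h); rewrite /= ?mulf_neq0 // scalerA.
Qed.

Definition pcls : 'M[K]_(1, n) -> proj_space K n := cls scale_orbit_action.

End ProjectiveSpace.

Section MxEval.
Variables (K : numClosedFieldType) (n : nat).
Implicit Types (q r : {mpoly K[1 * n]}) (w : 'M[K]_(1, n)).

Definition lin (i : 'I_n) : {mpoly K[1 * n]} := 'X_(mxvec_index 0 i).

Lemma mxeval_lin i w : mxeval (lin i) w = w 0 i.
Proof. by rewrite /mxeval mevalXU mxvecE. Qed.

Lemma lin_homog i : lin i \is 1.-homog.
Proof. by rewrite dhomogX; apply/eqP; exact: mdeg1. Qed.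

Lemma mxeval_ray q w c : mxeval q (c *: w) = (ray_poly q (mxvec w 0)).[c].
Proof.
by rewrite horner_ray_poly; apply: meval_eq => i; rewrite linearZ mxE.
Qed.

Lemma coef_mxray q w d : (ray_poly q (mxvec w 0))`_d = mxeval (pihomog mdeg d q) w.
Proof. exact: coef_ray_poly. Qed.

Lemma mxeval_homogZ q d w c : q \is d.-homog -> mxeval q (c *: w) = c ^+ d * mxeval q w.
Proof.
move=> qh; rewrite -(meval_homog_scale _ _ qh); apply: meval_eq => i.
by rewrite linearZ mxE.
Qed.

Lemma mxeval_inj0 q : (forall w, w != 0 -> mxeval q w = 0) -> (0 < n)%N -> q = 0.
Proof.
move=> q0 n0; have qw w : w != 0 -> ray_poly q (mxvec w 0) = 0.
  move=> wN0; apply: (@poly_eq0_cofinite _ 'X); first by rewrite polyX_eq0.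
  by move=> s; rewrite hornerX -mxeval_ray => sN0; rewrite q0 // scaler_eq0 negb_or sN0.
apply: meval_inj0 => v; pose w : 'M[K]_(1, n) := vec_mx (\row_i v i).
have <- : mxeval q w = q.@[v] by apply: meval_eq => i; rewrite vec_mxK mxE.
have [->|/q0//] := eqVneq w 0.
have eN0 : delta_mx 0 (Ordinal n0) != 0 :> 'M[K]_(1, n).
  by apply/eqP => /matrixP/(_ 0 (Ordinal n0)); rewrite !mxE !eqxx => /eqP; rewrite oner_eq0.
by rewrite -(scale0r (delta_mx 0 (Ordinal n0))) mxeval_ray qw // horner0.
Qed.

Lemma mxeval_sum I (s : seq I) (P : pred I) (F : I -> {mpoly K[1 * n]}) w :
  mxeval (\sum_(i <- s | P i) F i) w = \sum_(i <- s | P i) mxeval (F i) w.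
Proof. exact: rmorph_sum. Qed.

Lemma row_neq0P w : reflect (exists i, w 0 i != 0) (w != 0).
Proof.
apply: (iffP idP) => [wN0|[i wi]]; last first.
  by apply: contraNneq wi => ->; rewrite mxE.
apply: contrapT => H; move/eqP: wN0; apply; apply/rowP => i; rewrite mxE.
by apply/eqP/negPn/negP => wi; apply: H; exists i.
Qed.

End MxEval.

Lemma fctE (Y : Type) (R : pzRingType) :
  (forall (f g : Y -> R) y, (f + g) y = f y + g y) *
  (forall (f : Y -> R) y, (- f) y = - f y) *
  (forall (f g : Y -> R) y, (f * g) y = f y * g y).
Proof. by []. Qed.

(** * [Proj] of a ring of polynomials in the coordinates of a surjective map *)

Section GradedPullback.
Variables (K : numClosedFieldType) (n : nat).
Hypothesis n_gt0 : (0 < n)%N.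
Variables (Y : Type) (zeta : Y -> 'M[K]_(1, n)).
Implicit Types (q r : {mpoly K[1 * n]}) (w : 'M[K]_(1, n)).
Variable gr : nat -> set (Y -> K).
Hypothesis grE : forall k, gr k = [set F | exists2 q, q \is k.-homog &
  F = fun y => mxeval q (zeta y)].

(** [zeta] will be a map from the frames of a line bundle to [K^n], and the pieces [gr k] either the
    invariant sections of the powers of [L] or the sections of the powers of a descent. *)
Definition pb q : Y -> K := fun y => mxeval q (zeta y).

Lemma pbD q r : pb (q + r) = pb q + pb r.
Proof. by apply/funext => y; rewrite /pb mxevalD. Qed.

Lemma pbM q r : pb (q * r) = pb q * pb r.
Proof. by apply/funext => y; rewrite /pb mxevalM. Qed.

Lemma pbC c : pb c%:MP = cst c.
Proof. by apply/funext => y; rewrite /pb mxevalC. Qed.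

Lemma pb0 : pb 0 = 0.
Proof. by rewrite -mpolyC0 pbC. Qed.

Lemma pbN q : pb (- q) = - pb q.
Proof. by apply: (addrI (pb q)); rewrite -pbD !subrr pb0. Qed.

Lemma pb_sum I (s : seq I) (P : pred I) (F : I -> {mpoly K[1 * n]}) :
  pb (\sum_(i <- s | P i) F i) = \sum_(i <- s | P i) pb (F i).
Proof. exact: (big_morph _ pbD pb0). Qed.

Lemma pbX q k : pb (q ^+ k) = pb q ^+ k.
Proof.
elim: k => [|k IH]; first by rewrite !expr0 -mpolyC1 pbC.
by rewrite !exprS pbM IH.
Qed.

Lemma gr_pb k q : q \is k.-homog -> gr k (pb q).
Proof. by rewrite grE => qh; exists q. Qed.

Lemma graded_sumE : graded_sum gr = range pb.
Proof.
apply/seteqP; split=> f.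
  move=> [N [s [sP ->]]].
  have /choice[q qE] k : exists q, q \is k.-homog /\ s k = pb q.
    by have := sP k; rewrite grE => -[q qh ->]; exists q.
  exists (\sum_(k < N) q k) => //; rewrite pb_sum.
  by apply: eq_bigr => k _; case: (qE k).
move=> [q _ <-]; exists (msize q), (fun k => pb (pihomog mdeg k q)); split.
  by move=> k; apply: gr_pb; exact: pihomogP.
by rewrite {1}(pihomog_partitionE (leqnn (msize q))) pb_sum.
Qed.

Hypothesis zeta_surj : forall w, w != 0 -> exists y, zeta y = w.

Lemma pb_inj : injective pb.
Proof.
move=> q r e; apply/eqP; rewrite -subr_eq0; apply/eqP.
apply: mxeval_inj0 => // w /zeta_surj[y <-].
have := congr1 (fun f => f y) e; rewrite /pb => e'.
by apply/eqP; rewrite mxevalD (_ : mxeval (- r) _ = - mxeval r (zeta y)) ?e' ?subrr //; exact: mevalN.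
Qed.

Lemma pb_integrally_closed : integrally_closed (graded_sum gr).
Proof.
rewrite graded_sumE; split.
  split.
    rewrite -[1](pbC 1) -pb0 => /pb_inj /eqP.
    by rewrite mpolyC1 oner_eq0.
  move=> _ _ [q _ <-] [r _ <-]; rewrite -pbM -pb0 => /pb_inj/eqP.
  by rewrite mulf_eq0 => /orP[] /eqP ->; [left|right]; rewrite ?pb0.
move=> _ _ m c [q _ <-] [r _ <-] rN0 cP E.
have /choice[c' c'E] i : exists p, c i = pb p by have [p _ <-] := cP i; exists p.
have rN0' : r != 0 by apply/eqP => r0; apply: rN0; rewrite r0 pb0.
have [|d dE] := @mpoly_integral_dvd _ _ q r m c' rN0'.
  apply: pb_inj; rewrite pb0 -[RHS]E pbD pbX pb_sum; congr (_ + _).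
  by apply: eq_bigr => i _; rewrite !pbM !pbX c'E.
by exists (pb d); [exists d|rewrite -pbM dE].
Qed.

Lemma pb_generated :
  graded_sum gr `<=` \bigcap_(B in [set B | subalgebra B /\ gr 1 `<=` B]) B.
Proof.
rewrite graded_sumE => _ [q _ <-] B [[Bc Ba Bm] B1].
apply: (@mxeval_ind _ _ _ _ B zeta) => //.
move=> i j; rewrite ord1; have -> : (fun y => zeta y 0 j) = pb (lin K j).
  by apply/funext => y; rewrite /pb mxeval_lin.
by apply/B1/gr_pb/lin_homog.
Qed.

End GradedPullback.
Section ProjPoints.
Variables (K : numClosedFieldType) (n : nat).
Hypothesis n_gt0 : (0 < n)%N.
Variables (Y : Type) (zeta : Y -> 'M[K]_(1, n)).
Implicit Types (q r : {mpoly K[1 * n]}) (w : 'M[K]_(1, n)).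
Variable gr : nat -> set (Y -> K).
Hypothesis grE : forall k, gr k = [set F | exists2 q, q \is k.-homog &
  F = fun y => mxeval q (zeta y)].
Hypothesis zeta_surj : forall w, w != 0 -> exists y, zeta y = w.
Local Notation pb := (pb zeta).
Local Notation pb_inj := (pb_inj n_gt0 zeta_surj).
Local Notation grS := (graded_sumE grE).

(** The homogeneous ideal of the line of [w], transported to [Y]: a polynomial vanishes along the
    line exactly when all its homogeneous components vanish at [w]. *)
Definition line_ideal w : set (Y -> K) :=
  [set f | exists2 q, f = pb q & ray_poly q (mxvec w 0) = 0].

Lemma ray_polyD q r (v : 'I_(1 * n) -> K) : ray_poly (q + r) v = ray_poly q v + ray_poly r v.
Proof.
apply: (@poly_eq_cofinite _ 1); rewrite ?oner_eq0 // => s _.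
by rewrite hornerD !horner_ray_poly mevalD.
Qed.

Lemma ray_polyM q r (v : 'I_(1 * n) -> K) : ray_poly (q * r) v = ray_poly q v * ray_poly r v.
Proof.
apply: (@poly_eq_cofinite _ 1); rewrite ?oner_eq0 // => s _.
by rewrite hornerM !horner_ray_poly mevalM.
Qed.

Lemma line_idealE w q : line_ideal w (pb q) <-> ray_poly q (mxvec w 0) = 0.
Proof. by split=> [[r /pb_inj <-]|e] //; exists q. Qed.

Lemma ray_poly_homog q d w : q \is d.-homog ->
  ray_poly q (mxvec w 0) = mxeval q w *: 'X^d.
Proof.
move=> qh; apply: (@poly_eq_cofinite _ 1); rewrite ?oner_eq0 // => s _.
by rewrite -mxeval_ray hornerZ hornerXn (mxeval_homogZ _ _ qh) mulrC.
Qed.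

Lemma line_ideal_homog w q d : q \is d.-homog ->
  (line_ideal w (pb q) <-> mxeval q w = 0).
Proof.
move=> qh; rewrite line_idealE (ray_poly_homog _ qh); split=> [/eqP|->]; last by rewrite scale0r.
by rewrite scaler_eq0 -size_poly_eq0 size_polyXn orbF => /eqP.
Qed.

Lemma line_ideal_proof w : w != 0 -> line_ideal w \in proj_point gr.
Proof.
move=> wN0; apply/mem_set; rewrite /proj_point /= grS; split.
- split.
  + by move=> _ [q -> _]; exists q.
  + by rewrite -(pb0 zeta) line_idealE; apply: (@poly_eq_cofinite _ 1);
      rewrite ?oner_eq0 // => s _; rewrite horner0 horner_ray_poly meval0.
  + move=> _ _ [q -> q0] [r -> r0]; rewrite -pbD line_idealE ray_polyD.
    by rewrite q0 r0 addr0.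
  + move=> _ _ [q _ <-] [r -> r0]; rewrite -pbM line_idealE ray_polyM.
    by rewrite r0 mulr0.
- move=> N s sP ps k kN.
  have /choice[q qE] i : exists q, q \is i.-homog /\ s i = pb q.
    by have := sP i; rewrite grE => -[q qh ->]; exists q.
  have -> : s k = pb (q k) by case: (qE k).
  have [qh _] := qE k; rewrite line_ideal_homog; last exact: qh.
  move: ps; have -> : \sum_(i < N) s i = pb (\sum_(i < N) q i).
    by rewrite pb_sum; apply: eq_bigr => i _; case: (qE i).
  rewrite line_idealE => e; have := congr1 (fun P : {poly K} => P`_k) e.
  rewrite coef0 coef_mxray => <-.
  rewrite (linear_sum (pihomog mdeg k)) mxeval_sum (bigD1 (Ordinal kN)) //= big1.
    by rewrite addr0 pihomog_dE.
  move=> i ik; rewrite (pihomog_ne0 (d := i)) ?/mxeval ?meval0 //.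
  by have [] := qE i.
- move=> _ _ [q _ <-] [r _ <-]; rewrite -pbM !line_idealE ray_polyM.
  by move/eqP; rewrite mulf_eq0 => /orP[] /eqP; [left|right].
- have /row_neq0P[i wi] := wN0; exists 1%N, (pb (lin K i)); split=> //.
    exact: gr_pb (lin_homog _ _).
  by rewrite (line_ideal_homog _ (lin_homog _ _)) mxeval_lin; apply/eqP.
- move=> k a b; rewrite !grE => -[q qh ->] [r rh ->].
  rewrite -/(pb q) -/(pb r) line_ideal_homog; last exact: rh.
  move=> /eqP r0; exists (mxeval q w / mxeval r w).
  rewrite -(pbC zeta) -pbM -pbN -pbD.
  have h : q - (mxeval q w / mxeval r w)%:MP * r \is k.-homog.
    by rewrite mul_mpolyC rpredB // rpredZ.
  rewrite (line_ideal_homog _ h) mxevalD (_ : forall p, mxeval (- p) w = - mxeval p w).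
    by rewrite mxevalM mxevalC divfK // subrr.
  by move=> p; exact: mevalN.
Qed.

Lemma delta_neq0 : delta_mx 0 (Ordinal n_gt0) != 0 :> 'M[K]_(1, n).
Proof.
by apply/eqP => /matrixP/(_ 0 (Ordinal n_gt0)); rewrite !mxE !eqxx => /eqP; rewrite oner_eq0.
Qed.

Definition ppt w : Proj gr :=
  match pselect (w != 0) with
  | left h => exist (fun A => A \in proj_point gr) _ (line_ideal_proof h)
  | right _ => exist (fun A => A \in proj_point gr) _ (line_ideal_proof delta_neq0)
  end.

Lemma val_ppt w : w != 0 -> val (ppt w) = line_ideal w.
Proof. by rewrite /ppt; case: pselect. Qed.

(** Some coordinate [x_i] lies outside the prime, and the residue field [K] gives constants [c_j]
    with [x_j - c_j x_i] inside. Modulo the prime a form [q] of degree [d] becomes [q(c) x_i^d], so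
    the prime is the ideal of the line of [c]. *)
Lemma ppt_surj (z : Proj gr) : exists2 w, w != 0 & ppt w = z.
Proof.
have [[pS p0 pD pM] pgr ppr [k [a [k0 ak pa]]] pres] := set_mem (valP z).
set p := val z in pS p0 pD pM pgr ppr pa pres.
have Sq q : graded_sum gr (pb q) by rewrite grS; exists q.
have p_cst c f : c != 0 -> p (cst c * f) -> p f.
  move=> cN0 pcf; have := pM (cst c^-1) _ _ pcf.
  rewrite mulrA; have -> : cst c^-1 * cst c = 1 :> (Y -> K).
    by apply/funext => y; rewrite fctE /cst mulVf.
  by rewrite mul1r -(pbC zeta); apply; exact: Sq.
have p_sum I (s : seq I) (F : I -> Y -> K) : (forall i, p (F i)) -> p (\sum_(i <- s) F i).
  move=> pF; elim: s => [|i s IH]; rewrite ?big_nil ?big_cons //; exact: pD.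
(* Otherwise every form of positive degree would lie in [p], against its relevance. *)
have [i pi] : exists i, ~ p (pb (lin K i)).
  apply: contrapT => H; apply: pa; move: ak; rewrite grE => -[q qh ->].
  rewrite -/(pb q) [q]mpolyE pb_sum big_seq; apply: big_ind => // t tq.
  have /dhomogP qh1 := qh; have td : mdeg t = k := qh1 t tq.
  have [j tj] : exists j, (0 < t j)%N.
    apply: contrapT => H'; move: k0; rewrite -td lt0n mdeg_eq0 => /eqP; apply.
    apply/mnmP => j; rewrite mnm0E; apply/eqP; rewrite -leqn0 leqNgt.
    by apply/negP => tj; apply: H'; exists j.
  have -> : q@_t *: 'X_[t] = (q@_t *: 'X_[t - U_(j)]) * 'X_j.
    rewrite -scalerAl -mpolyXD submK //; apply/mnm_lepP => l; rewrite mnm1E.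
    by case: eqP => // <-.
  rewrite pbM; apply: pM; first exact: Sq.
  apply: contrapT => H''; apply: H; case: (mxvec_indexP j) H'' => i0 i1 H''.
  by exists i1; rewrite /lin -(ord1 i0).
have gr1 j : gr 1 (pb (lin K j)) by apply: gr_pb (lin_homog _ _).
have /choice[c cP] j : exists c, p (pb (lin K j) - cst c * pb (lin K i)).
  exact: (pres 1%N).
pose w : 'M[K]_(1, n) := \row_j c j.
have pN f : p f -> p (- f).
  move=> pf; have -> : - f = pb (-1) * f by rewrite pbN -mpolyC1 pbC mulN1r.
  exact: pM.
have ci : c i = 1.
  apply/eqP; rewrite eq_sym -subr_eq0; apply: contraT => cN0; exfalso; apply: pi.
  apply: (p_cst (1 - c i) (pb (lin K i)) cN0).
  have -> : cst (1 - c i) * pb (lin K i) = pb (lin K i) - cst (c i) * pb (lin K i).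
    by apply/funext => y; rewrite !fctE /cst; ring.
  exact: cP.
have wN0 : w != 0 by apply/row_neq0P; exists i; rewrite mxE ci oner_eq0.
pose cong f g := [/\ graded_sum gr f, graded_sum gr g & p (f - g)].
have Sop f g : graded_sum gr f -> graded_sum gr g -> graded_sum gr (f + g) /\ graded_sum gr (f * g).
  by rewrite grS => -[q _ <-] [r _ <-]; rewrite -pbD -pbM; split; [exists (q + r)|exists (q * r)].
have congq q : cong (pb q) (fun y => mxeval q (zeta y 0 i *: w)).
  (* A function on [bool * Y] is a pair of functions on [Y], so that one induction treats both
     evaluations and their congruence. *)
  pose G (x : bool * Y) := if x.1 then zeta x.2 else zeta x.2 0 i *: w.
  apply: (@mxeval_ind K 1 n _ [set h : bool * Y -> K |
    cong (fun y => h (true, y)) (fun y => h (false, y))] G) => /=.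
  - move=> e; rewrite -/(cst e) -(pbC zeta); split; try exact: Sq.
    by rewrite subrr.
  - move=> f g [f1 f2 f3] [g1 g2 g3]; split; [by case: (Sop _ _ f1 g1)|by case: (Sop _ _ f2 g2)|].
    by have := pD _ _ f3 g3; rewrite addrACA -opprD.
  - move=> f g [f1 f2 f3] [g1 g2 g3]; split; [by case: (Sop _ _ f1 g1)|by case: (Sop _ _ f2 g2)|].
    have := pD _ _ (pM _ _ f1 g3) (pM _ _ g2 f3); congr p.
    by apply/funext => y; rewrite !fctE; ring.
  - move=> i0 j; rewrite ord1 /G /=.
    have -> : (fun y => zeta y 0 j) = pb (lin K j).
      by apply/funext => y; rewrite /pb mxeval_lin.
    have -> : (fun y => (zeta y 0 i *: w) 0 j) = cst (c j) * pb (lin K i).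
      by apply/funext => y; rewrite fctE /pb mxeval_lin !mxE mulrC.
    by split; [exact: Sq|rewrite -(pbC zeta) -pbM; exact: Sq|exact: cP].
have p1 : ~ p 1.
  move=> p1; apply: pa; rewrite -[a]mulr1; apply: pM => //.
  by move: ak; rewrite grE => -[q _ ->]; exact: Sq.
have piX d : ~ p (pb (lin K i) ^+ d).
  elim: d => [//|d IH]; rewrite exprS => /ppr[||//|//]; first exact: Sq.
  by rewrite -pbX; exact: Sq.
have phom q d : q \is d.-homog -> (p (pb q) <-> mxeval q w = 0).
  move=> qh; have [_ _ pq] := congq q.
  have E : (fun y => mxeval q (zeta y 0 i *: w)) = cst (mxeval q w) * pb (lin K i) ^+ d.
    apply/funext => y; rewrite fctE -pbX /pb (mxeval_homogZ _ _ qh) /cst mulrC.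
    by congr (_ * _); rewrite -[LHS]mulr1 /mxeval rmorphXn /= mulr1 -/(mxeval _ _) mxeval_lin.
  rewrite E in pq; split=> [pq'|q0].
    apply/eqP; apply: contraT => qN0; exfalso; apply: (piX d).
    apply: (p_cst (mxeval q w)) => //.
    by have := pD _ _ pq' (pN _ pq); rewrite opprB addrCA subrr addr0.
  move: pq; rewrite q0; have -> : cst 0 * pb (lin K i) ^+ d = 0.
    by apply/funext => y; rewrite fctE mul0r.
  by rewrite subr0.
exists w => //; apply: val_inj; rewrite val_ppt // -/p; apply/seteqP; split=> f.
  move=> [q -> q0]; rewrite (pihomog_partitionE (leqnn (msize q))) pb_sum.
  apply: p_sum => d; apply/phom; first exact: pihomogP.
  by rewrite -coef_mxray q0 coef0.
move=> pf; have := pS _ pf; rewrite grS => -[q _ qE]; exists q => //.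
apply/polyP => d; rewrite coef0 coef_mxray.
have [dq|dq] := ltnP d (msize q); last first.
  rewrite -coef_mxray nth_default // (leq_trans _ dq) //.
  apply/leq_sizeP => j jq; rewrite coef_mxray pihomogE big1_seq /= ?/mxeval ?meval0 //.
  move=> t /andP[/eqP tj tq]; have := msize_mdeg_lt tq.
  by rewrite (tj : mdeg t = j) ltnNge jq.
apply/phom; first exact: pihomogP.
apply: (pgr (msize q) (fun d => pb (pihomog mdeg d q))) => //.
  by move=> e; apply: (gr_pb grE); exact: pihomogP.
by rewrite -pb_sum -pihomog_partitionE // qE.
Qed.

Lemma val_ppt_homog w q d : w != 0 -> q \is d.-homog ->
  (val (ppt w) (pb q) <-> mxeval q w = 0).
Proof. by move=> wN0 qh; rewrite val_ppt //; exact: (line_ideal_homog _ qh). Qed.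

Lemma ppt_scale w c : c != 0 -> ppt (c *: w) = ppt w.
Proof.
move=> cN0; have [->|wN0] := eqVneq w 0; first by rewrite scaler0.
have cwN0 : c *: w != 0 by rewrite scaler_eq0 negb_or cN0.
apply: val_inj; rewrite !val_ppt //; apply/seteqP; split=> _ [q -> q0]; exists q => //;
  apply: (@poly_eq0_cofinite _ 1); rewrite ?oner_eq0 // => s _; rewrite -mxeval_ray.
  have := congr1 (horner^~ (s / c)) q0.
  by rewrite -mxeval_ray horner0 scalerA divfK.
have := congr1 (horner^~ (s * c)) q0.
by rewrite -mxeval_ray horner0 scalerA.
Qed.

(** The forms [w_i x_j - w_j x_i] vanish at [w], hence belong to the common ideal and vanish at
    [w']. *)
Lemma ppt_eq w w' : w != 0 -> w' != 0 -> ppt w = ppt w' ->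
  exists2 c, c != 0 & w' = c *: w.
Proof.
move=> wN0 w'N0 e.
have E i j : w 0 i * w' 0 j = w 0 j * w' 0 i.
  pose q := w 0 i *: lin K j - w 0 j *: lin K i.
  have qh : q \is 1.-homog by rewrite rpredB // rpredZ // lin_homog.
  have qE u : mxeval q u = w 0 i * u 0 j - w 0 j * u 0 i.
    by rewrite /q /mxeval mevalB !mevalZ -!/(mxeval _ _) !mxeval_lin.
  apply/eqP; rewrite -subr_eq0 -qE; apply/eqP/(val_ppt_homog w'N0 qh); rewrite -e.
  by apply/(val_ppt_homog wN0 qh); rewrite qE mulrC subrr.
have /row_neq0P[i wi] := wN0.
have w'E : w' = (w' 0 i / w 0 i) *: w.
  by apply/rowP => j; rewrite mxE mulrAC -[w' 0 i * _]mulrC -E mulrC mulKf.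
exists (w' 0 i / w 0 i) => //; apply: contraNneq w'N0 => c0.
by rewrite w'E c0 scale0r.
Qed.

End ProjPoints.

Section ProjTopology.
Variables (K : numClosedFieldType) (n : nat).
Hypothesis n_gt0 : (0 < n)%N.
Variables (Y : Type) (zeta : Y -> 'M[K]_(1, n)).
Implicit Types (q r : {mpoly K[1 * n]}) (w : 'M[K]_(1, n)).
Variable gr : nat -> set (Y -> K).
Hypothesis grE : forall k, gr k = [set F | exists2 q, q \is k.-homog &
  F = fun y => mxeval q (zeta y)].
Hypothesis zeta_surj : forall w, w != 0 -> exists y, zeta y = w.
Local Notation pb := (pb zeta).
Local Notation ppt := (ppt n_gt0 grE zeta_surj).
Local Notation val_ppt_homog := (val_ppt_homog n_gt0 grE zeta_surj).
Local Notation nz := [set w : 'M[K]_(1, n) | w != 0].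

Definition cone (U : set (Proj gr)) : set 'M[K]_(1, n) := [set w | w != 0 /\ U (ppt w)].

Lemma mxray_neq0 q w : mxeval q w != 0 -> ray_poly q (mxvec w 0) != 0.
Proof.
by rewrite -{1}[w]scale1r mxeval_ray; exact: horner_neq0.
Qed.

Lemma mxray_comp_neq0 q w : mxeval q w != 0 ->
  exists d, mxeval (pihomog mdeg d q) w != 0.
Proof.
move=> /mxray_neq0 H; apply: contrapT => H'; move/eqP: H; apply; apply/polyP => d.
rewrite coef0 coef_mxray; apply/eqP/negPn/negP => qd; apply: H'; by exists d.
Qed.

Lemma mxray_scale_neq0 q w d : mxeval (pihomog mdeg d q) w != 0 ->
  exists2 c : K, c != 0 & mxeval q (c *: w) != 0.
Proof.
move=> qd; have rN0 : ray_poly q (mxvec w 0) != 0.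
  by apply: contraNneq qd => r0; rewrite -coef_mxray r0 coef0.
have [c] : exists c, ('X * ray_poly q (mxvec w 0)).[c] != 0.
  by apply: poly_neq0_ex; rewrite mulf_neq0 // polyX_eq0.
rewrite hornerM hornerX mulf_eq0 negb_or -mxeval_ray => /andP[cN0 qc].
by exists c.
Qed.

(** Open sets of [Proj] are cut out by forms, those of [K^n] minus the origin by arbitrary
    polynomials. Cones are stable under scaling, and a polynomial is nonzero at some nonzero
    multiple of [w] exactly when one of its homogeneous components is nonzero at [w]. *)
Lemma proj_opnE U : @opn K (Proj gr) U <-> zopen nz (cone U).
Proof.
split=> [UP|/zopenP[_ UP] z Uz].
  apply/zopenP; split=> [w []//|w [wN0 Uw]].
  have [k [a [k0 ak aw aU]]] := UP _ Uw.
  move: ak; rewrite grE => -[q qh aE].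
  exists (mxeval q); split; first by exists q.
    by move=> q0; apply: aw; rewrite aE; apply/(val_ppt_homog wN0 qh).
  move=> w' w'N0 qw'; split=> //; apply: aU; rewrite aE.
  by move/(val_ppt_homog w'N0 qh).
have [w wN0 wz] := ppt_surj n_gt0 grE zeta_surj z; rewrite -wz in Uz *.
have [x [[p /funext xE] xw pU]] := UP _ (conj wN0 Uz); subst x; move/eqP: xw => pw.
have [d qd] := mxray_comp_neq0 pw; have /row_neq0P[i wi] := wN0.
set q := pihomog mdeg d p in qd.
have qh : q \is d.-homog by exact: pihomogP.
(* A basic open set of [Proj] requires a form of positive degree, while [q] may have degree [0]; the
   factor [x_i] is nonzero at [w]. *)
have qlh : q * lin K i \is d.+1.-homog by rewrite -(addn1 d) dhomogM // lin_homog.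
exists d.+1, (pb (q * lin K i)); split=> //.
- exact: (gr_pb grE).
- move/(val_ppt_homog wN0 qlh); rewrite mxevalM mxeval_lin => /eqP.
  by rewrite mulf_eq0 (negPf qd) (negPf wi).
- move=> z'; have [w' w'N0 <-] := ppt_surj n_gt0 grE zeta_surj z' => H.
  have qw' : mxeval q w' != 0.
    by apply/eqP => q0; apply: H; apply/(val_ppt_homog w'N0 qlh); rewrite mxevalM q0 mul0r.
  have [c cN0 pc] := mxray_scale_neq0 qw'.
  have cwN0 : c *: w' != 0 by rewrite scaler_eq0 negb_or cN0.
  have [//|_] := pU _ cwN0; first exact/eqP.
  by rewrite ppt_scale.
Qed.

Lemma cone_scale U w c : c != 0 -> cone U w -> cone U (c *: w).
Proof. by move=> cN0 [wN0 Uw]; split; rewrite ?ppt_scale // scaler_eq0 negb_or cN0. Qed.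

(** As [f] is constant on lines, an identity [p = f q] extends along the whole line and so holds
    between the components of each degree: a local fraction can be replaced by one of two forms of
    equal degree. *)
Lemma proj_regE U (f : Proj gr -> K) : @opn K (Proj gr) U ->
  (reg U f <-> zregular (cone U) (f \o ppt)).
Proof.
move=> Uo; split=> [fP|/zregularP fP z Uz].
  apply/zregularP => w [wN0 Uw]; have [V [k [a [b [Vo Vw VU [ak bk] fE]]]]] := fP _ Uw.
  move: ak bk; rewrite !grE => -[q qh aE] [r rh bE].
  have /proj_opnE/zopenP[_ VP] := Vo.
  have [e [eP ew eV]] := VP _ (conj wN0 Vw).
  have fE' w' : w' != 0 -> V (ppt w') -> mxeval r w' != 0 /\ f (ppt w') * mxeval r w' = mxeval q w'.
    move=> w'N0 Vw'; have [bw' abw'] := fE _ Vw'; split.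
      by apply/eqP => r0; apply: bw'; rewrite bE; apply/(val_ppt_homog w'N0 rh).
    have h : q - (f (ppt w'))%:MP * r \is k.-homog by rewrite mul_mpolyC rpredB // rpredZ.
    have : val (ppt w') (pb (q - (f (ppt w'))%:MP * r)).
      by rewrite pbD pbN pbM pbC; move: abw'; rewrite aE bE.
    move/(val_ppt_homog w'N0 h); rewrite mxevalD (_ : forall p, mxeval (- p) w' = - mxeval p w').
      by rewrite mxevalM mxevalC => /eqP; rewrite subr_eq0 => /eqP ->.
    by move=> p; exact: mevalN.
  exists (fun w' => mxeval q w' * e w'), (fun w' => mxeval r w' * e w').
  split; [by apply: polyfunM => //; exists q|by apply: polyfunM => //; exists r| |].
    by apply/eqP; rewrite mulf_neq0 //; [case: (fE' _ wN0 Vw)|exact/eqP].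
  move=> w' [w'N0 Uw'] /eqP; rewrite mulf_eq0 negb_or => /andP[rw' /eqP ew'].
  have [_ Vw'] := eV _ w'N0 ew'.
  have [_ <-] := fE' _ w'N0 Vw'.
  by rewrite -mulf_div divff ?mulr1 /= ?mulfK //; exact/eqP.
have [w wN0 wz] := ppt_surj n_gt0 grE zeta_surj z; rewrite -wz in Uz *.
have [x [y [[p /funext xE] [q /funext yE] yw fE]]] := fP _ (conj wN0 Uz).
subst x y; move/eqP: yw => qw.
have [d qd] := mxray_comp_neq0 qw.
pose V := [set z | exists2 w', cone U w' /\ mxeval (pihomog mdeg d q) w' != 0 & z = ppt w'].
have Vcone w' : w' != 0 -> V (ppt w') <-> cone U w' /\ mxeval (pihomog mdeg d q) w' != 0.
  move=> w'N0; split=> [[w'' [[w''N0 Uw''] qw''] e]|[H1 H2]]; last by exists w'.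
  have [c cN0 w''E] := ppt_eq w'N0 w''N0 e.
  have := qw''; rewrite w''E (mxeval_homogZ _ _ (pihomogP _ _ _)) mulf_eq0 negb_or => /andP[_ ?].
  by split=> //; split=> //; move: Uw''; rewrite w''E ppt_scale.
exists V, d, (pb (pihomog mdeg d p)), (pb (pihomog mdeg d q)); split.
- apply/proj_opnE.
  have -> : cone V = cone U `&` [set w' | w' != 0 /\ mxeval (pihomog mdeg d q) w' != 0].
    apply/seteqP; split=> w' [].
      by move=> w'N0 /(Vcone _ w'N0)[? ?]; split.
    by move=> Uw' [w'N0 qw']; split=> //; apply/(Vcone _ w'N0).
  apply: zopenI; first exact/proj_opnE.
  by apply: zopen_poly; exists (pihomog mdeg d q).
- by exists w.
- by move=> _ [w' [[_ Uw'] _] ->].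
- by split; apply: (gr_pb grE); exact: pihomogP.
- move=> _ [w' [[w'N0 Uw'] qw'] ->]; split.
    by move/(val_ppt_homog w'N0 (pihomogP _ _ _)); apply/eqP.
  set c := f (ppt w').
  have h : pihomog mdeg d p - c%:MP * pihomog mdeg d q \is d.-homog.
    by rewrite mul_mpolyC rpredB ?rpredZ // pihomogP.
  have : mxeval (pihomog mdeg d p - c%:MP * pihomog mdeg d q) w' = 0.
    rewrite mxevalD (_ : forall p, mxeval (- p) w' = - mxeval p w'); last by move=> ?; exact: mevalN.
    rewrite mxevalM mxevalC -!coef_mxray -coefZ -coefN -coefD.
    suff -> : ray_poly p (mxvec w' 0) = c *: ray_poly q (mxvec w' 0) by rewrite subrr coef0.
    have rN0 : ray_poly q (mxvec w' 0) != 0.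
      by apply: contraNneq qw' => r0; rewrite -coef_mxray r0 coef0.
    apply: (@poly_eq_cofinite _ ('X * ray_poly q (mxvec w' 0))).
      by rewrite mulf_neq0 // polyX_eq0.
    move=> s; rewrite hornerM hornerX mulf_eq0 negb_or => /andP[sN0 qs].
    rewrite hornerZ -!mxeval_ray in qs *.
    have := fE _ (cone_scale sN0 (conj w'N0 Uw')) (elimN eqP qs).
    by rewrite /= ppt_scale // -/c => ->; rewrite divfK.
  move/(val_ppt_homog w'N0 h).
  by rewrite pbD pbN pbM pbC.
Qed.

Local Notation pcls := (@pcls K n n_gt0).

Lemma proj_rep_ex (z : Proj gr) : exists w, w != 0 /\ ppt w = z.
Proof. by have [w ? ?] := ppt_surj n_gt0 grE zeta_surj z; exists w. Qed.

Definition proj_rep (z : Proj gr) : 'M[K]_(1, n) := projT1 (cid (proj_rep_ex z)).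

Lemma proj_repP z : proj_rep z != 0 /\ ppt (proj_rep z) = z.
Proof. exact: projT2 (cid (proj_rep_ex z)). Qed.

Definition proj_iso (z : Proj gr) : proj_space K n := pcls (proj_rep z).

Lemma pcls_scale w c : w != 0 -> c != 0 -> pcls (c *: w) = pcls w.
Proof. by move=> wN0 cN0; apply: cls_act. Qed.

Lemma proj_isoE w : w != 0 -> proj_iso (ppt w) = pcls w.
Proof.
move=> wN0; rewrite /proj_iso; have [rN0 rE] := proj_repP (ppt w).
by have [c cN0 ->] := ppt_eq wN0 rN0 (esym rE); rewrite pcls_scale.
Qed.

Lemma pcls_surj (A : proj_space K n) : exists2 w, w != 0 & pcls w = A.
Proof.
have [w Aw] := orbit_elt (scale_orbit_action K n_gt0) A; exists w.
  exact: (orbit_inY (scale_orbit_action K n_gt0) Aw).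
exact: cls_eq.
Qed.

Lemma pclsP w : w != 0 -> val (pcls w) w.
Proof. by move=> wN0; apply: clsP. Qed.

Lemma pcls_eq w w' : w != 0 -> w' != 0 -> pcls w = pcls w' -> exists2 c, c != 0 & w' = c *: w.
Proof.
move=> wN0 w'N0 e; have H := pclsP w'N0; rewrite -e in H.
by have [c cN0 ->] := orbit_same (scale_orbit_action K n_gt0) (pclsP wN0) H; exists c.
Qed.

Definition proj_inv (A : proj_space K n) : Proj gr :=
  ppt (projT1 (cid2 (pcls_surj A))).

Lemma proj_invE w : w != 0 -> proj_inv (pcls w) = ppt w.
Proof.
move=> wN0; rewrite /proj_inv; case: cid2 => /= w' w'N0 e.
by have [c cN0 ->] := pcls_eq w'N0 wN0 e; rewrite ppt_scale.
Qed.

Lemma proj_iso_isomorphism : isomorphism proj_iso.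
Proof.
have opn1 V : opn V -> @opn K (Proj gr) (proj_iso @^-1` V).
  rewrite (orbit_opnE (scale_orbit_action K n_gt0)) => VP; apply/proj_opnE.
  move: VP; congr zopen; apply/seteqP.
  by split=> w [/= wN0 Vw]; split=> //; move: Vw; rewrite /= proj_isoE.
have opn2 V : @opn K (Proj gr) V -> opn (proj_inv @^-1` V).
  move=> /proj_opnE VP; rewrite (orbit_opnE (scale_orbit_action K n_gt0)).
  move: VP; congr zopen; apply/seteqP.
  by split=> w [/= wN0 Vw]; split=> //; move: Vw; rewrite /= proj_invE.
split; first split=> [//|V g Vo].
  move=> /(orbit_regE (scale_orbit_action K n_gt0)) gP.
  apply/proj_regE; first exact: opn1.
  have e : cone (proj_iso @^-1` V) = [set y | y != 0 /\ V (pcls y)].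
    by apply/seteqP; split=> w [/= wN0 Vw]; split=> //; move: Vw; rewrite /= proj_isoE.
  rewrite e; apply: zregular_eq gP => w [wN0 _] /=.
  by rewrite proj_isoE.
exists proj_inv; split.
- split=> // V g Vo /(proj_regE _ Vo) gP.
  apply/(orbit_regE (scale_orbit_action K n_gt0)).
  have e : cone V = [set y | y != 0 /\ V (proj_inv (pcls y))].
    by apply/seteqP; split=> w [/= wN0 Vw]; split=> //; move: Vw; rewrite /= proj_invE.
  move: gP; rewrite e; apply: zregular_eq => w [wN0 _] /=.
  by rewrite -[cls _ _]/(pcls w) proj_invE.
- move=> z; have [w wN0 <-] := ppt_surj n_gt0 grE zeta_surj z.
  by rewrite proj_isoE // proj_invE.
- move=> A; have [w wN0 <-] := pcls_surj A.
  by rewrite proj_invE // proj_isoE.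
Qed.

End ProjTopology.

(** * Maximal tori *)

Section Diagonalizable.
Variable K : numClosedFieldType.

(** [lam c] is annihilated by [X^N - 1], which is separable in characteristic zero. *)
Lemma torsion_diagonalizable m (lam : K -> 'M[K]_m) (c : K) (N : nat) :
  (0 < N)%N -> lam 1 = 1%:M ->
  (forall a b, a != 0 -> b != 0 -> lam (a * b) = lam a *m lam b) ->
  c ^+ N = 1 -> diagonalizable (lam c).
Proof.
move=> N0; case: m lam => [|m] lam lam1 lamM cN.
  have -> : lam c = 0 by apply/matrixP => -[].
  exact: diagonalizable0.
have cN0 : c != 0.
  by apply/eqP => c0; move/eqP: cN; rewrite c0 expr0n eqn0Ngt N0 eq_sym oner_eq0.
have lamX k : lam c ^+ k = lam (c ^+ k).
  elim: k => [|k IH]; first by rewrite !expr0 lam1.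
  by rewrite !exprS IH lamM // expf_neq0.
have [rs rsE] := closed_field_poly_normal ('X^N - 1 : {poly K}).
rewrite (monicP (monicXnsubC 1 N0)) scale1r in rsE.
have urs : uniq rs.
  by rewrite -separable_prod_XsubC -rsE separable_Xn_sub_1 // pnatr_eq0 -lt0n.
apply/diagonalizableP; exists rs => //; rewrite -rsE; apply: mxminpoly_min.
by rewrite rmorphB /= rmorphXn /= horner_mx_X rmorph1 lamX cN lam1 subrr.
Qed.

(** With a single denominator, the zeros of any linear combination of entries are zeros of a
    polynomial whose size is bounded in advance. *)
Lemma common_denominator m p (lam : K -> 'M[K]_(m, p)) :
  (forall i j, locally_rational [set c | c != 0] (fun c => lam c i j)) ->
  exists (Q : {poly K}) (R : 'M[{poly K}]_(m, p)), forall c, c != 0 ->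
    Q.[c] != 0 /\ forall i j, Q.[c] * lam c i j = (R i j).[c].
Proof.
move=> H; have H' (ij : 'I_m * 'I_p) : exists pq : {poly K} * {poly K}, forall c, c != 0 ->
    pq.2.[c] != 0 /\ lam c ij.1 ij.2 = pq.1.[c] / pq.2.[c].
  have [||p0 [q0 [_ E]]] := @locally_rational_frac K 'X (fun c => lam c ij.1 ij.2).
  - by rewrite polyX_eq0.
  - have -> : [set s | 'X.[s] != 0] = [set c : K | c != 0] by apply/funext => s /=; rewrite hornerX.
    exact: H.
  - by exists (p0, q0) => c cN0; apply: E; rewrite hornerX.
have [pq pqE] := choice H'.
exists (\prod_ij (pq ij).2), (\matrix_(i, j) ((pq (i, j)).1 *
  \prod_(kl | kl != (i, j)) (pq kl).2)) => c cN0; split=> [|i j].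
  by rewrite horner_prod; apply/prodf_neq0 => ij _; case: (pqE ij c cN0).
rewrite mxE hornerM !horner_prod (bigD1 (i, j)) //=.
have [qN0 /= ->] := pqE (i, j) c cN0.
by rewrite mulrC mulrA divfK.
Qed.

End Diagonalizable.

Section TorusDiagonal.
Variable K : numClosedFieldType.
Variable n : nat.
Implicit Types (t g : 'M[K]_(n + n)) (T : set 'M[K]_(n + n)).

(* The torsion points of a one-parameter subgroup are simultaneously
   diagonalizable; the off-diagonal entries of the subgroup are rational functions
   with more zeros than their degree allows, hence vanish. *)
Lemma torus_diagonal T : torus T ->
  exists2 g, g \in unitmx & forall t, T t -> is_diag_mx (g *m t *m invmx g).
Proof.
move=> [[TS T1 TM TV] _ [r [tau [sigma [[tauT sigG] [_ tauK] tau_mul tau_reg _]]]]].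
pose e (j : 'I_r) (c : K) : 'rV[K]_r := \row_i (if i == j then c else 1).
have eG j c : c != 0 -> Gm (e j c).
  by move=> cN0 i; rewrite mxE; case: (i == j) => //; exact: oner_neq0.
have tau1 : tau (const_mx 1) = 1%:M.
  have G1 : Gm (const_mx 1 : 'rV[K]_r) by move=> i; rewrite mxE oner_eq0.
  have /Sp_unitmx tU := TS _ (tauT _ G1).
  have := tau_mul _ _ G1 G1; have -> : map2_mx *%R (const_mx 1) (const_mx 1) = const_mx 1 :> 'rV[K]_r.
    by apply/rowP => i; rewrite !mxE mulr1.
  by move/(congr1 (mulmx (invmx (tau (const_mx 1))))); rewrite mulVmx // mulKmx.
pose lam j c := tau (e j c).
have lam1 j : lam j 1 = 1%:M.
  by rewrite /lam (_ : e j 1 = const_mx 1) //; apply/rowP => i; rewrite !mxE if_same.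
have lamM j a b : a != 0 -> b != 0 -> lam j (a * b) = lam j a *m lam j b.
  move=> aN0 bN0; rewrite /lam -tau_mul; try exact: eG.
  by congr tau; apply/rowP => i; rewrite !mxE; case: eqP; rewrite ?mulr1.
have comm z w : Gm z -> Gm w -> tau z *m tau w = tau w *m tau z.
  move=> zG wG; rewrite -!tau_mul //; congr tau.
  by apply/rowP => i; rewrite !mxE mulrC.
have lam_rat j i k : locally_rational [set c | c != 0] (fun c => lam j c i k).
  apply: (@zregular_curve _ 1 r (@Gm K r) (fun y => tau y i k) (e j)); last exact: tau_reg.
    move=> a b; case: (eqVneq b j) => [->|bj].
      by exists 'X => s; rewrite mxE eqxx hornerX.
    by exists 1 => s; rewrite mxE (negPf bj) hornerC.
  by move=> s; exact: eG.
have /choice[QR QRP] j : exists QR : {poly K} * 'M[{poly K}]_(n + n), forall c, c != 0 ->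
    QR.1.[c] != 0 /\ forall i k, QR.1.[c] * lam j c i k = (QR.2 i k).[c].
  by have [Q [R H]] := common_denominator (lam_rat j); exists (Q, R).
(* [N] exceeds the size of every linear combination of the numerators of one [lam j], so a
   combination that vanishes at all [N]-th roots of unity is zero. *)
pose N := (\sum_j \sum_i \sum_k size ((QR j).2 i k)).+1.
have [rs rsE] := closed_field_poly_normal ('X^N - 1 : {poly K}).
rewrite (monicP (monicXnsubC 1 (ltn0Sn _))) scale1r in rsE.
have urs : uniq rs.
  by rewrite -separable_prod_XsubC -rsE separable_Xn_sub_1 // pnatr_eq0.
have srs : size rs = N.
  have := congr1 (fun p : {poly K} => size p) rsE.
  by rewrite size_prod_XsubC size_XnsubC // => -[].
have rsN c : c \in rs -> c ^+ N = 1.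
  rewrite -root_prod_XsubC -rsE rootE hornerD hornerN hornerXn hornerC subr_eq0.
  by move/eqP.
have rs0 c : c \in rs -> c != 0.
  by move/rsN => cN; apply/eqP => c0; move/eqP: cN; rewrite c0 expr0n eq_sym oner_eq0.
pose As := [seq lam j c | j <- enum 'I_r, c <- rs].
have [|g gU /allP gP] := (codiagonalizableP As).1.
  split=> [A B /allpairsP[[j c] /= [_ cr ->]] /allpairsP[[j' c'] /= [_ cr' ->]]|A].
    by apply: comm; apply: eG; exact: rs0.
  move=> /allpairsP[[j c] /= [_ cr ->]].
  by apply: (@torsion_diagonalizable _ _ (lam j) c N) => //; [exact: lamM|exact: rsN].
exists g => // t Tt.
pose dg x := is_diag_mx (g *m x *m invmx g).
have dgM x y : dg x -> dg y -> dg (x *m y).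
  move=> /is_diag_mxP dx /is_diag_mxP dy; apply/is_diag_mxP => i j ij.
  have -> : g *m (x *m y) *m invmx g = (g *m x *m invmx g) *m (g *m y *m invmx g).
    by rewrite !mulmxA mulmxKV.
  rewrite mxE big1 // => k _; have [ik|ik] := eqVneq (i : nat) k.
    by rewrite dy ?mulr0 // -ik.
  by rewrite dx ?mul0r.
have dg_lam j c : c != 0 -> dg (lam j c).
  move=> cN0; apply/is_diag_mxP => a b ab.
  pose P := \sum_i \sum_k (g a i * invmx g k b) *: (QR j).2 i k.
  have PE c' : c' != 0 -> P.[c'] = (QR j).1.[c'] * (g *m lam j c' *m invmx g) a b.
    move=> c'N0; rewrite /P horner_sum; under eq_bigr do rewrite horner_sum.
    rewrite exchange_big /= mxE mulr_sumr; apply: eq_bigr => k _.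
    rewrite mxE mulr_suml mulr_sumr; apply: eq_bigr => i _.
    have [_ /(_ i k) E] := QRP j c' c'N0.
    by rewrite hornerZ -E; ring.
  suff P0 : P = 0.
    have [qN0 _] := QRP j c cN0; have /esym/eqP := PE c cN0.
    by rewrite P0 horner0 mulf_eq0 (negPf qN0) => /eqP.
  apply/eqP; apply: contraT => PN0.
  have := @max_poly_roots _ P rs PN0; rewrite srs => H.
  have : (N < size P)%N.
    apply: H urs; apply/allP => c' c'r; rewrite rootE PE; last exact: rs0.
    have c'As : lam j c' \in As by apply/allpairsP; exists (j, c'); rewrite /= mem_enum c'r.
    have /(elimT (diagonalizable_forP _ gU)) -> := gP _ c'As; rewrite ?mulr0 //.
  rewrite ltnNge; case/negP; rewrite /N.
  apply: leq_trans (leqnSn _).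
  apply: leq_trans (_ : (\sum_i \sum_k size ((QR j).2 i k) <= _)%N); last first.
    by rewrite (bigD1 j) //= leq_addr.
  rewrite /P; apply: leq_trans (size_sum _ _ _) _.
  apply/bigmax_leqP => i _; rewrite [X in (_ <= X)%N](bigD1 i) //=.
  apply: leq_trans (leq_addr _ _).
  apply: leq_trans (size_sum _ _ _) _; apply/bigmax_leqP => k _.
  rewrite (bigD1 k) //=; apply: leq_trans (leq_addr _ _).
  exact: size_scale_leq.
rewrite -(tauK _ Tt); have zG := sigG _ Tt; set z := sigma t in zG *.
(* [z] is a product of elements with a single coordinate different from [1]; [zj j] is the product
   of the first [j] of them. *)
pose zj (j : nat) : 'rV[K]_r := \row_i (if (i < j)%N then z 0 i else 1).
have H j : (j <= r)%N -> dg (tau (zj j)).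
  elim: j => [_|j IH jr].
    have -> : zj 0%N = const_mx 1 by apply/rowP => i; rewrite !mxE.
    rewrite tau1 /dg mulmx1 mulmxV //; exact: scalar_mx_is_diag.
  have jG : Gm (zj j) by move=> i; rewrite mxE; case: ifP; rewrite ?oner_eq0.
  have -> : zj j.+1 = map2_mx *%R (zj j) (e (Ordinal jr) (z 0 (Ordinal jr))).
    apply/rowP => i; rewrite !mxE ltnS leq_eqVlt -val_eqE /=.
    have [ij|//] := eqVneq (i : nat) j; rewrite ?ij ?ltnn ?mul1r ?mulr1 //.
    by congr (z 0 _); apply: val_inj.
  rewrite tau_mul //; last by apply: eG; exact: zG.
  by apply: dgM; [exact: IH (ltnW jr)|exact: dg_lam (zG _)].
have -> : z = zj r by apply/rowP => i; rewrite mxE ltn_ord.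
exact: H.
Qed.

End TorusDiagonal.

(** * Symplectic bases of weight vectors *)

Section SymplecticForm.
Variables (K : numClosedFieldType) (n : nat).
Implicit Types (u v w : 'cV[K]_(n + n)) (t g : 'M[K]_(n + n)).
Local Notation J := (symp_form K n).

Definition sform u v : K := (u^T *m J *m v) 0 0.

Lemma sformDl u v w : sform (u + v) w = sform u w + sform v w.
Proof. by rewrite /sform linearD /= !mulmxDl mxE. Qed.

Lemma sformDr u v w : sform u (v + w) = sform u v + sform u w.
Proof. by rewrite /sform mulmxDr mxE. Qed.

Lemma sformZl c u v : sform (c *: u) v = c * sform u v.
Proof. by rewrite /sform linearZ /= -!scalemxAl mxE. Qed.

Lemma sformZr c u v : sform u (c *: v) = c * sform u v.
Proof. by rewrite /sform -scalemxAr mxE. Qed.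

Lemma symp_formT : J^T = - J.
Proof. by rewrite /symp_form tr_block_mx opp_block_mx !trmx0 !linearN /= !trmx1 !oppr0 opprK. Qed.


Lemma sform_skew u v : sform v u = - sform u v.
Proof.
have -> : sform v u = ((v^T *m J *m u)^T) 0 0 by rewrite mxE.
by rewrite !trmx_mul trmxK symp_formT mulNmx mulmxN mulmxA mxE.
Qed.

Lemma sform_alt u : sform u u = 0.
Proof.
have /eqP := sform_skew u u; rewrite -addr_eq0 -mulr2n -mulr_natr mulf_eq0.
by rewrite pnatr_eq0 orbF => /eqP.
Qed.

Lemma sform_Sp t u v : Sp t -> sform (t *m u) (t *m v) = sform u v.
Proof.
rewrite /sform => tS; congr (_ _ _); rewrite -[J in RHS]tS trmx_mul.
by rewrite !mulmxA.
Qed.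

Lemma sformNl u v : sform (- u) v = - sform u v.
Proof. by rewrite -scaleN1r sformZl mulN1r. Qed.

Lemma sform0l v : sform 0 v = 0.
Proof. by rewrite -(scale0r 0) sformZl mul0r. Qed.

Lemma sform_suml k (F : 'I_k -> 'cV[K]_(n + n)) v :
  sform (\sum_(i < k) F i) v = \sum_(i < k) sform (F i) v.
Proof. by apply: (big_morph (sform^~ v)) => [x y|]; rewrite ?sformDl ?sform0l. Qed.

Lemma symp_form_unit : J \in unitmx.
Proof.
have E : J *m (- J) = 1%:M.
  rewrite /symp_form opp_block_mx !oppr0 opprK mulmx_block.
  rewrite !mulmx0 !mul0mx mulmxN mulNmx !mulmx1 opprK !addr0 !add0r.
  by rewrite -scalar_mx_block.
by have [] := mulmx1_unit E.
Qed.

Lemma sform_col g a b : sform (col a g) (col b g) = (g^T *m J *m g) a b.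
Proof.
rewrite /sform tr_col -!mulmxA mxE [RHS]mxE; apply: eq_bigr => k _.
by rewrite !mxE; congr (_ * _); apply: eq_bigr => l _; rewrite !mxE.
Qed.

Lemma sform_neq0 g u : g \in unitmx -> u != 0 -> exists a, sform u (col a g) != 0.
Proof.
move=> gU uN0; apply: contrapT => H; move/eqP: uN0; apply.
have E : u^T *m J *m g = 0.
  apply/matrixP => i a; rewrite ord1 [RHS]mxE; apply/eqP/negPn/negP => e; apply: H.
  by exists a; rewrite /sform colE !mulmxA -colE mxE.
have : u^T = 0.
  have := congr1 (fun x => x *m invmx g *m invmx J) E.
  by rewrite mulmxK // mulmxK ?symp_form_unit // !mul0mx.
by move/(congr1 trmx); rewrite trmxK trmx0.
Qed.

Lemma symp_formE (a b : 'I_(n + n)) : J a b =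
  match fintype.split a, fintype.split b with
  | inl i, inr j => (i == j)%:R
  | inr i, inl j => - (i == j)%:R
  | _, _ => 0
  end.
Proof.
rewrite /symp_form /block_mx mxE; case: (fintype.split a) => i; rewrite mxE; case: (fintype.split b) => j;
  by rewrite !mxE.
Qed.

End SymplecticForm.

Lemma split_lshiftE a b (i : 'I_a) : fintype.split (lshift b i) = inl i.
Proof. exact: (unsplitK (inl i)). Qed.

Lemma split_rshiftE a b (i : 'I_b) : fintype.split (rshift a i) = inr i.
Proof. exact: (unsplitK (inr i)). Qed.

Section WeightBasis.
Variables (K : numClosedFieldType) (n : nat).
Variable T : set 'M[K]_(n + n).
Hypothesis TS : T `<=` @Sp K n.
Implicit Types (u v w : 'cV[K]_(n + n)) (t g : 'M[K]_(n + n)).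

Definition is_weight_vec v := exists mu : 'M[K]_(n + n) -> K,
  forall t, T t -> t *m v = mu t *: v.

(** An incomplete symplectic basis of weight vectors. Indexing by natural numbers keeps the type of
    the families fixed while [k] grows. *)
Definition symp_pairs k (e f : nat -> 'cV[K]_(n + n)) :=
  [/\ forall i, (i < k)%N -> is_weight_vec (e i) /\ is_weight_vec (f i),
      forall i j, (i < k)%N -> (j < k)%N -> sform (e i) (e j) = 0,
      forall i j, (i < k)%N -> (j < k)%N -> sform (f i) (f j) = 0 &
      forall i j, (i < k)%N -> (j < k)%N -> sform (e i) (f j) = (i == j)%:R].

(* Projection to the orthogonal complement of the span of the [e i] and [f i]. *)
Definition sproj k (e f : nat -> 'cV[K]_(n + n)) u :=
  u - \sum_(i < k) sform u (f i) *: e i + \sum_(i < k) sform u (e i) *: f i.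

Section Proj.
Variables (k : nat) (e f : nat -> 'cV[K]_(n + n)).
Hypothesis ef : symp_pairs k e f.

Lemma sproj_ortho u j : (j < k)%N ->
  sform (sproj k e f u) (e j) = 0 /\ sform (sproj k e f u) (f j) = 0.
Proof.
case: ef => _ ee ff eff jk; rewrite /sproj !sformDl !sformNl !sform_suml; split.
  rewrite [X in _ - X]big1 => [|i _]; last by rewrite sformZl ee // mulr0.
  rewrite (bigD1 (Ordinal jk)) //= big1 => [|i]; last rewrite -val_eqE /= => /negPf ij.
    by rewrite sformZl (sform_skew (e j) (f _)) eff // eqxx mulrN1 subr0 addr0 subrr.
  by rewrite sformZl (sform_skew (e j) (f _)) eff // eq_sym ij oppr0 mulr0.
rewrite [X in _ + X]big1 => [|i _]; last by rewrite sformZl ff // mulr0.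
rewrite (bigD1 (Ordinal jk)) //= big1 => [|i]; last rewrite -val_eqE /= => /negPf ij.
  by rewrite sformZl eff // eqxx mulr1 !addr0 subrr.
by rewrite sformZl eff // ij mulr0.
Qed.

(** Invariance of the form makes the weights of [e i] and [f i] inverse to each other, and makes
    [sform u (f i)] vanish unless [u] and [e i] are scaled alike; so every term that is subtracted
    has the weight of [u]. *)
Lemma sproj_weight u : is_weight_vec u -> is_weight_vec (sproj k e f u).
Proof.
case: ef => wt _ _ eff [mu uE]; exists mu => t Tt.
have tS := TS Tt.
rewrite /sproj !mulmxDr mulmxN !mulmx_sumr uE // !scalerDr scalerN !scaler_sumr.
have aux (i : 'I_k) : exists a b : K, [/\ t *m e i = a *: e i, t *m f i = b *: f i & a * b = 1].
  have [[al alE] [be beE]] := wt _ (ltn_ord i); exists (al t), (be t).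
  rewrite alE // beE //; split=> //.
  have := sform_Sp (e i) (f i) tS.
  by rewrite alE // beE // sformZl sformZr eff // eqxx mulr1.
congr (_ - _ + _); apply: eq_bigr => i _; have [a [b [eE fE ab]]] := aux i.
  rewrite -scalemxAr eE !scalerA; congr (_ *: _).
  have := sform_Sp u (f i) tS; rewrite uE // fE sformZl sformZr => E.
  by rewrite -[RHS]mulr1 -ab -{1}E; ring.
rewrite -scalemxAr fE !scalerA; congr (_ *: _).
have := sform_Sp u (e i) tS; rewrite uE // eE sformZl sformZr => E.
by rewrite -[RHS]mulr1 -ab -{1}E; ring.
Qed.

End Proj.

(** A Gram-Schmidt step: [2k < 2n] vectors cannot span, so a column of [g] has a nonzero projection
    [e1]. By nondegeneracy some column pairs nontrivially with [e1], and its projection pairs with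
    [e1] in the same way. *)
Lemma symp_pairs_extend k e f g : g \in unitmx -> (forall a, is_weight_vec (col a g)) ->
  symp_pairs k e f -> (k < n)%N -> exists e' f', symp_pairs k.+1 e' f'.
Proof.
move=> gU gw ef kn; pose pr := sproj k e f.
have [a pa] : exists a, pr (col a g) != 0.
  apply: contrapT => H.
  (* If all projections vanish, [g] factors through a space of dimension [2k]. *)
  pose E := \matrix_(i < n + n, j < k + k)
    (match fintype.split j with inl l => e l i 0 | inr l => f l i 0 end).
  pose C := \matrix_(j < k + k, a < n + n)
    (match fintype.split j with inl l => sform (col a g) (f l) | inr l => - sform (col a g) (e l) end).
  have gE : g = E *m C.
    apply/matrixP => i a.
    have pa : pr (col a g) = 0 by apply/eqP/negPn/negP => h; apply: H; exists a.
    have := congr1 (fun x : 'cV[K]_(n + n) => x i 0) pa.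
    rewrite /pr /sproj !mxE !summxE big_split_ord /= => /eqP.
    rewrite addr_eq0 subr_eq => /eqP ->; rewrite addrC -sumrN; congr (_ + _);
      apply: eq_bigr => l _; rewrite !mxE.
      by rewrite split_rshiftE mulrN mulrC.
    by rewrite split_lshiftE mulrC.
  have := mulmx_max_rank E C; rewrite -gE mxrank_unit // leqNgt.
  by rewrite -addnS leq_add // ltnW.
have [b pb] := sform_neq0 gU pa.
set e1 := pr (col a g) in pa pb; pose c := sform e1 (col b g).
pose f1 := c^-1 *: pr (col b g).
have ort u j := @sproj_ortho k e f ef u j.
have e1o j : (j < k)%N -> sform e1 (e j) = 0 /\ sform e1 (f j) = 0 by exact: ort.
have f1o j : (j < k)%N -> sform f1 (e j) = 0 /\ sform f1 (f j) = 0.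
  by move=> jk; rewrite !sformZl; have [-> ->] := ort (col b g) _ jk; rewrite mulr0.
have e1f1 : sform e1 f1 = 1.
  rewrite sformZr sform_skew /pr {1}/sproj !sformDl sformNl !sform_suml.
  rewrite [X in _ - X]big1 => [|i _]; last first.
    by rewrite sformZl (sform_skew e1 (e i)); have [-> _] := e1o _ (ltn_ord i); rewrite oppr0 mulr0.
  rewrite [X in _ + X]big1 => [|i _]; last first.
    by rewrite sformZl (sform_skew e1 (f i)); have [_ ->] := e1o _ (ltn_ord i); rewrite oppr0 mulr0.
  by rewrite subr0 addr0 -sform_skew mulVf.
have [wt ee ff eff] := ef.
have e1w : is_weight_vec e1 by apply: sproj_weight.
have f1w : is_weight_vec f1.
  have [mu muE] := sproj_weight ef (gw b); exists mu => t Tt.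
  by rewrite -scalemxAr muE // !scalerA mulrC.
exists (fun i => if i == k then e1 else e i), (fun i => if i == k then f1 else f i).
have ltk l : (l < k.+1)%N = (l == k) || (l < k)%N by rewrite ltnS leq_eqVlt.
split=> [i|i j|i j|i j]; rewrite !ltk.
- by case: eqP => //= _ /wt.
- case: (eqVneq i k) => [_|_] /=; case: (eqVneq j k) => [_|_] //= ik jk.
  + by rewrite sform_alt.
  + by case: (e1o _ jk).
  + by rewrite sform_skew; case: (e1o _ ik) => -> _; rewrite oppr0.
  + exact: ee.
- case: (eqVneq i k) => [_|_] /=; case: (eqVneq j k) => [_|_] //= ik jk.
  + by rewrite sform_alt.
  + by case: (f1o _ jk).
  + by rewrite sform_skew; case: (f1o _ ik) => _ ->; rewrite oppr0.
  + exact: ff.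
- case: (eqVneq i k) => [->|ik] /=; case: (eqVneq j k) => [->|jk] //= ik' jk'.
  + by case: (e1o _ jk').
  + by rewrite (negPf ik) sform_skew; case: (f1o _ ik') => -> _; rewrite oppr0.
  + exact: eff.
Qed.

Lemma symplectic_weight_basis g : g \in unitmx -> (forall a, is_weight_vec (col a g)) ->
  exists2 h, Sp h & forall a, is_weight_vec (col a h).
Proof.
move=> gU gw; have [e [f [wt ee ff ef]]] : exists e f, symp_pairs n e f.
  have H k : (k <= n)%N -> exists e f, symp_pairs k e f.
    elim: k => [_|k IH kn]; first by exists (fun=> 0), (fun=> 0); split.
    have [e [f ef]] := IH (ltnW kn); exact: symp_pairs_extend gU gw ef kn.
  exact: H.
pose h := \matrix_(i < n + n, a < n + n) (match fintype.split a with inl l => e l i 0 | inr l => f l i 0 end).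
have hc a : col a h = match fintype.split a with inl l => e l | inr l => f l end.
  by apply/colP => i; rewrite !mxE; case: (fintype.split a).
exists h; last by move=> a; rewrite hc; case: (fintype.split a) => l; case: (wt _ (ltn_ord l)).
rewrite /Sp /=; apply/matrixP => a b; rewrite -sform_col !hc symp_formE.
case: (fintype.split a) => i; case: (fintype.split b) => j; rewrite ?ee ?ff ?ef //.
by rewrite sform_skew ef // eq_sym.
Qed.

End WeightBasis.

Lemma zregular_sum (K : numClosedFieldType) a b (W : set 'M[K]_(a, b)) I (r : seq I)
    (F : I -> 'M[K]_(a, b) -> K) :
  (forall i, zregular W (F i)) -> zregular W (fun y => \sum_(i <- r) F i y).
Proof.
move=> FP; elim: r => [|i r IH].
  by under eq_fun do rewrite big_nil; apply: zregular_polyfun; exact: polyfun_const.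
by under eq_fun do rewrite big_cons; exact: zregularD.
Qed.

(** * Maximal tori as conjugates of the diagonal torus *)

Section StandardTorus.
Variables (K : numClosedFieldType) (n : nat).
Implicit Types (z w : 'rV[K]_n) (t g h x : 'M[K]_(n + n)) (a b : 'I_(n + n)).
Local Notation J := (symp_form K n).

(* The coordinate [a] of [K^(2n)] has weight [epsilon_(sidx a)], or its opposite if
   [sneg a]; [star a] is the coordinate paired with [a] by the symplectic form. *)
Definition sidx a : 'I_n := match fintype.split a with inl i => i | inr i => i end.
Definition sneg a : bool := match fintype.split a with inl _ => false | inr _ => true end.
Definition star a : 'I_(n + n) :=
  match fintype.split a with inl i => rshift n i | inr i => lshift n i end.

Lemma sidx_lshift i : sidx (lshift n i) = i. Proof. by rewrite /sidx split_lshiftE. Qed.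
Lemma sidx_rshift i : sidx (rshift n i) = i. Proof. by rewrite /sidx split_rshiftE. Qed.
Lemma sneg_lshift i : sneg (lshift n i) = false. Proof. by rewrite /sneg split_lshiftE. Qed.
Lemma sneg_rshift i : sneg (rshift n i) = true. Proof. by rewrite /sneg split_rshiftE. Qed.
Lemma star_lshift i : star (lshift n i) = rshift n i. Proof. by rewrite /star split_lshiftE. Qed.
Lemma star_rshift i : star (rshift n i) = lshift n i. Proof. by rewrite /star split_rshiftE. Qed.

Definition shiftE := (sidx_lshift, sidx_rshift, sneg_lshift, sneg_rshift, star_lshift, star_rshift,
  split_lshiftE, split_rshiftE).

Lemma ordP a : a = if sneg a then rshift n (sidx a) else lshift n (sidx a).
Proof. by case: (split_ordP a) => i ->; rewrite !shiftE. Qed.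

Lemma same_idx a b : sidx a = sidx b -> b = a \/ b = star a.
Proof.
case: (split_ordP a) => i ->; case: (split_ordP b) => j ->; rewrite !shiftE => ->;
  by [left|right].
Qed.

Definition dv z a : K := if sneg a then (z 0 (sidx a))^-1 else z 0 (sidx a).
Definition dz z : 'M[K]_(n + n) := diag_mx (\row_a dv z a).

Lemma dzE z a b : dz z a b = dv z a *+ (a == b).
Proof. by rewrite !mxE. Qed.

Lemma dvM z w a : dv (map2_mx *%R z w) a = dv z a * dv w a.
Proof. by rewrite /dv mxE; case: (sneg a); rewrite ?invfM. Qed.

Lemma dv_neq0 z a : Gm z -> dv z a != 0.
Proof. by move=> zG; rewrite /dv; case: (sneg a); rewrite ?invr_eq0 zG. Qed.

Lemma dv_star z a : dv z (star a) = (dv z a)^-1.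
Proof. by rewrite /dv; case: (split_ordP a) => i ->; rewrite !shiftE ?invrK. Qed.

Lemma dzM z w : dz (map2_mx *%R z w) = dz z *m dz w.
Proof.
rewrite /dz mulmx_diag; congr diag_mx; apply/rowP => a; by rewrite !mxE dvM.
Qed.

Lemma dz1 : dz (const_mx 1) = 1%:M.
Proof.
apply/matrixP => a b; rewrite dzE mxE /dv; case: (sneg a); by rewrite mxE ?invr1.
Qed.

Lemma dz_mulmx z x a b : (dz z *m x) a b = dv z a * x a b.
Proof. by rewrite mul_diag_mx !mxE. Qed.

Lemma mulmx_dz z x a b : (x *m dz z) a b = x a b * dv z b.
Proof. by rewrite mul_mx_diag !mxE. Qed.

Lemma symp_form_star a b : J a b = if b == star a then (-1) ^+ sneg a else 0.
Proof.
rewrite symp_formE; case: (split_ordP a) => i ->; case: (split_ordP b) => j ->; rewrite !shiftE.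
- by rewrite eq_lrshift.
- by rewrite eq_rshift eq_sym; case: eqP.
- by rewrite eq_lshift eq_sym; case: eqP => //; rewrite oppr0.
- by rewrite eq_rlshift.
Qed.

Lemma Sp_dz z : Gm z -> Sp (dz z).
Proof.
move=> zG; rewrite /Sp /= {1}/dz tr_diag_mx -/(dz z); apply/matrixP => a b.
rewrite mulmx_dz dz_mulmx symp_form_star; case: eqP => [->|]; last by rewrite mulr0 mul0r.
by rewrite mulrAC dv_star divff ?mul1r // dv_neq0.
Qed.

Lemma Sp_inv g : Sp g -> Sp (invmx g).
Proof.
move=> gS; have gU := Sp_unitmx gS; rewrite /Sp /=.
rewrite -{1}[J](gS : _ = _) !mulmxA -trmx_mul mulmxV // trmx1 mul1mx.
by rewrite mulmxK.
Qed.

Lemma Sp_diag x : Sp x -> (forall a b, a != b -> x a b = 0) ->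
  exists2 z, Gm z & x = dz z.
Proof.
move=> xS xd; pose z : 'rV[K]_n := \row_i x (lshift n i) (lshift n i).
have E i : x (lshift n i) (lshift n i) * x (rshift n i) (rshift n i) = 1.
  have := congr1 (fun y : 'M[K]_(n + n) => y (lshift n i) (rshift n i)) (xS : _ = _).
  rewrite /= symp_form_star !shiftE eqxx expr0 => <-.
  rewrite mxE (bigD1 (rshift n i)) //= big1 ?addr0 => [|b bi]; last by rewrite xd ?mulr0.
  congr (_ * _); rewrite mxE (bigD1 (lshift n i)) //= big1 ?addr0 => [|b bi].
    by rewrite symp_form_star !shiftE eqxx mulr1 mxE.
  by rewrite mxE xd ?mul0r.
have zG : Gm z.
  by move=> i; rewrite mxE; apply/eqP => e; have /eqP := E i; rewrite e mul0r eq_sym oner_eq0.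
exists z => //; apply/matrixP => a b; rewrite dzE.
have [<-|/xd //] := eqVneq a b; rewrite mulr1n /dv.
case: (split_ordP a) => i ->; rewrite !shiftE mxE //.
by apply: (mulfI (zG i)); rewrite mxE E divff //; have := zG i; rewrite mxE.
Qed.

Definition ad g z := g *m dz z *m invmx g.

Section MaxTorus.
Variable g : 'M[K]_(n + n).
Hypothesis gS : Sp g.
Let gU : g \in unitmx := Sp_unitmx gS.

Lemma adM z w : ad g (map2_mx *%R z w) = ad g z *m ad g w.
Proof. by rewrite /ad dzM !mulmxA mulmxKV. Qed.

Lemma ad1 : ad g (const_mx 1) = 1%:M.
Proof. by rewrite /ad dz1 mulmx1 mulmxV. Qed.

Lemma adK z : invmx g *m ad g z *m g = dz z.
Proof. by rewrite /ad !mulmxA mulVmx // mul1mx mulmxKV. Qed.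

Lemma Sp_ad z : Gm z -> Sp (ad g z).
Proof. by move=> zG; apply: Sp_mul (Sp_inv gS); apply: Sp_mul gS (Sp_dz zG). Qed.

Lemma conj_diag t : is_diag_mx (invmx g *m t *m g) -> Sp t ->
  exists2 z, Gm z & t = ad g z.
Proof.
move=> /is_diag_mxP d tS; have [|a b ab|z zG e] := @Sp_diag (invmx g *m t *m g).
- by apply: Sp_mul gS; apply: Sp_mul tS; exact: Sp_inv.
- by apply: d; rewrite -val_eqE in ab.
- by exists z => //; rewrite /ad -e !mulmxA mulmxV // mul1mx mulmxK.
Qed.

Lemma mul_Gm z w : Gm z -> Gm w -> Gm (map2_mx *%R z w).
Proof. by move=> zG wG i; rewrite mxE mulf_neq0 // ?zG ?wG. Qed.

Lemma inv_Gm z : Gm z -> Gm (map_mx GRing.inv z).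
Proof. by move=> zG i; rewrite mxE invr_eq0 zG. Qed.

Lemma one_Gm : Gm (const_mx 1 : 'rV[K]_n).
Proof. by move=> i; rewrite mxE oner_eq0. Qed.

Lemma polyfun_conj a b : polyfun (fun t : 'M[K]_(n + n) => (invmx g *m t *m g) a b).
Proof.
have -> : (fun t => (invmx g *m t *m g) a b) =
    fun t => \sum_k (\sum_l invmx g a l * t l k) * g k b.
  by apply/funext => t; rewrite mxE; apply: eq_bigr => k _; rewrite mxE.
apply: polyfun_sum => k; apply: polyfunM; last exact: polyfun_const.
apply: polyfun_sum => l; apply: polyfunM; [exact: polyfun_const|exact: polyfun_entry].
Qed.

(** The torus to which the maximality of [T] is applied. It is closed because, by [conj_diag], an
    element of [Sp] outside it has a nonzero off-diagonal entry in the basis [g]. *)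
Lemma torus_ad : torus [set ad g z | z in @Gm K n].
Proof.
split; first split.
- by move=> _ [z zG <-]; exact: Sp_ad.
- by exists (const_mx 1); [exact: one_Gm|exact: ad1].
- by move=> _ _ [z zG <-] [w wG <-]; exists (map2_mx *%R z w); [exact: mul_Gm|exact: adM].
- move=> _ [z zG <-]; exists (map_mx GRing.inv z); first exact: inv_Gm.
  have E : ad g z *m ad g (map_mx GRing.inv z) = 1%:M.
    rewrite -adM -ad1; congr ad; apply/rowP => i; by rewrite !mxE divff // zG.
  have [U _] := mulmx1_unit E.
  by rewrite -[RHS]mulmx1 -E mulKmx.
- apply/zopenP; split=> [t []//|t [tS nt]].
  have [a [b [ab tab]]] : exists a b, a != b /\ (invmx g *m t *m g) a b != 0.
    apply: contrapT => H; apply: nt; have [|z zG ->] := conj_diag _ tS; last by exists z.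
    apply/is_diag_mxP => a b ab; apply/eqP/negPn/negP => h; apply: H.
    by exists a, b; rewrite -val_eqE.
  exists (fun t => (invmx g *m t *m g) a b); split; [exact: polyfun_conj|exact/eqP|].
  move=> t' t'S t'ab; split=> // -[z _ E]; apply: t'ab.
  by rewrite -E adK dzE (negPf ab).
exists n, (ad g), (fun t => \row_i (invmx g *m t *m g) (lshift n i) (lshift n i)).
have K1 z : \row_i (invmx g *m ad g z *m g) (lshift n i) (lshift n i) = z.
  by apply/rowP => i; rewrite mxE adK dzE eqxx mulr1n /dv !shiftE.
split.
- split=> [z zG|_ [z zG <-]]; first by exists z.
  by rewrite K1.
- by split=> [z _|_ [z _ <-]]; rewrite K1.
- by move=> z w _ _; exact: adM.
- move=> a b; have -> : (fun z => ad g z a b) = fun z => \sum_k (g a k * dv z k) * invmx g k b.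
    by apply/funext => z; rewrite mxE; apply: eq_bigr => k _; rewrite mulmx_dz.
  apply: zregular_sum => k; apply: zregularM; last by apply: zregular_polyfun; exact: polyfun_const.
  apply: zregularM; first by apply: zregular_polyfun; exact: polyfun_const.
  have R : zregular (@Gm K n) (fun z => z 0 (sidx k)) by apply: zregular_polyfun; exact: polyfun_entry.
  by rewrite /dv; case: (sneg k) => //; apply: zregularV R => z zG; exact: zG.
- move=> a b; apply: zregular_polyfun.
  by under eq_fun do rewrite mxE; exact: polyfun_conj.
Qed.

End MaxTorus.

(** In the basis [g] the elements of [T] are diagonal, so [T] lies in the full diagonal torus, and
    maximality gives equality. *)
Lemma maximal_torus_ad T g : maximal_torus T -> Sp g ->
  (forall a, is_weight_vec T (col a g)) -> T = [set ad g z | z in @Gm K n].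
Proof.
move=> [[[TS _ _ _] _ _] Tm] gS gw; symmetry; apply: Tm; first exact: torus_ad.
have gU := Sp_unitmx gS.
move=> t Tt; have [|z zG ->] := conj_diag gS _ (TS _ Tt); last by exists z.
apply/is_diag_mxP => a b ab; have [mu muE] := gw b.
have : t *m g *m delta_mx b (0 : 'I_1) = mu t *: (g *m delta_mx b 0).
  by rewrite -mulmxA -colE muE.
move=> /(congr1 (mulmx (invmx g))); rewrite -!scalemxAr mulKmx // !mulmxA -colE.
move=> /(congr1 (fun y : 'cV[K]__ => y a 0)).
rewrite [LHS]mxE [RHS]mxE [delta_mx _ _ _ _]mxE -val_eqE (negPf ab) mulr0.
by move=> <-.
Qed.

Lemma maximal_torus_exists T : maximal_torus T ->
  exists2 g, Sp g & T = [set ad g z | z in @Gm K n].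
Proof.
move=> Tm; have [[[TS _ _ _] _ _] _] := Tm.
have [u uU ud] := torus_diagonal Tm.1.
have [|a|g gS gw] := @symplectic_weight_basis K n T TS (invmx u).
- by rewrite unitmx_inv.
- exists (fun t => (u *m t *m invmx u) a a) => t Tt.
  have /is_diag_mxP d := ud _ Tt; apply: (can_inj (mulKmx uU)).
  rewrite -scalemxAr !colE !mulmxA mulmxV // mul1mx -colE; apply/colP => i.
  rewrite !mxE andbT; have [->|ia] := eqVneq i a; first by rewrite mulr1.
  by rewrite mulr0; have := d i a; rewrite mxE => ->.
- by exists g => //; exact: maximal_torus_ad Tm gS gw.
Qed.

End StandardTorus.

(** * Matching the characters [eps] with coordinates *)

Section Weights.
Variables (K : numClosedFieldType) (n : nat).
Implicit Types (z w : 'rV[K]_n) (t g h x : 'M[K]_(n + n)) (a b : 'I_(n + n)).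
Variable eps : 'I_n -> 'M[K]_(n + n) -> K.

Lemma weight_charD u v t : (forall i, eps i t != 0) ->
  weight_char eps (u + v) t = weight_char eps u t * weight_char eps v t.
Proof.
move=> e0; rewrite /weight_char -big_split /=; apply: eq_bigr => i _.
by rewrite mxE expfzDr.
Qed.

Lemma weight_charN u t : weight_char eps (- u) t = (weight_char eps u t)^-1.
Proof.
rewrite /weight_char -prodfV; apply: eq_bigr => i _.
by rewrite mxE -invr_expz.
Qed.

Lemma weight_char_eps i t : weight_char eps (eps_vec i) t = eps i t.
Proof.
rewrite /weight_char (bigD1 i) //= !mxE !eqxx expr1z big1 ?mulr1 // => j ji.
by rewrite mxE eqxx (negPf ji) expr0z.
Qed.

End Weights.

Lemma roots_CP n (i j : 'I_n) (s s' : bool) :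
  (-1) ^+ s *: eps_vec i + (-1) ^+ s' *: eps_vec j != 0 ->
  roots_C ((-1) ^+ s *: eps_vec i + (-1) ^+ s' *: eps_vec j).
Proof. by split=> //; exists i, j, s, s'. Qed.

Section StandardCoordinates.
Variables (K : numClosedFieldType) (n : nat).
Implicit Types (z w : 'rV[K]_n) (t g h x : 'M[K]_(n + n)) (a b : 'I_(n + n)).
Variable T : set 'M[K]_(n + n).
Hypothesis T_max : maximal_torus T.
Variable eps : 'I_n -> 'M[K]_(n + n) -> K.
Hypothesis eps_coord : bourbaki_coordinates T eps.

(** A nonzero entry [(a, b)] of a root vector, in the basis [g], exhibits the root as the difference
    of the weights of the coordinates [a] and [b]. *)
Lemma weight_entry g (beta : 'M[K]_(n + n) -> K) x z a b : g \in unitmx ->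
  T (ad g z) -> weight_vector T beta x -> Gm z ->
  dv z a * (invmx g *m x *m g) a b = beta (ad g z) * (invmx g *m x *m g) a b * dv z b.
Proof.
move=> gU Tz [_ /(_ _ Tz) E] zG.
have E' : dz z *m (invmx g *m x *m g) = (beta (ad g z) *: (invmx g *m x *m g)) *m dz z.
  have adU : ad g z \in unitmx.
    rewrite /ad !unitmx_mul gU unitmx_inv gU andbT /= unitmxE det_diag unitfE.
    by apply/prodf_neq0 => k _; rewrite mxE dv_neq0.
  have E2 : ad g z *m x = beta (ad g z) *: x *m ad g z by rewrite -E mulmxKV.
  have gz : g *m dz z = ad g z *m g by rewrite /ad mulmxKV.
  rewrite -scalemxAl -!mulmxA gz !mulmxA.
  have zg : dz z *m invmx g = invmx g *m ad g z by rewrite /ad !mulmxA mulVmx // mul1mx.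
  by rewrite zg -(mulmxA (invmx g)) E2 -scalemxAl -scalemxAr -scalemxAl !mulmxA.
have := congr1 (fun y : 'M[K]_(n + n) => y a b) E'.
by rewrite dz_mulmx mulmx_dz => ->; rewrite [X in X * _]mxE.
Qed.

Let TS : T `<=` @Sp K n. Proof. by case: T_max => [[[]]]. Qed.

Lemma eps_neq0 i t : T t -> eps i t != 0.
Proof. by case: eps_coord => /(_ i)[H _ _] _; exact: H. Qed.

Lemma epsM i t t' : T t -> T t' -> eps i (t *m t') = eps i t * eps i t'.
Proof. by case: eps_coord => /(_ i)[_ H _] _; exact: H. Qed.

Lemma eps1 i : eps i 1%:M = 1.
Proof.
have T1 : T 1%:M by case: T_max => [[[]]].
by apply: (mulfI (eps_neq0 i T1)); rewrite -epsM // mul1mx mulr1.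
Qed.

Lemma root_vector v : roots_C v -> (exists2 t, T t & weight_char eps v t != 1) /\
  exists2 x, x != 0 & weight_vector T (weight_char eps v) x.
Proof.
move=> vR; have [_ /(_ (weight_char eps v)) H] := eps_coord.
by have [|_ h1 h2] := H.2; first by exists v.
Qed.

Section Basis.
Variable g : 'M[K]_(n + n).
Hypotheses (gS : Sp g) (Tg : T = [set ad g z | z in @Gm K n]).

Let adT z : Gm z -> T (ad g z). Proof. by move=> zG; rewrite Tg; exists z. Qed.

(* A root vector for [2 epsilon_i] with a nonzero entry [(a, b)] gives
   [2 epsilon_i = weight a - weight b]; testing on signs shows that [b] is [star a]. *)
Lemma eps_coordinate i : exists a, forall z, Gm z -> eps i (ad g z) = dv z a.
Proof.
pose v := (-1) ^+ false *: eps_vec i + (-1) ^+ false *: eps_vec i : 'rV[int]_n.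
have vN0 : v != 0.
  by apply/eqP => /rowP/(_ i); rewrite !mxE !eqxx.
have vE t : T t -> weight_char eps v t = eps i t ^+ 2.
  by move=> Tt; rewrite /v expr0 scale1r weight_charD ?weight_char_eps // => j; exact: eps_neq0.
have [[t Tt vt] [x xN0 xw]] := root_vector (roots_CP vN0).
have [a [b ab]] : exists a b, (invmx g *m x *m g) a b != 0.
  apply: contrapT => H; move/eqP: xN0; apply.
  have -> : x = g *m (invmx g *m x *m g) *m invmx g.
    by rewrite !mulmxA mulmxV ?Sp_unitmx // mul1mx mulmxK ?Sp_unitmx.
  rewrite (_ : invmx g *m x *m g = 0) ?mulmx0 ?mul0mx //.
  apply/matrixP => a b; rewrite [RHS]mxE; apply/eqP/negPn/negP => h; apply: H; by exists a, b.
have E z : Gm z -> dv z a = eps i (ad g z) ^+ 2 * dv z b.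
  move=> zG; apply: (mulIf ab).
  by rewrite (weight_entry _ _ _ (adT zG) xw) ?Sp_unitmx // vE; [rewrite mulrAC|exact: adT].
have epsX z : Gm z -> eps i (ad g (map2_mx *%R z z)) = eps i (ad g z) ^+ 2.
  by move=> zG; rewrite adM // epsM ?expr2 //; exact: adT.
have /same_idx[bE|bE] : sidx a = sidx b.
  (* As [z] squares to [1], so does the value of [eps i] on it, whereas the weight of [a] is [-1]
     there and that of [b] is [1]. *)
  apply/eqP; apply: contraT => ne; pose z : 'rV[K]_n := \row_j (if j == sidx a then -1 else 1).
  have zG : Gm z by move=> j; rewrite mxE; case: (j == _); rewrite ?oppr_eq0 oner_eq0.
  have := E z zG; rewrite -epsX //.
  have -> : map2_mx *%R z z = const_mx 1.
    by apply/rowP => j; rewrite !mxE; case: (j == _); rewrite ?mulrNN mulr1.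
  rewrite ad1 // eps1 mul1r /dv !mxE eqxx [sidx b == _]eq_sym (negPf ne).
  have -> : (if sneg a then (-1)^-1 else -1) = -1 :> K by case: (sneg a); rewrite ?invrN1.
  have -> : (if sneg b then 1^-1 else 1) = 1 :> K by case: (sneg b); rewrite ?invr1.
  by move/eqP; rewrite eqNr oner_eq0.
(* [b = a] would make the root [2 epsilon_i] trivial on [T]. *)
- move: Tt vt; rewrite Tg => -[z zG <-]; rewrite vE; last exact: adT.
  have := E z zG; rewrite bE => E'; case/eqP.
  by apply: (mulIf (dv_neq0 a zG)); rewrite -E' mul1r.
(* Only the squares of [eps i] and of the weight of [a] are known to agree, which suffices because
   every element of the torus is a square. *)
exists a => z zG; pose w : 'rV[K]_n := map_mx sqrtC z.
have wG : Gm w by move=> j; rewrite mxE sqrtC_eq0 zG.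
have -> : z = map2_mx *%R w w by apply/rowP => j; rewrite !mxE -expr2 sqrtCK.
rewrite epsX // dvM; have := E w wG; rewrite bE dv_star => E'.
by rewrite {1}E' mulfVK // dv_neq0.
Qed.

End Basis.

(** Each [eps i] is the weight of a coordinate [c i]. The roots [epsilon_i - epsilon_j] and
    [epsilon_i + epsilon_j] are nontrivial, so different [c i] lie in different symplectic pairs;
    permuting the pairs and exchanging vectors within them makes [eps i] the weight of the
    coordinate [i]. *)
Lemma standard_torus : exists2 h, Sp h &
  [/\ T = [set ad h z | z in @Gm K n] & forall i z, Gm z -> eps i (ad h z) = z 0 i].
Proof.
have [g gS Tg] := maximal_torus_exists T_max.
have adT z : Gm z -> T (ad g z) by move=> zG; rewrite Tg; exists z.
have /choice[c cP] := eps_coordinate gS Tg.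
have c_inj i j : sidx (c i) = sidx (c j) -> i = j.
  move=> e; apply/eqP; apply: contraT => ij.
  pose r (s : bool) := (-1) ^+ false *: eps_vec i + (-1) ^+ s *: eps_vec j : 'rV[int]_n.
  have rN0 s : r s != 0.
    apply/eqP => /rowP/(_ i); rewrite !mxE !eqxx /= (negPf ij) mulr0 addr0 => /eqP.
    by rewrite ?expr0 ?mulr1 oner_eq0.
  have H (s : bool) : exists2 z, Gm z & eps i (ad g z) * (eps j (ad g z)) ^ ((-1) ^+ s : int) != 1.
    have [[t Tt rt] _] := root_vector (roots_CP (rN0 s)).
    move: Tt rt; rewrite Tg => -[z zG <-] rt; exists z => //; move: rt.
    have e0 l : eps l (ad g z) != 0 by apply/eps_neq0/adT.
    rewrite /r weight_charD // expr0 scale1r weight_char_eps; case: s.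
      by rewrite expr1 scaleN1r weight_charN weight_char_eps -invr_expz expr1z.
    by rewrite expr0 scale1r weight_char_eps expr1z.
  have [E|E] := same_idx e.
    have [z zG] := H true; rewrite -invr_expz expr1z cP // cP // E divff ?eqxx //.
    exact: dv_neq0.
  have [z zG] := H false; rewrite expr1z cP // cP // E dv_star divff ?eqxx //.
  exact: dv_neq0.
(* Exchanging the two vectors of a pair changes the sign of the form; [sg i] restores it. *)
pose sg i : K := (-1) ^+ sneg (c i).
pose h := \matrix_(k, a) match fintype.split a with
  | inl i => g k (c i) | inr i => sg i * g k (star (c i)) end.
have hcl i : col (lshift n i) h = col (c i) g.
  by apply/colP => k; rewrite !mxE !shiftE.
have hcr i : col (rshift n i) h = sg i *: col (star (c i)) g.
  by apply/colP => k; rewrite !mxE !shiftE.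
have gf a b : sform (col a g) (col b g) = if b == star a then (-1) ^+ sneg a else 0.
  by rewrite sform_col (gS : _ = _) symp_form_star.
have idx_star a : sidx (star a) = sidx a by case: (split_ordP a) => i ->; rewrite !shiftE.
have starK a : star (star a) = a by case: (split_ordP a) => i ->; rewrite !shiftE.
have star_eq i j : (c j == star (c i)) = false.
  apply/eqP => e; have := congr1 (@sidx n) e; rewrite idx_star => /c_inj ji.
  move: e; rewrite ji; case: (split_ordP (c i)) => l ->; rewrite !shiftE => /eqP.
    by rewrite eq_lrshift.
  by rewrite eq_rlshift.
have hS : Sp h.
  rewrite /Sp /=; apply/matrixP => a b; rewrite -sform_col symp_form_star.
  case: (split_ordP a) => i ->; case: (split_ordP b) => j ->; rewrite !shiftE ?hcl ?hcr.
  - by rewrite gf star_eq eq_lrshift.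
  - rewrite sformZr gf eq_rshift.
    have -> : (star (c j) == star (c i)) = (j == i).
      apply/eqP/eqP => [/(congr1 (@star n))|-> //]; rewrite !starK => e; apply: c_inj; by rewrite e.
    by case: eqP => [->|_]; rewrite ?mulr0 // /sg -signr_addb addbb.
  - rewrite sformZl gf starK eq_lshift.
    have -> : (c j == c i) = (j == i) by apply/eqP/eqP => [e|-> //]; apply: c_inj; rewrite e.
    case: eqP => _; rewrite ?mulr0 // /sg -signr_addb.
    by case: (split_ordP (c i)) => l ->; rewrite !shiftE.
  - by rewrite sformZl sformZr gf starK [star _ == _]eq_sym star_eq eq_rlshift !mulr0.
have adg z a : Gm z -> ad g z *m col a g = dv z a *: col a g.
  move=> zG; rewrite {1}colE /ad -mulmxA mulKmx ?Sp_unitmx //.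
  by apply/colP => k; rewrite -colE [LHS]mxE mulmx_dz [RHS]mxE [col a g k 0]mxE mulrC.
have hw a : is_weight_vec T (col a h).
  exists (fun t => match fintype.split a with inl i => eps i t | inr i => (eps i t)^-1 end) => t.
  rewrite Tg => -[z zG <-] /=; case: (split_ordP a) => i ->; rewrite ?shiftE ?hcl ?hcr.
    by rewrite adg // cP.
  by rewrite -scalemxAr adg // cP // dv_star !scalerA mulrC.
exists h => //; split; first exact: maximal_torus_ad.
move=> i z zG; have Th := maximal_torus_ad T_max hS hw.
have : T (ad h z) by rewrite Th; exists z.
rewrite Tg => -[z' z'G e].
have E1 : ad h z *m col (lshift n i) h = z 0 i *: col (lshift n i) h.
  rewrite {1}colE /ad -mulmxA mulKmx ?Sp_unitmx //; apply/colP => k.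
  by rewrite -colE [LHS]mxE mulmx_dz [RHS]mxE [col _ h k 0]mxE mulrC /dv !shiftE.
have E2 : ad h z *m col (lshift n i) h = eps i (ad h z) *: col (lshift n i) h.
  by rewrite -e hcl adg // cP.
have /eqP := etrans (esym E1) E2; rewrite -subr_eq0 -scalerBl scaler_eq0 => /orP[|].
  by rewrite subr_eq0 => /eqP.
move=> /eqP/(congr1 (mulmx (invmx h))); rewrite colE mulKmx ?Sp_unitmx // mulmx0.
by move/colP/(_ (lshift n i)); rewrite !mxE !eqxx => /eqP; rewrite oner_eq0.
Qed.

End StandardCoordinates.

(** * The parabolic subgroup as the stabilizer of a line *)

Section Generation.
Variables (K : numClosedFieldType) (n : nat).
Implicit Types (u v w : 'cV[K]_(n + n)) (x y : 'M[K]_(n + n)) (a b : 'I_(n + n)) (i j : 'I_n).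

Definition bvec a : 'cV[K]_(n + n) := delta_mx a 0.
Local Notation L i := (bvec (lshift n i)).
Local Notation R i := (bvec (rshift n i)).

(* Root vectors of [epsilon_i - epsilon_j] (X1), [epsilon_i + epsilon_j] (X2),
   [- 2 epsilon_i] (X3) and [2 epsilon_i] (X4). *)
Definition X1 i j : 'M[K]_(n + n) :=
  delta_mx (lshift n i) (lshift n j) - delta_mx (rshift n j) (rshift n i).
Definition X2 i j : 'M[K]_(n + n) :=
  delta_mx (lshift n i) (rshift n j) + delta_mx (lshift n j) (rshift n i).
Definition X4 i : 'M[K]_(n + n) := delta_mx (lshift n i) (rshift n i).
Definition X3 i : 'M[K]_(n + n) := delta_mx (rshift n i) (lshift n i).

Lemma delta_bvec a b c : delta_mx a b *m bvec c = (b == c)%:R *: bvec a.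
Proof. by rewrite /bvec mul_delta_mx_cond scaler_nat. Qed.

Lemma X1E i j a : X1 i j *m bvec a =
  (lshift n j == a)%:R *: L i - (rshift n i == a)%:R *: R j.
Proof. by rewrite mulmxBl !delta_bvec. Qed.

Lemma X2E i j a : X2 i j *m bvec a =
  (rshift n j == a)%:R *: L i + (rshift n i == a)%:R *: L j.
Proof. by rewrite mulmxDl !delta_bvec. Qed.

Lemma X3E i a : X3 i *m bvec a = (lshift n i == a)%:R *: R i.
Proof. by rewrite delta_bvec. Qed.

Lemma X4E i a : X4 i *m bvec a = (rshift n i == a)%:R *: L i.
Proof. by rewrite delta_bvec. Qed.

Lemma elemE c x v : (1%:M + c *: x) *m v = v + c *: (x *m v).
Proof. by rewrite mulmxDl mul1mx -scalemxAl. Qed.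

Variable Hs : set 'M[K]_(n + n).
Hypothesis HsS : Hs `<=` @Sp K n.
Hypothesis Hs1 : Hs 1%:M.
Hypothesis HsM : forall x y, Hs x -> Hs y -> Hs (x *m y).
Hypothesis HsV : forall x, Hs x -> Hs (invmx x).
Hypothesis HsD : forall z : 'rV[K]_n, Gm z -> Hs (dz z).
Hypothesis Hs_up : forall i j c, j = i.+1 :> nat -> Hs (1%:M + c *: X1 i j).
Hypothesis Hs_down : forall i j c, j = i.+1 :> nat -> (0 < i)%N -> Hs (1%:M + c *: X1 j i).
Hypothesis Hs_long : forall i c, Hs (1%:M + c *: X4 i).
Hypothesis Hs_short : forall i j c, j = i.+1 :> nat -> Hs (1%:M + c *: X2 i j).
Hypothesis Hs_neg : forall i c, i.+1 = n -> (0 < i)%N -> Hs (1%:M + c *: X3 i).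

Definition fixes (k : nat) x := forall a, (sidx a < k)%N -> x *m bvec a = bvec a.
Definition above (k : nat) v := forall a, (sidx a < k)%N -> v a 0 = 0.
(** The moving element fixes the first [k] symplectic pairs, so that elimination in later
    coordinates does not disturb what is already settled. *)
Definition reach k v w := exists x, [/\ Hs x, fixes k x & x *m v = w].

Lemma reach_trans k u v w : reach k u v -> reach k v w -> reach k u w.
Proof.
move=> [x [Hx fx xE]] [y [Hy fy yE]]; exists (y *m x); split; first exact: HsM.
  by move=> a ak; rewrite -mulmxA fx // fy.
by rewrite -mulmxA xE yE.
Qed.

Lemma reach_sym k u v : reach k u v -> reach k v u.
Proof.
move=> [x [Hx fx xE]]; have xU := Sp_unitmx (HsS Hx).
exists (invmx x); split; first exact: HsV.
  by move=> a ak; rewrite -{1}(fx a ak) mulKmx.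
by rewrite -xE mulKmx.
Qed.

Lemma reach_elem k c X v w : Hs (1%:M + c *: X) ->
  (forall a, (sidx a < k)%N -> X *m bvec a = 0) -> v + c *: (X *m v) = w -> reach k v w.
Proof.
move=> HX X0 E; exists (1%:M + c *: X); split=> //; last by rewrite elemE.
by move=> a ak; rewrite elemE X0 // scaler0 addr0.
Qed.

Lemma sidx_lt_neq a i : (sidx a < i)%N -> ((lshift n i == a) = false) * ((rshift n i == a) = false).
Proof.
by move=> ai; split; apply/eqP => e; move: ai; rewrite -e !shiftE ltnn.
Qed.

Lemma X1_fix i j k a : (k <= i)%N -> (k <= j)%N -> (sidx a < k)%N -> X1 i j *m bvec a = 0.
Proof.
move=> ki kj ak; rewrite X1E.
by rewrite !sidx_lt_neq ?(leq_trans ak) // !scale0r subr0.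
Qed.

Lemma X2_fix i j k a : (k <= i)%N -> (k <= j)%N -> (sidx a < k)%N -> X2 i j *m bvec a = 0.
Proof.
move=> ki kj ak; rewrite X2E.
by rewrite !sidx_lt_neq ?(leq_trans ak) // !scale0r addr0.
Qed.

Lemma X3_fix i k a : (k <= i)%N -> (sidx a < k)%N -> X3 i *m bvec a = 0.
Proof. by move=> ki ak; rewrite X3E sidx_lt_neq ?(leq_trans ak) // scale0r. Qed.

Lemma X4_fix i k a : (k <= i)%N -> (sidx a < k)%N -> X4 i *m bvec a = 0.
Proof. by move=> ki ak; rewrite X4E sidx_lt_neq ?(leq_trans ak) // scale0r. Qed.

Lemma reach_lift i u v p q : reach i.+1 u v ->
  reach i (p *: L i + q *: R i + u) (p *: L i + q *: R i + v).
Proof.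
move=> [x [Hx fx xE]]; exists x; split=> //; first by move=> a ai; rewrite fx // ltnS ltnW.
by rewrite !mulmxDr -!scalemxAr !fx ?shiftE // xE.
Qed.

Lemma above_split i v : above i v ->
  exists2 u, above i.+1 u & v = v (lshift n i) 0 *: L i + v (rshift n i) 0 *: R i + u.
Proof.
move=> va; exists (v - (v (lshift n i) 0 *: L i + v (rshift n i) 0 *: R i)); last first.
  by rewrite addrC subrK.
move=> a; rewrite ltnS leq_eqVlt => /orP[/eqP/val_inj e|ai]; last first.
  have [h1 h2] := sidx_lt_neq ai.
  by rewrite !mxE (va _ ai) !(eq_sym a) h1 h2 !mulr0 addr0 subr0.
case: (split_ordP a) e => l ->; rewrite !shiftE => <-; rewrite !mxE !eqxx ?eq_lrshift ?eq_rlshift /=.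
  by rewrite mulr0 addr0 mulr1 subrr.
by rewrite mulr0 add0r mulr1 subrr.
Qed.

Lemma above_eq0 v : above n v -> v = 0.
Proof. by move=> va; apply/colP => a; rewrite mxE va. Qed.

Lemma bvec_neq0 a : bvec a != 0.
Proof. by apply/eqP => /colP/(_ a); rewrite !mxE !eqxx => /eqP; rewrite oner_eq0. Qed.

Lemma bvec_above a k : (k <= sidx a)%N -> above k (bvec a).
Proof.
move=> ka b bk; rewrite mxE; case: eqP => //= ba; move: bk; by rewrite ba ltnNge ka.
Qed.

Definition bvecE := (X1E, X2E, X3E, X4E, eqxx, eq_lrshift, eq_rlshift, eq_lshift, eq_rshift).

(** From an index [i > 0] on, the simple roots are available with both signs, since only the
    negative of the first one is missing; this is enough for transitivity on nonzero vectors. The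
    induction descends from the last pair, where root elements of [SL_2] suffice. *)
Lemma reach_above i v : (0 < i)%N -> above i v -> v != 0 -> reach i v (L i).
Proof.
have [m] := ubnP (n - i); elim: m i v => // m IH i v im i0 va vN0.
have [u ua vE] := above_split va.
set p := v (lshift n i) 0 in vE; set q := v (rshift n i) 0 in vE.
have [ni|ni] := ltnP i.+1 n; last first.
  have iE : i.+1 = n by apply/eqP; rewrite eqn_leq ni ltn_ord.
  have u0 : u = 0 by apply: above_eq0; rewrite -iE.
  rewrite u0 addr0 in vE; rewrite vE.
  (* The nonzero coefficient of [R i] serves to make that of [L i] equal to [1], and is then cleared
     by [X3]. *)
  have q_neq0 r s : s != 0 -> reach i (r *: L i + s *: R i) (L i).
    move=> sN0; apply: (@reach_trans _ _ (L i + s *: R i)).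
      apply: (@reach_elem _ ((1 - r) / s) (X4 i)) => [|a|]; first exact: Hs_long.
        exact: X4_fix.
      rewrite mulmxDr -!scalemxAr !bvecE scale0r scaler0 add0r scale1r scalerA divfK //.
      by rewrite addrAC -scalerDl (addrC r) subrK scale1r.
    apply: (@reach_elem _ (- s) (X3 i)) => [|a|]; [exact: Hs_neg|exact: X3_fix|].
    by rewrite mulmxDr -scalemxAr !bvecE scale0r scaler0 addr0 scale1r scaleNr addrK.
  have [q0|qN0] := eqVneq q 0; last exact: q_neq0.
  have pN0 : p != 0 by apply: contraNneq vN0 => p0; rewrite vE p0 q0 !scale0r addr0.
  apply: (@reach_trans _ _ (p *: L i + p *: R i)); last exact: q_neq0.
  apply: (@reach_elem _ 1 (X3 i)) => [|a|]; [exact: Hs_neg|exact: X3_fix|].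
  by rewrite q0 scale0r addr0 -scalemxAr !bvecE !scale1r.
pose j := Ordinal ni.
have ij : (i == j) = false by apply/eqP => /(congr1 val) /= /eqP; rewrite ltn_eqF.
have ji : (j == i) = false by rewrite eq_sym.
have j0 : (0 < j)%N by [].
have IHj w : above j w -> w != 0 -> reach j w (L j).
  by apply: IH => //; rewrite /= -ltnS (leq_trans _ im) // ltnS subnS ltn_predL subn_gt0.
have Rj : reach j (R j) (L j).
  by apply: IHj (bvec_neq0 _); apply: bvec_above; rewrite shiftE.
(* By induction a nonzero tail [w] can be moved freely: as [R j] it clears the coefficient of [R i],
   as [L j] it makes that of [L i] equal to [1], and finally it is cleared itself. *)
have main r s w : above j w -> w != 0 -> reach i (r *: L i + s *: R i + w) (L i).
  move=> wa wN0; apply: (@reach_trans _ _ (r *: L i + s *: R i + R j)).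
    by apply/reach_lift/(@reach_trans _ _ (L j)); [exact: IHj|exact: reach_sym].
  apply: (@reach_trans _ _ (r *: L i + 0 *: R i + ((r * s) *: L j + R j))).
    apply: (@reach_elem _ s (X1 j i)) => [|a|]; [exact: Hs_down|by apply: X1_fix => //=|].
    rewrite !mulmxDr -!scalemxAr !(bvecE, ij, ji).
    by apply/colP => a; rewrite /= !mxE; ring.
  apply: (@reach_trans _ _ (r *: L i + 0 *: R i + L j)).
    apply/reach_lift/IHj.
      move=> a aj; rewrite !mxE; have [h1 h2] := sidx_lt_neq aj.
      by rewrite !(eq_sym a) h1 h2 !mulr0 addr0.
    apply/eqP => /colP/(_ (rshift n j)); rewrite !mxE !eqxx eq_rlshift mulr0 add0r => /eqP.
    by rewrite oner_eq0.
  rewrite scale0r addr0; apply: (@reach_trans _ _ (L i + L j)).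
    apply: (@reach_elem _ (1 - r) (X1 i j)) => [|a|]; [exact: Hs_up|by apply: X1_fix => //=|].
    rewrite mulmxDr -scalemxAr !(bvecE, ij, ji).
    by apply/colP => a; rewrite /= !mxE; ring.
  apply: (@reach_elem _ (-1) (X1 j i)) => [|a|]; [exact: Hs_down|by apply: X1_fix => //=|].
  rewrite mulmxDr !(bvecE, ij, ji).
  by apply/colP => a; rewrite /= !mxE; ring.
(* A vanishing tail is first replaced by a nonzero one, produced from the coefficient of [L i] or of
   [R i]. *)
have [u0|uN0] := eqVneq u 0; last by rewrite vE; exact: main.
rewrite vE u0 addr0; have [p0|pN0] := eqVneq p 0; last first.
  apply: (@reach_trans _ _ (p *: L i + q *: R i + p *: L j)).
    apply: (@reach_elem _ 1 (X1 j i)) => [|a|]; [exact: Hs_down|by apply: X1_fix => //=|].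
    rewrite mulmxDr -!scalemxAr !(bvecE, ij, ji).
    by apply/colP => a; rewrite /= !mxE; ring.
  apply: main; last by rewrite scaler_eq0 negb_or pN0 bvec_neq0.
  by move=> a aj; rewrite !mxE; have [h1 h2] := sidx_lt_neq aj; rewrite (eq_sym a) h1 mulr0.
have qN0 : q != 0 by apply: contraNneq vN0 => q0; rewrite vE p0 q0 u0 !scale0r !addr0.
apply: (@reach_trans _ _ (p *: L i + q *: R i + (- q) *: R j)).
  apply: (@reach_elem _ 1 (X1 i j)) => [|a|]; [exact: Hs_up|by apply: X1_fix => //=|].
  rewrite mulmxDr -!scalemxAr !(bvecE, ij, ji) p0.
  by apply/colP => a; rewrite /= !mxE; ring.
apply: main; last by rewrite scaler_eq0 oppr_eq0 negb_or qN0 bvec_neq0.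
by move=> a aj; rewrite !mxE; have [h1 h2] := sidx_lt_neq aj; rewrite (eq_sym a) h2 mulr0.
Qed.

(** [x] preserves the orthogonal complement of the vectors it fixes, and the coordinate [b] of a
    vector is up to sign its pairing with the basis vector of index [star b]. *)
Lemma Sp_fixes_above k x a : Sp x -> fixes k x -> (k <= sidx a)%N -> above k (x *m bvec a).
Proof.
move=> xS fx ka b bk; pose c := star b.
have ck : (sidx c < k)%N by move: bk; rewrite /c; case: (split_ordP b) => l ->; rewrite !shiftE.
have sb d e : sform (bvec d) (bvec e) = symp_form K n d e.
  by rewrite /sform /bvec trmx_delta -rowE -colE !mxE.
have sv v : sform (bvec c) v = symp_form K n c b * v b 0.
  rewrite /sform /bvec trmx_delta -rowE mxE (bigD1 b) //= big1 ?addr0 ?mxE // => d db.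
  rewrite mxE symp_form_star ifF ?mul0r //; apply/negbTE.
  by move: db; rewrite /c; case: (split_ordP b) => l ->; rewrite !shiftE.
have := sform_Sp (bvec c) (bvec a) xS; rewrite fx // sv sb !symp_form_star.
have -> : b == star c by rewrite /c; case: (split_ordP b) => l ->; rewrite !shiftE.
rewrite ifF => [/eqP|]; first by rewrite mulf_eq0 signr_eq0 => /eqP.
apply/eqP => e; move: ka; rewrite e leqNgt /c.
by case: (split_ordP b) bk => l ->; rewrite !shiftE => ->.
Qed.

(** Pairing with [L i] gives [x R_i = p L_i + R_i + u]. The tail [u] is moved to [L j] with
    [j = i + 1] and removed by the root [epsilon_i + epsilon_j]; the root [2 epsilon_i] removes
    [p L_i]. As [reach_above] is used only from [j] on, [i = 0] is allowed. *)
Lemma fix_next (i : 'I_n) x : Sp x -> fixes i x -> x *m L i = L i ->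
  exists2 y, Hs y & fixes i.+1 (y *m x).
Proof.
move=> xS fx xL; set w := x *m R i.
have wa : above i w by apply: Sp_fixes_above => //; rewrite shiftE.
have [u ua wE] := above_split wa; set p := w (lshift n i) 0 in wE.
have w1 : w (rshift n i) 0 = 1.
  have sv v : sform (L i) v = v (rshift n i) 0.
    rewrite /sform /bvec trmx_delta -rowE mxE (bigD1 (rshift n i)) //= big1 ?addr0 => [|d db].
      by rewrite mxE symp_form_star !shiftE eqxx mul1r.
    by rewrite mxE symp_form_star !shiftE (negPf db) mul0r.
  by have := sform_Sp (L i) (R i) xS; rewrite xL !sv => ->; rewrite !mxE !eqxx.
rewrite w1 scale1r in wE.
have H : exists y, [/\ Hs y, fixes i y, y *m L i = L i & y *m w = p *: L i + R i].
  have [u0|uN0] := eqVneq u 0.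
    exists 1%:M; split; rewrite ?mul1mx //; last by rewrite wE u0 addr0.
    by move=> a _; rewrite mul1mx.
  have ni : (i.+1 < n)%N.
    rewrite ltnNge; apply: contra uN0 => ni; apply/eqP/above_eq0 => a an.
    by apply: ua; exact: leq_trans (ltn_ord _) ni.
  pose j := Ordinal ni.
  have [y [Hy fy yu]] : reach j u (L j) by apply: reach_above.
  have ij : (i == j) = false by apply/eqP => /(congr1 val) /= /eqP; rewrite ltn_eqF.
  exists ((1%:M + (-1) *: X2 i j) *m y); split.
  - by apply: HsM Hy; exact: Hs_short.
  - move=> a ai; rewrite -mulmxA fy; last by rewrite ltnS ltnW.
    by rewrite elemE (@X2_fix _ _ i) ?scaler0 ?addr0 //=.
  - rewrite -mulmxA fy ?shiftE //; by rewrite elemE !bvecE !scale0r addr0 scaler0 addr0.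
  - rewrite -mulmxA wE !mulmxDr -scalemxAr !fy ?shiftE // yu !elemE -!scalemxAr !bvecE.
    have ji : (j == i) = false by rewrite eq_sym.
    rewrite !(ij, ji) /=.
    by apply/colP => a; rewrite /= !mxE; ring.
have [y [Hy fy yL yw]] := H; exists ((1%:M + (- p) *: X4 i) *m y).
  by apply: HsM Hy; exact: Hs_long.
move=> a; rewrite ltnS leq_eqVlt -!mulmxA => /orP[/eqP/val_inj|ai]; last first.
  by rewrite fx // fy // elemE (@X4_fix _ i) // scaler0 addr0.
case: (split_ordP a) => l ->; rewrite shiftE => ->.
  by rewrite xL yL elemE !bvecE scale0r scaler0 addr0.
rewrite -/w yw elemE mulmxDr -scalemxAr !bvecE scale0r scaler0 add0r scale1r.
by rewrite scaleNr addrAC subrr add0r.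
Qed.

(** Each step fixes one more pair, and an element fixing all pairs is the identity. The bound
    [0 < k] is that of [reach_above]. *)
Lemma fixes_in (k : nat) x : (0 < k)%N -> (k <= n)%N -> Sp x -> fixes k x -> Hs x.
Proof.
have [m] := ubnP (n - k); elim: m k x => // m IH k x km k0 kn xS fx.
have [nk|nk] := leqP n k.
  have -> : x = 1%:M; last exact: Hs1.
  apply/matrixP => a b; have /colP/(_ a) := fx b (leq_trans (ltn_ord _) nk).
  by rewrite /bvec -colE !mxE andbT.
pose i := Ordinal nk.
have [y [Hy fy yx]] : reach k (x *m L i) (L i).
  apply: (@reach_above i) => //; first by apply: Sp_fixes_above; rewrite ?shiftE.
  apply/eqP => e; have := bvec_neq0 (lshift n i).
  by rewrite -(mulKmx (Sp_unitmx xS) (L i)) e mulmx0 eqxx.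
have [|||y' Hy' fy'] := @fix_next i (y *m x).
- by apply: Sp_mul xS; exact: HsS.
- by move=> a ai; rewrite -mulmxA fx // fy.
- by rewrite -mulmxA.
have : Hs (y' *m (y *m x)).
  apply: (IH k.+1) => //; first by rewrite -ltnS (leq_trans _ km) // ltnS subnS ltn_predL subn_gt0.
  by apply: Sp_mul; [exact: HsS|apply: Sp_mul xS; exact: HsS].
move=> H; have := HsM (HsV Hy) (HsM (HsV Hy') H).
by rewrite !mulKmx // ?Sp_unitmx //; exact: HsS.
Qed.

(** A torus element makes the scalar equal to [1]; [fix_next] settles the first pair and [fixes_in]
    the others. *)
Lemma stabilizer_in (i : 'I_n) x c : i = 0%N :> nat -> Sp x -> c != 0 ->
  x *m L i = c *: L i -> Hs x.
Proof.
move=> i0 xS cN0 xL; pose z : 'rV[K]_n := \row_j (if j == i then c^-1 else 1).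
have zG : Gm z by move=> j; rewrite mxE; case: (j == i); rewrite ?invr_eq0 ?oner_eq0.
have Hz := HsD zG; have zS := HsS Hz.
have zL : dz z *m L i = c^-1 *: L i.
  apply/colP => a; rewrite mul_diag_mx !mxE; case: eqP => [->|_]; last by rewrite !mulr0.
  by rewrite /dv !shiftE mxE eqxx.
have [|||y Hy fy] := @fix_next i (dz z *m x).
- exact: Sp_mul.
- by move=> a; rewrite i0.
- by rewrite -mulmxA xL -scalemxAr zL scalerA divff // scale1r.
have H : Hs (y *m (dz z *m x)).
  apply: (@fixes_in i.+1) => //; apply: Sp_mul; first exact: HsS.
  exact: Sp_mul.
have := HsM (HsV Hz) (HsM (HsV Hy) H).
by rewrite !mulKmx // ?Sp_unitmx //; exact: HsS.
Qed.

End Generation.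

(** * Root elements, the parabolic subgroup and its character *)

Section Parabolic.
Variables (K : numClosedFieldType) (n : nat).
Hypothesis n_ge2 : (2 <= n)%N.
Implicit Types (z w : 'rV[K]_n) (t g h x p : 'M[K]_(n + n)) (a b : 'I_(n + n)) (i j : 'I_n) (u v : 'rV[int]_n).
Variable T : set 'M[K]_(n + n).
Variable eps : 'I_n -> 'M[K]_(n + n) -> K.
Hypothesis T_max : maximal_torus T.
Hypothesis eps_coord : bourbaki_coordinates T eps.
Variable h : 'M[K]_(n + n).
Hypothesis hS : Sp h.
Hypothesis Th : T = [set ad h z | z in @Gm K n].
Hypothesis eps_ad : forall i z, Gm z -> eps i (ad h z) = z 0 i.
Variable i1 : 'I_n.
Hypothesis i1E : i1 = 0%N :> nat.
Let hU : h \in unitmx := Sp_unitmx hS.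
Let adT z : Gm z -> T (ad h z). Proof. by move=> zG; rewrite Th; exists z. Qed.

Definition om a : 'rV[int]_n := (-1) ^+ sneg a *: eps_vec (sidx a).
Definition zchar z v : K := \prod_i z 0 i ^ v 0 i.

Lemma omE a i : om a 0 i = (-1) ^+ sneg a * (i == sidx a)%:R.
Proof. by rewrite !mxE. Qed.

Lemma dv_zchar z a : dv z a = zchar z (om a).
Proof.
rewrite /zchar (bigD1 (sidx a)) //= big1 => [|i /negPf ia]; last first.
  by rewrite omE ia mulr0 expr0z.
by rewrite omE eqxx mulr1 mulr1 /dv; case: (sneg a).
Qed.

Lemma zcharD z u v : Gm z -> zchar z (u + v) = zchar z u * zchar z v.
Proof.
move=> zG; rewrite /zchar -big_split /=; apply: eq_bigr => i _.
by rewrite mxE expfzDr // zG.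
Qed.

Lemma weight_char_ad z v : Gm z -> weight_char eps v (ad h z) = zchar z v.
Proof. by move=> zG; apply: eq_bigr => i _; rewrite eps_ad. Qed.

(** The exponents are read off at points with one coordinate [2] and all others [1]. *)
Lemma zchar_inj u v : (forall z, Gm z -> zchar z u = zchar z v) -> u = v.
Proof.
move=> E; apply/rowP => i; pose z : 'rV[K]_n := \row_j (if j == i then 2 else 1).
have zG : Gm z by move=> j; rewrite mxE; case: (j == i); rewrite ?pnatr_eq0 ?oner_eq0.
have zE (w : 'rV[int]_n) : zchar z w = ratr (2 ^ w 0 i).
  rewrite /zchar (bigD1 i) //= mxE eqxx big1 => [|j /negPf ji]; last first.
    by rewrite mxE ji exp1rz.
  by rewrite mulr1 fmorphXz rmorph_nat.
have := E z zG; rewrite !zE => /fmorph_inj /ieexprIz; apply; rewrite ?ltr0n //.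
Qed.

Definition cj x := h *m x *m invmx h.

Lemma cjK x : cj (invmx h *m x *m h) = x.
Proof. by rewrite /cj !mulmxA mulmxV // mul1mx mulmxK. Qed.

Lemma cjM x y : cj (x *m y) = cj x *m cj y.
Proof. by rewrite /cj !mulmxA mulmxKV. Qed.

Lemma cjD x y : cj (x + y) = cj x + cj y.
Proof. by rewrite /cj mulmxDr mulmxDl. Qed.

Lemma cjZ c x : cj (c *: x) = c *: cj x.
Proof. by rewrite /cj -scalemxAr -scalemxAl. Qed.

Lemma cj1 : cj 1%:M = 1%:M.
Proof. by rewrite /cj mulmx1 mulmxV. Qed.

Lemma cj_Sp x : Sp (cj x) <-> Sp x.
Proof.
split=> [xS|xS]; last by apply: Sp_mul (Sp_inv hS); exact: Sp_mul.
have -> : x = invmx h *m cj x *m h by rewrite /cj !mulmxA mulVmx // mul1mx mulmxKV.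
by apply: Sp_mul hS; apply: Sp_mul xS; exact: Sp_inv.
Qed.

Lemma sp_lie_cj x : sp_lie x -> sp_lie (cj x).
Proof.
rewrite /sp_lie /= => xl; set y := _ + _.
have : h^T *m y *m h = 0.
  rewrite mulmxDr mulmxDl -[RHS]xl; congr (_ + _).
    rewrite -[in RHS](hS : _ = _) !mulmxA -!trmx_mul; congr (_^T *m _ *m _).
    by rewrite /cj mulmxKV.
  by rewrite -[in RHS](hS : _ = _) /cj !mulmxA mulmxKV.
move=> /(congr1 (fun y => invmx h^T *m y *m invmx h)).
by rewrite mulmx0 mul0mx !mulmxA mulVmx ?unitmx_tr // mul1mx mulmxK.
Qed.

Lemma weight_vector_cj v x : sp_lie x ->
  (forall z a b, Gm z -> x a b != 0 -> om a = v + om b) ->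
  weight_vector T (weight_char eps v) (cj x).
Proof.
move=> xl xw; split; first exact: sp_lie_cj.
move=> t; rewrite Th => -[z zG <-]; rewrite weight_char_ad //.
have adU : ad h z \in unitmx by apply: Sp_unitmx; exact: Sp_ad.
apply: (can_inj (mulmxK adU)); rewrite mulmxKV //.
have -> : ad h z = cj (dz z) by [].
rewrite -scalemxAl -!cjM -cjZ; congr cj; apply/matrixP => a b.
rewrite dz_mulmx mxE mulmx_dz; have [->|xab] := eqVneq (x a b) 0; first by rewrite mulr0 mul0r mulr0.
by rewrite !dv_zchar (xw z a b) // zcharD //; ring.
Qed.

Lemma weight_om v x a b : weight_vector T (weight_char eps v) x ->
  (invmx h *m x *m h) a b != 0 -> om a = v + om b.
Proof.
move=> xw xab; apply: zchar_inj => z zG; rewrite zcharD // -!dv_zchar -weight_char_ad //.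
apply: (mulIf xab); rewrite (weight_entry _ _ _ (adT zG) xw) //.
by rewrite mulrAC.
Qed.

Lemma om_inj a b i : om a 0 i = om b 0 i -> om a 0 i != 0 -> a = b.
Proof.
rewrite !omE; have [ia|_] := eqVneq i (sidx a); last by rewrite mulr0 eqxx.
have [ib|_] := eqVneq i (sidx b); last by rewrite mulr1 mulr0 => /eqP; rewrite signr_eq0.
rewrite !mulr1 => e _.
rewrite (ordP a) (ordP b) -ia -ib; congr (if _ then _ else _).
by move: e; case: (sneg a); case: (sneg b).
Qed.

(** A nonzero term in an entry of the square gives [om a + om c = om b + om b]. Weights of
    coordinates are basis vectors up to sign, so [a = b] and then [v = 0]. *)
Lemma root_vector_sqr v x : v != 0 -> weight_vector T (weight_char eps v) x -> x *m x = 0.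
Proof.
move=> vN0 xw; pose x' := invmx h *m x *m h.
suff x'0 : x' *m x' = 0 by rewrite -(cjK x) -/x' -cjM x'0 /cj mulmx0 mul0mx.
apply/matrixP => a c; rewrite !mxE big1 // => b _; apply/eqP; apply: contraT.
rewrite mulf_eq0 negb_or => /andP[xab xbc].
have E1 := weight_om xw xab; have E2 := weight_om xw xbc.
have E : om a + om c = om b + om b by rewrite {1}E1 {3}E2 addrAC addrC addrA.
have ab : a = b.
  apply: (@om_inj _ _ (sidx b)).
    have /rowP/(_ (sidx b)) := E; rewrite mxE [RHS]mxE !omE eqxx !mulr1.
    by case: (sidx b == sidx a); case: (sidx b == sidx c); case: (sneg a); case: (sneg b); case: (sneg c).
  have /rowP/(_ (sidx b)) := E; rewrite mxE [RHS]mxE !omE eqxx !mulr1.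
  by case: (sidx b == sidx a); case: (sidx b == sidx c); case: (sneg a); case: (sneg b); case: (sneg c).
move/eqP: E1; rewrite ab -subr_eq0 opprD addrCA subrr addr0 oppr_eq0.
by rewrite (negPf vN0).
Qed.

Definition v0 : 'cV[K]_(n + n) := col (lshift n i1) h.

(** The image of [v0] would have weight [epsilon_1 + v], with first coordinate at least [1]; the
    only such weight of a coordinate is [epsilon_1], which forces [v = 0]. *)
Lemma root_vector_kill v x : v != 0 -> 0 <= v 0 i1 ->
  weight_vector T (weight_char eps v) x -> x *m v0 = 0.
Proof.
move=> vN0 vi1 xw; pose x' := invmx h *m x *m h.
have -> : x *m v0 = h *m col (lshift n i1) x'.
  by rewrite /v0 !colE /x' !mulmxA mulmxV // mul1mx.
suff -> : col (lshift n i1) x' = 0 by rewrite mulmx0.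
apply/colP => a; rewrite [LHS]mxE [RHS]mxE; apply/eqP; apply: contraT => xa; exfalso.
have E := weight_om xw xa.
have aE : a = lshift n i1.
  apply: (@om_inj _ _ i1); have /rowP/(_ i1) := E; rewrite [RHS]mxE => E'.
    move: E' vi1; rewrite !omE !shiftE eqxx expr0 mul1r => e.
    have -> : v 0 i1 = (-1) ^+ sneg a * (i1 == sidx a)%:R - 1 by rewrite e addrK.
    by case: (i1 == sidx a); case: (sneg a).
  rewrite E' omE !shiftE eqxx expr0 mul1r; apply: lt0r_neq0.
  by rewrite ltr_wpDl.
move/eqP: E; rewrite aE -subr_eq0 opprD addrCA subrr addr0 oppr_eq0.
by rewrite (negPf vN0).
Qed.

Lemma Sp_root v x : v != 0 -> weight_vector T (weight_char eps v) x -> Sp (1%:M + x).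
Proof.
move=> vN0 xw; have x2 := root_vector_sqr vN0 xw; have [xl _] := xw.
have xl' : x^T *m symp_form K n = - (symp_form K n *m x).
  by apply/eqP; rewrite -addr_eq0; apply/eqP.
rewrite /Sp /= [(1%:M + x)^T]linearD /= trmx1 mulmxDl mul1mx xl' mulmxDr mulmx1.
by rewrite mulmxDl mulNmx -mulmxA x2 mulmx0 oppr0 addr0 subrK.
Qed.

Definition line_stab : set 'M[K]_(n + n) :=
  [set p | Sp p /\ exists2 c, c != 0 & p *m v0 = c *: v0].

Lemma invmx_line p c : p \in unitmx -> c != 0 -> p *m v0 = c *: v0 -> invmx p *m v0 = c^-1 *: v0.
Proof.
move=> pU cN0 e; have := congr1 (mulmx (invmx p)) e.
by rewrite mulKmx // -scalemxAr => E; rewrite [in RHS]E scalerA mulVf // scale1r.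
Qed.

Lemma line_stab_subgroup : subgroup line_stab.
Proof.
split.
- by move=> p [].
- split; first by rewrite -dz1; apply: Sp_dz; exact: one_Gm.
  by exists 1; rewrite ?oner_eq0 // mul1mx scale1r.
- move=> p q [pS [c cN0 pE]] [qS [d dN0 qE]]; split; first exact: Sp_mul.
  by exists (d * c); rewrite ?mulf_neq0 // -mulmxA qE -scalemxAr pE scalerA.
- move=> p [pS [c cN0 pE]]; split; first exact: Sp_inv.
  by exists c^-1; rewrite ?invr_eq0 //; apply: invmx_line => //; exact: Sp_unitmx.
Qed.

Lemma ad_v0 z : ad h z *m v0 = z 0 i1 *: v0.
Proof.
rewrite /v0 {1}colE /ad -mulmxA mulKmx //; apply/colP => k.
by rewrite -colE [LHS]mxE mulmx_dz [RHS]mxE [col _ h k 0]mxE mulrC /dv !shiftE.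
Qed.

Lemma simple_root_ge0 j : 0 <= simple_root j 0 i1.
Proof.
rewrite /simple_root; case: insubP => [k _ kE|_]; last by rewrite !mxE; case: (_ && _).
rewrite !mxE !eqxx /=; have -> : (i1 == k) = false.
  by apply/eqP => e; move: kE; rewrite -e /= i1E.
by rewrite subr0; case: (_ == _).
Qed.

Lemma positive_root_ge0 v : positive_root v -> 0 <= v 0 i1.
Proof.
move=> [_ [c ->]]; rewrite summxE sumr_ge0 // => j _.
by rewrite mulmxnE mulrn_wge0 // simple_root_ge0.
Qed.

Lemma simple_root_i1 j : j != i1 -> simple_root j 0 i1 = 0.
Proof.
move=> ji; rewrite /simple_root; case: insubP => [k _ kE|_]; last first.
  by rewrite !mxE eqxx /= eq_sym (negPf ji) mulr0.
rewrite !mxE !eqxx /= eq_sym (negPf ji); have -> : (i1 == k) = false.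
  by apply/eqP => e; move: kE; rewrite -e /= i1E.
by rewrite subr0.
Qed.

Lemma roots_C_short i j (s s' : bool) : i != j ->
  roots_C ((-1) ^+ s *: eps_vec i + (-1) ^+ s' *: eps_vec j).
Proof.
move=> ij; apply: roots_CP; apply/eqP => /rowP/(_ i); rewrite !mxE !eqxx (negPf ij) mulr0 addr0 mulr1.
by move/eqP; rewrite signr_eq0.
Qed.

Lemma roots_C_long i (s : bool) : roots_C ((-1) ^+ s *: eps_vec i + (-1) ^+ s *: eps_vec i).
Proof.
apply: roots_CP; apply/eqP => /rowP/(_ i); rewrite !mxE !eqxx mulr1 -mulr2n => /eqP.
by rewrite mulrn_eq0 signr_eq0.
Qed.

Lemma simple_root_next i j : j = i.+1 :> nat -> simple_root i = eps_vec i - eps_vec j.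
Proof.
move=> ji; rewrite /simple_root; case: insubP => [k _ kE|]; last by rewrite -ji ltn_ord.
by congr (_ - eps_vec _); apply: val_inj; rewrite kE -ji.
Qed.

Lemma simple_root_last i : i.+1 = n -> simple_root i = eps_vec i + eps_vec i.
Proof.
move=> iN; rewrite /simple_root; case: insubP => [k ki _|_]; first by rewrite iN ltnn in ki.
by rewrite scaler_nat mulr2n.
Qed.

Lemma roots_C_opp_simple j : roots_C (- simple_root j).
Proof.
have [jn|jn] := ltnP j.+1 n.
  rewrite (@simple_root_next j (Ordinal jn)) // opprB addrC.
  have := @roots_C_short j (Ordinal jn) true false; rewrite expr0 expr1 scaleN1r scale1r; apply.
  by apply/eqP => /(congr1 val) /= /eqP; rewrite ltn_eqF.
rewrite simple_root_last; last by apply/eqP; rewrite eqn_leq jn ltn_ord.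
by have := roots_C_long j true; rewrite expr1 scaleN1r opprD.
Qed.

Definition poscone v := exists c : 'I_n -> nat, v = \sum_i simple_root i *+ c i.

Lemma posconeD u v : poscone u -> poscone v -> poscone (u + v).
Proof.
move=> [c ->] [d ->]; exists (fun i => c i + d i)%N.
by rewrite -big_split /=; apply: eq_bigr => i _; rewrite mulrnDr.
Qed.

Lemma poscone_simple i : poscone (simple_root i).
Proof.
exists (fun j => (j == i) : nat); rewrite (bigD1 i) //= eqxx big1 ?addr0 // => j /negPf ->.
by rewrite mulr0n.
Qed.

Lemma poscone_long i : poscone (eps_vec i + eps_vec i).
Proof.
have [m] := ubnP (n - i); elim: m i => // m IH i im.
have [ni|ni] := ltnP i.+1 n; last first.
  rewrite -simple_root_last; first exact: poscone_simple.
  by apply/eqP; rewrite eqn_leq ni ltn_ord.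
pose j := Ordinal ni; have si := @simple_root_next i j erefl.
have -> : eps_vec i + eps_vec i = simple_root i + simple_root i + (eps_vec j + eps_vec j).
  by rewrite si addrACA !subrK.
apply: posconeD; first by apply: posconeD; exact: poscone_simple.
by apply: IH; rewrite /= -ltnS (leq_trans _ im) // ltnS subnS ltn_predL subn_gt0.
Qed.

Local Notation P := (parabolic T eps i1).

(** Induction on generators. Of the roots that occur only the sign of the first coordinate is kept,
    and each generator may be assumed to lie in [P], because the minimality of [P] is applied to its
    intersection with [H]. *)
Lemma parabolic_min H : subgroup H -> T `<=` H ->
  (forall v x, roots_C v -> 0 <= v 0 i1 -> weight_vector T (weight_char eps v) x ->
     P (1%:M + x) -> H (1%:M + x)) -> P `<=` H.
Proof.
move=> Hg HT Hr p Pp.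
pose H' := H `&` P.
have PT : T `<=` P by move=> t Tt G [] _ /(_ _ Tt).
have PS : P `<=` @Sp K n.
  move=> q /(_ line_stab) []//; split; first exact: line_stab_subgroup.
  - move=> t; rewrite Th => -[z zG <-]; split; first exact: Sp_ad.
    by exists (z 0 i1); [exact: zG|rewrite ad_v0].
  - move=> v vp _ [x xw <-]; have [[vN0 _] _] := vp; split; first exact: Sp_root xw.
    exists 1; rewrite ?oner_eq0 // mulmxDl mul1mx (root_vector_kill vN0 _ xw) ?addr0 ?scale1r //.
    exact: positive_root_ge0.
  - move=> j ji _ [x xw <-]; have [vN0 _] := roots_C_opp_simple j; split; first exact: Sp_root xw.
    exists 1; rewrite ?oner_eq0 // mulmxDl mul1mx (root_vector_kill vN0 _ xw) ?addr0 ?scale1r //.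
    by rewrite mxE simple_root_i1 // oppr0.
have [HS H1 HM HV] := Hg.
suff : H' p by case.
apply: Pp; split.
- split.
  + by move=> q [/HS].
  + by split=> // G [[]].
  + by move=> x y [Hx Px] [Hy Py]; split; [exact: HM|move=> G Gf; have [[_ _ GM _] _ _ _] := Gf; apply: GM; [exact: Px|exact: Py]].
  + by move=> x [Hx Px]; split; [exact: HV|move=> G Gf; have [[_ _ _ GV] _ _ _] := Gf; apply: GV; exact: Px].
- by move=> t Tt; split; [exact: HT|exact: PT].
- move=> v vp _ [x xw <-]; have Px : P (1%:M + x).
    by move=> G [_ _ /(_ v vp) GR _]; apply: GR; exists x.
  by split=> //; apply: (Hr v) => //; [case: vp|exact: positive_root_ge0].
- move=> j ji _ [x xw <-]; have Px : P (1%:M + x).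
    by move=> G [_ _ _ /(_ j ji) GR]; apply: GR; exists x.
  split=> //; apply: (Hr (- simple_root j)) => //; first exact: roots_C_opp_simple.
  by rewrite mxE simple_root_i1 // oppr0.
Qed.

Lemma sp_lieP x : (forall a b, (-1) ^+ sneg a * x (star a) b = (-1) ^+ sneg b * x (star b) a) ->
  sp_lie x.
Proof.
move=> E; rewrite /sp_lie /=; apply/matrixP => a b; rewrite !mxE.
have starK c : star (star c) = c by case: (split_ordP c) => l ->; rewrite !shiftE.
rewrite (bigD1 (star b)) //= big1 ?addr0 => [|c cb]; last first.
  rewrite symp_form_star ifF ?mulr0 //; apply/negbTE; apply: contra cb => /eqP ->.
  by rewrite starK.
rewrite (bigD1 (star a)) //= big1 ?addr0 => [|c ca]; last first.
  by rewrite symp_form_star (negPf ca) mul0r.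
rewrite !symp_form_star starK !eqxx mxE E.
have -> : (-1) ^+ sneg (star b) = - (-1) ^+ sneg b :> K.
  by case: (split_ordP b) => l ->; rewrite !shiftE ?opprK.
by rewrite mulrN mulrC addNr.
Qed.

Lemma sp_lieZ c x : sp_lie x -> sp_lie (c *: x).
Proof.
rewrite /sp_lie /= => E; rewrite linearZ /= -scalemxAl -scalemxAr -scalerDr E.
by rewrite scaler0.
Qed.

Lemma weight_vectorZ beta c x : weight_vector T beta x -> weight_vector T beta (c *: x).
Proof.
move=> [xl xw]; split; first exact: sp_lieZ.
by move=> t Tt; rewrite -scalemxAr -scalemxAl xw // !scalerA mulrC.
Qed.

Lemma weight_vector_gen v X c : sp_lie X ->
  (forall a b, X a b != 0 -> om a = v + om b) ->
  weight_vector T (weight_char eps v) (cj (c *: X)).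
Proof.
move=> Xl Xw; rewrite cjZ; apply: weight_vectorZ; apply: weight_vector_cj => // z a b _.
exact: Xw.
Qed.

Definition block_eqE := (eq_lshift, eq_rshift, eq_lrshift, eq_rlshift).
Definition block_zeroE := (@subr0 K, @sub0r K, @addr0 K, @add0r K, @oppr0 K, @mulr0 K).

Lemma sp_lie_X1 i j : sp_lie (X1 K i j).
Proof.
apply: sp_lieP => a b; case: (split_ordP a) => k ->; case: (split_ordP b) => l ->;
  rewrite !shiftE !mxE ?block_eqE /= ?andbF ?andbF ?block_zeroE ?eqxx //.
  by rewrite ?expr0 ?expr1 ?mul1r ?mulN1r ?opprK andbC.
by rewrite ?expr0 ?expr1 ?mul1r ?mulN1r ?opprK andbC.
Qed.

Lemma om_X1 i j a b : X1 K i j a b != 0 -> om a = eps_vec i - eps_vec j + om b.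
Proof.
rewrite /om; case: (split_ordP a) => k ->; case: (split_ordP b) => l ->;
  rewrite !shiftE !mxE ?block_eqE /= ?andbF ?andbF ?block_zeroE ?eqxx //.
  have [/andP[/eqP -> /eqP ->] _|_] := boolP ((k == i) && (l == j)); last by rewrite eqxx.
  by rewrite expr0 !scale1r subrK.
have [/andP[/eqP -> /eqP ->] _|_] := boolP ((k == j) && (l == i)); last by rewrite oppr0 eqxx.
by rewrite expr1 !scaleN1r addrAC subrr add0r.
Qed.

Lemma sp_lie_X2 i j : sp_lie (X2 K i j).
Proof.
apply: sp_lieP => a b; case: (split_ordP a) => k ->; case: (split_ordP b) => l ->;
  rewrite !shiftE !mxE ?block_eqE /= ?andbF ?andbF ?block_zeroE ?eqxx //.
by rewrite addrC ![_ && (k == _)]andbC ![_ && (l == _)]andbC.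
Qed.

Lemma om_X2 i j a b : X2 K i j a b != 0 -> om a = eps_vec i + eps_vec j + om b.
Proof.
rewrite /om; case: (split_ordP a) => k ->; case: (split_ordP b) => l ->;
  rewrite !shiftE !mxE ?block_eqE /= ?andbF ?andbF ?block_zeroE ?eqxx //.
rewrite expr0 expr1 scale1r scaleN1r.
have [/andP[/eqP -> /eqP ->] _|_] := boolP ((k == i) && (l == j)); first by rewrite addrK.
have [/andP[/eqP -> /eqP ->] _|_] := boolP ((k == j) && (l == i)); first by rewrite addrAC subrr add0r.
by rewrite addr0 eqxx.
Qed.

Lemma sp_lie_X4 i : sp_lie (X4 K i).
Proof.
apply: sp_lieP => a b; case: (split_ordP a) => k ->; case: (split_ordP b) => l ->;
  rewrite !shiftE !mxE ?block_eqE /= ?andbF ?andbF ?block_zeroE ?eqxx //.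
by rewrite andbC.
Qed.

Lemma om_X4 i a b : X4 K i a b != 0 -> om a = eps_vec i + eps_vec i + om b.
Proof.
rewrite /om; case: (split_ordP a) => k ->; case: (split_ordP b) => l ->;
  rewrite !shiftE !mxE ?block_eqE /= ?andbF ?andbF ?block_zeroE ?eqxx //.
rewrite expr0 expr1 scale1r scaleN1r.
have [/andP[/eqP -> /eqP ->] _|_] := boolP ((k == i) && (l == i)); first by rewrite addrK.
by rewrite eqxx.
Qed.

Lemma sp_lie_X3 i : sp_lie (X3 K i).
Proof.
apply: sp_lieP => a b; case: (split_ordP a) => k ->; case: (split_ordP b) => l ->;
  rewrite !shiftE !mxE ?block_eqE /= ?andbF ?andbF ?block_zeroE ?eqxx //.
by rewrite andbC.
Qed.

Lemma om_X3 i a b : X3 K i a b != 0 -> om a = - (eps_vec i + eps_vec i) + om b.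
Proof.
rewrite /om; case: (split_ordP a) => k ->; case: (split_ordP b) => l ->;
  rewrite !shiftE !mxE ?block_eqE /= ?andbF ?andbF ?block_zeroE ?eqxx //.
rewrite expr0 expr1 scale1r scaleN1r.
have [/andP[/eqP -> /eqP ->] _|_] := boolP ((k == i) && (l == i)); last by rewrite eqxx.
by rewrite opprD addrNK.
Qed.

(** The generators stabilize the line by [root_vector_kill]. The converse is the elimination of
    [stabilizer_in] in the basis [h]; besides the simple roots and the permitted negatives it uses
    the positive roots [2 epsilon_i] and [epsilon_i + epsilon_(i+1)]. *)
Lemma parabolicE : P = line_stab.
Proof.
apply/seteqP; split=> p.
  apply: parabolic_min => //; first exact: line_stab_subgroup.
    move=> t; rewrite Th => -[z zG <-]; split; first exact: Sp_ad.
    by exists (z 0 i1); [exact: zG|rewrite ad_v0].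
  move=> v x [vN0 _] vi1 xw _; split; first exact: Sp_root xw.
  by exists 1; rewrite ?oner_eq0 // mulmxDl mul1mx (root_vector_kill vN0 _ xw) ?addr0 ?scale1r.
move=> [pS [c cN0 pE]] H [[HS H1 HM HV] HT Hpos Hneg].
have xS : Sp (invmx h *m p *m h) := Sp_mul (Sp_mul (Sp_inv hS) pS) hS.
have pos v X s : positive_root v -> sp_lie X -> (forall a b, X a b != 0 -> om a = v + om b) ->
    H (cj (1%:M + s *: X)).
  move=> vp Xl Xw; apply: (Hpos v vp); exists (cj (s *: X)); last by rewrite cjD cj1.
  exact: weight_vector_gen.
have neg j X s : j != i1 -> sp_lie X -> (forall a b, X a b != 0 -> om a = - simple_root j + om b) ->
    H (cj (1%:M + s *: X)).
  move=> ji Xl Xw; apply: (Hneg j ji); exists (cj (s *: X)); last by rewrite cjD cj1.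
  exact: weight_vector_gen.
have eq_neq i j : j = i.+1 :> nat -> i != j.
  by move=> ji; apply/eqP => /(congr1 val) /= /eqP; rewrite ji ltn_eqF.
rewrite -(cjK p); apply: (@stabilizer_in _ _ (fun x => H (cj x)) _ _ _ _ _ _ _ _ _ _ i1 _ c) => //.
- by move=> x /HS /cj_Sp.
- by rewrite cj1.
- by move=> x y Hx Hy; rewrite cjM; exact: HM.
- move=> x Hx; have xU : x \in unitmx by apply/Sp_unitmx/cj_Sp/HS.
  have E : cj x *m cj (invmx x) = 1%:M by rewrite -cjM mulmxV // cj1.
  by rewrite -[cj (invmx x)](mulKmx (Sp_unitmx (HS _ Hx))) E mulmx1; exact: HV.
- by move=> z zG; apply: HT; exact: adT.
- move=> i j s ji; apply: (pos (eps_vec i - eps_vec j)); [|exact: sp_lie_X1|exact: om_X1].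
  split; last by rewrite -simple_root_next //; exact: poscone_simple.
  by have := roots_C_short false true (eq_neq _ _ ji); rewrite expr0 expr1 scale1r scaleN1r.
- move=> i j s ji i0; apply: (neg i); [|exact: sp_lie_X1|].
    by apply: contraTneq i0 => ->; rewrite i1E.
  by rewrite (simple_root_next ji) opprB; exact: om_X1.
- move=> i s; apply: (pos (eps_vec i + eps_vec i)); [|exact: sp_lie_X4|exact: om_X4].
  by split; [have := roots_C_long i false; rewrite expr0 scale1r|exact: poscone_long].
- move=> i j s ji; apply: (pos (eps_vec i + eps_vec j)); [|exact: sp_lie_X2|exact: om_X2].
  split; first by have := roots_C_short false false (eq_neq _ _ ji); rewrite expr0 !scale1r.
  have -> : eps_vec i + eps_vec j = simple_root i + (eps_vec j + eps_vec j).
    by rewrite (simple_root_next ji) addrA subrK.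
  by apply: posconeD; [exact: poscone_simple|exact: poscone_long].
- move=> i s iN i0; apply: (neg i); [|exact: sp_lie_X3|].
    by apply: contraTneq i0 => ->; rewrite i1E.
  by rewrite simple_root_last //; exact: om_X3.
- have : h *m (invmx h *m p *m h *m bvec K (lshift n i1)) = h *m (c *: bvec K (lshift n i1)).
    by rewrite !mulmxA mulmxV // mul1mx -mulmxA -scalemxAr /bvec -colE.
  by move/(can_inj (mulKmx hU)).
Qed.

(** Orthogonality to the last simple root kills the last coordinate, and orthogonality to the
    others, except the first, makes consecutive coordinates equal. *)
Lemma fundamental_weight_first omega : fundamental_weight i1 omega -> omega = eps_vec i1.
Proof.
move=> oP.
have dotD (u v w : 'rV[int]_n) : dotz u (v + w) = dotz u v + dotz u w by rewrite /dotz linearD /= mulmxDr mxE.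
have dotN (u v : 'rV[int]_n) : dotz u (- v) = - dotz u v by rewrite /dotz linearN /= mulmxN mxE.
have dote u i : dotz u (eps_vec i) = u 0 i.
  by rewrite /dotz trmx_delta -colE mxE.
have last_eq i : i.+1 = n -> omega 0 i = 0.
  move=> iN; have := oP i; rewrite (simple_root_last iN) (_ : i1 == i = false).
    by rewrite mul0r dotD dote => /eqP; rewrite mulf_eq0 /= -mulr2n mulrn_eq0 => /eqP.
  by apply/eqP => e; move: n_ge2; rewrite -iN -e i1E.
have next_eq i j : j = i.+1 :> nat -> i != i1 -> omega 0 i = omega 0 j.
  move=> ji ii1; have := oP i; rewrite (simple_root_next ji) [i1 == i]eq_sym (negPf ii1) mul0r.
  by rewrite dotD dotN !dote => /eqP; rewrite mulf_eq0 /= subr_eq0 => /eqP.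
have zero i : i != i1 -> omega 0 i = 0.
  have [m] := ubnP (n - i); elim: m i => // m IH i im ii1.
  have [ni|ni] := ltnP i.+1 n; last by apply: last_eq; apply/eqP; rewrite eqn_leq ni ltn_ord.
  rewrite (next_eq i (Ordinal ni)) //; apply: IH.
    by rewrite /= -ltnS (leq_trans _ im) // ltnS subnS ltn_predL subn_gt0.
  by rewrite -val_eqE /= i1E.
have n1 : (i1.+1 < n)%N by rewrite i1E.
have := oP i1; rewrite (@simple_root_next i1 (Ordinal n1)) // eqxx mul1r.
have ij : (i1 == Ordinal n1) = false by apply/eqP => /(congr1 val) /= /eqP; rewrite ltn_eqF.
have ji : (Ordinal n1 == i1) = false by rewrite eq_sym.
have wj : omega 0 (Ordinal n1) = 0 by apply: zero; rewrite ji.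
rewrite !(dotD, dotN, dote) wj !mxE !eqxx ij ji /= => o1.
apply/rowP => i; rewrite mxE eqxx /=; have [->|/zero //] := eqVneq i i1.
by apply: (@mulfI _ (2 : int)) => //; rewrite subr0 in o1; rewrite o1.
Qed.

Section Character.
Variables (omega1 : 'rV[int]_n) (chi : 'M[K]_(n + n) -> K).
Hypothesis omega1P : fundamental_weight i1 omega1.
Hypothesis chi_char : is_character P chi.
Hypothesis chiT : forall t, T t -> chi t = weight_char eps (omega1 *+ 2) t.

Lemma v0_neq0 : v0 != 0.
Proof.
apply/eqP => /(congr1 (mulmx (invmx h))); rewrite /v0 colE mulKmx // mulmx0.
by move/colP/(_ (lshift n i1)); rewrite !mxE !eqxx => /eqP; rewrite oner_eq0.
Qed.

Lemma line_scalar_uniq (c d : K) : c *: v0 = d *: v0 -> c = d.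
Proof.
move/eqP; rewrite -subr_eq0 -scalerBl scaler_eq0 (negPf v0_neq0) orbF subr_eq0.
by move/eqP.
Qed.

Lemma chi_torus z : Gm z -> chi (ad h z) = z 0 i1 ^+ 2.
Proof.
move=> zG; rewrite chiT ?weight_char_ad //; last exact: adT.
rewrite (fundamental_weight_first omega1P) mulr2n zcharD //.
suff -> : zchar z (eps_vec i1) = z 0 i1 by rewrite expr2.
rewrite /zchar (bigD1 i1) //= big1 => [|i /negPf ii]; first by rewrite !mxE !eqxx mulr1.
by rewrite mxE eqxx ii expr0z.
Qed.

(* Conjugation by [t] in [T] maps [1 + r x] to [1 + v(t) r x] and does not change
   [chi]; with [v(t) != 1] every [1 + x] is a quotient of two such elements. *)
Lemma chi_unipotent v x : roots_C v -> 0 <= v 0 i1 -> weight_vector T (weight_char eps v) x ->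
  chi (1%:M + x) = 1.
Proof.
move=> vR vi1 xw; have [chi0 chiM _] := chi_char; have [vN0 _] := vR.
have inP s : P (1%:M + s *: x).
  have sw := weight_vectorZ s xw; rewrite parabolicE; split; first exact: Sp_root sw.
  by exists 1; rewrite ?oner_eq0 // mulmxDl mul1mx (root_vector_kill vN0 _ sw) ?addr0 ?scale1r.
have [[t Tt vt] _] := root_vector eps_coord vR.
set b := weight_char eps v t in vt.
have x2 := root_vector_sqr vN0 xw.
have addx r s : (1%:M + r *: x) *m (1%:M + s *: x) = 1%:M + (r + s) *: x.
  rewrite mulmxDl mul1mx mulmxDr mulmx1 -scalemxAl -scalemxAr x2 !scaler0 addr0.
  by rewrite -addrA -scalerDl [s + r]addrC.
have PT : T `<=` P by move=> u Tu G [_ /(_ _ Tu)].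
have [[[TS T1 TM TV] _ _] _] := T_max.
have tU := Sp_unitmx (TS _ Tt).
have conj r : t *m (1%:M + r *: x) *m invmx t = 1%:M + (r * b) *: x.
  rewrite mulmxDr mulmx1 mulmxDl mulmxV // -scalemxAr -scalemxAl; case: xw => _ ->//.
  by rewrite scalerA.
have [_ _ PM _] := line_stab_subgroup; rewrite -parabolicE in PM.
have PtV : P (invmx t) by apply: PT; exact: TV.
have chit : chi t * chi (invmx t) = 1.
  have PT1 : P 1%:M by exact: PT.
  have c1 : chi 1%:M = 1 by apply: (mulfI (chi0 _ PT1)); rewrite -chiM // mul1mx mulr1.
  by rewrite -chiM ?mulmxV //; exact: PT.
have chib r : chi (1%:M + (r * b) *: x) = chi (1%:M + r *: x).
  rewrite -conj chiM; [|by apply: PM; [exact: PT|exact: inP]|exact: PtV].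
  by rewrite chiM; [rewrite mulrAC chit mul1r|exact: PT|exact: inP].
have bN0 : b - 1 != 0 by rewrite subr_eq0.
have := chib (b - 1)^-1; have -> : (b - 1)^-1 * b = (b - 1)^-1 + 1.
  by apply: (mulfI bN0); rewrite mulrA mulfV // mul1r mulrDr mulfV // mulr1 addrC subrK.
rewrite -addx chiM; try exact: inP.
rewrite scale1r -[X in _ = X -> _]mulr1; apply: mulfI; apply: chi0; exact: inP.
Qed.

(** Both sides are multiplicative in [p], so it suffices to compare them on [T], where the weight is
    [2 omega_1], and on root elements, where both are [1]. *)
Lemma chi_parabolic p c : P p -> p *m v0 = c *: v0 -> chi p = c ^+ 2.
Proof.
move=> Pp; have [chi0 chiM _] := chi_char.
have PG := line_stab_subgroup; rewrite -parabolicE in PG; have [PS P1 PM PV] := PG.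
suff [_] : P p /\ forall c, p *m v0 = c *: v0 -> chi p = c ^+ 2 by apply.
move: p {c} Pp; apply: parabolic_min => //.
- split.
  + by move=> p [/PS].
  + split=> // c; rewrite mul1mx -[in LHS](scale1r v0) => /line_scalar_uniq <-.
    by apply: (mulfI (chi0 _ P1)); rewrite -chiM // mul1mx expr1n mulr1.
  + move=> p q [Pp pE] [Pq qE]; split; first exact: PM.
    have := Pp; have := Pq; rewrite parabolicE => -[_ [d dN0 qd]] [_ [e eN0 pe]] c.
    rewrite -mulmxA qd -scalemxAr pe scalerA => /line_scalar_uniq <-.
    by rewrite chiM // (pE e) // (qE d) // exprMn mulrC.
  + move=> p [Pp pE]; split; first exact: PV.
    have := Pp; rewrite parabolicE => -[pS [e eN0 pe]] c; have pU := Sp_unitmx pS.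
    rewrite (invmx_line pU eN0 pe) => /line_scalar_uniq <-.
    have pN0 := chi0 _ Pp; apply: (mulfI pN0); rewrite -chiM //; last exact: PV.
    rewrite mulmxV // (pE e) // -exprMn mulfV // expr1n.
    by apply: (mulfI (chi0 _ P1)); rewrite -chiM // mul1mx mulr1.
- move=> t Tt; split; first by move=> G [_ /(_ _ Tt)].
  move: Tt; rewrite Th => -[z zG <-] c; rewrite ad_v0 => /line_scalar_uniq <-.
  exact: chi_torus.
- move=> v x vR vi1 xw Px; split=> // c; have [vN0 _] := vR.
  rewrite mulmxDl mul1mx (root_vector_kill vN0 vi1 xw) addr0 -[in LHS](scale1r v0).
  by move=> /line_scalar_uniq <-; rewrite (chi_unipotent vR) // expr1n.
Qed.

End Character.

End Parabolic.

(** Continuity along a curve in algebraic form: equality off the zeros of [d] is a polynomial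
    identity between two fractions whose denominators have no zero where [e] has none. *)
Lemma locally_rational_eq (K : numClosedFieldType) (d e : {poly K}) (h1 h2 : K -> K) :
  d != 0 -> e != 0 -> locally_rational [set s | e.[s] != 0] h1 ->
  locally_rational [set s | e.[s] != 0] h2 ->
  (forall s, e.[s] != 0 -> d.[s] != 0 -> h1 s = h2 s) ->
  forall s, e.[s] != 0 -> h1 s = h2 s.
Proof.
move=> dN0 eN0 r1 r2 E s es.
have [p1 [q1 [_ E1]]] := locally_rational_frac eN0 r1.
have [p2 [q2 [_ E2]]] := locally_rational_frac eN0 r2.
have H : p1 * q2 = p2 * q1.
  apply: (@poly_eq_cofinite _ (d * e)); first by rewrite mulf_neq0.
  move=> s'; rewrite hornerM mulf_eq0 negb_or => /andP[ds' es'].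
  have [q1N0 h1E] := E1 _ es'; have [q2N0 h2E] := E2 _ es'.
  have := E _ es' ds'; rewrite h1E h2E => /eqP.
  by rewrite eqr_div // !hornerM => /eqP.
have [q1N0 ->] := E1 _ es; have [q2N0 ->] := E2 _ es.
by apply/eqP; rewrite eqr_div // -!hornerM H.
Qed.

(** * The slice and the functions invariant under the torus *)

Section Transvection.
Variables (K : numClosedFieldType) (n : nat).
Implicit Types (q v : 'cV[K]_(n + n)).
Local Notation J := (symp_form K n).

(** The symplectic transvection along [q]. Being polynomial in [q] and in [c], it yields both the
    slice [sec] and curves in the group. *)
Definition transv q (c : K) : 'M[K]_(n + n) := 1%:M + c *: (q *m (q^T *m J)).

Lemma transvE q c v : transv q c *m v = v + (c * sform q v) *: q.
Proof.
rewrite mulmxDl mul1mx -scalemxAl -scalerA; congr (_ + _ *: _).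
rewrite -mulmxA (mx11_scalar (q^T *m J *m v)) mul_mx_scalar.
by rewrite /sform.
Qed.

Lemma Sp_transv q c : Sp (transv q c).
Proof.
have e : forall x : 'M[K]_(n + n), (forall a b, sform (col a x) (col b x) = symp_form K n a b) -> Sp x.
  by move=> x H; apply/matrixP => a b; rewrite -sform_col.
apply: e => a b; have colT d : col d (transv q c) = bvec K d + (c * sform q (bvec K d)) *: q.
  by rewrite colE transvE.
rewrite !colT sformDl !sformDr !sformZl !sformZr sform_alt (sform_skew q (bvec K a)).
rewrite -[symp_form K n a b]mul1r -[1]mulr1.
have -> : sform (bvec K a) (bvec K b) = symp_form K n a b.
  by rewrite /sform /bvec trmx_delta -rowE -colE !mxE.
by rewrite !mulr1 mul1r; ring.
Qed.

End Transvection.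

Lemma colZE (K : fieldType) m (c : K) (v : 'cV[K]_m) a : (c *: v) a 0 = c * v a 0.
Proof. by rewrite mxE. Qed.

Lemma dz_colE (K : numClosedFieldType) n (z : 'rV[K]_n) (v : 'cV[K]_(n + n)) a :
  (dz z *m v) a 0 = dv z a * v a 0.
Proof. by rewrite mul_diag_mx !mxE. Qed.

Section Coordinates.
Variables (K : numClosedFieldType) (n : nat).
Hypothesis n_ge2 : (2 <= n)%N.
Implicit Types (z : 'rV[K]_n) (t p y : 'M[K]_(n + n)) (w : 'M[K]_(1, n)).
Variable T : set 'M[K]_(n + n).
Variable eps : 'I_n -> 'M[K]_(n + n) -> K.
Hypothesis T_max : maximal_torus T.
Hypothesis eps_coord : bourbaki_coordinates T eps.
Variable h : 'M[K]_(n + n).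
Hypothesis hS : Sp h.
Hypothesis Th : T = [set ad h z | z in @Gm K n].
Hypothesis eps_ad : forall i z, Gm z -> eps i (ad h z) = z 0 i.
Variable i1 : 'I_n.
Hypothesis i1E : i1 = 0%N :> nat.
Variables (omega1 : 'rV[int]_n) (chi : 'M[K]_(n + n) -> K).
Hypothesis omega1P : fundamental_weight i1 omega1.
Local Notation P := (parabolic T eps i1).
Hypothesis chi_char : is_character P chi.
Hypothesis chiT : forall t, T t -> chi t = weight_char eps (omega1 *+ 2) t.
Let hU : h \in unitmx := Sp_unitmx hS.
Local Notation v0 := (v0 h i1).

Definition ucoord y : 'cV[K]_(n + n) := invmx h *m y *m v0.
(* With [y v0 = (x_1, ..., x_2n)] in the basis [h], [zmap y] is the row of the
   [x_i x_(n+i)], and [sec w] maps [v0] to [(w, 1)]. *)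
Definition zmap y : 'M[K]_(1, n) :=
  \row_i (ucoord y (lshift n i) 0 * ucoord y (rshift n i) 0).
Definition onecol w : 'cV[K]_(n + n) := col_mx w^T (const_mx 1).
Definition sec w : 'M[K]_(n + n) :=
  h *m transv (onecol w - bvec K (lshift n i1)) (-1) *m invmx h.

Let chiP p c : P p -> p *m v0 = c *: v0 -> chi p = c ^+ 2.
Proof. exact: (chi_parabolic n_ge2 T_max eps_coord hS Th eps_ad i1E omega1P chi_char chiT). Qed.

Let PE : P = line_stab h i1.
Proof. by apply: parabolicE => //; exact: eps_ad. Qed.

Lemma ucoord_eq x y : y \in unitmx -> ucoord x = ucoord y -> invmx y *m x *m v0 = v0.
Proof.
move=> yU /(congr1 (fun v => invmx y *m (h *m v))).
by rewrite /ucoord -!mulmxA !mulKVmx // mulKmx.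
Qed.

(** The difference of [(w, 1)] and the first basis vector pairs to [-1] with the latter for every
    [w], so one transvection with constant [-1] carries the second to the first. The slice is thus
    polynomial on all of [K^n], origin included. *)
Lemma ucoord_sec w : ucoord (sec w) = onecol w.
Proof.
rewrite /ucoord /sec /v0 colE !mulmxA mulmxKV // mulVmx // mul1mx -/(bvec K (lshift n i1)) transvE.
have sb v : sform v (bvec K (lshift n i1)) = - v (rshift n i1) 0.
  rewrite sform_skew /sform /bvec trmx_delta -rowE mxE (bigD1 (rshift n i1)) //= big1 ?addr0 => [|d db].
    by rewrite mxE symp_form_star !shiftE eqxx mul1r.
  by rewrite mxE symp_form_star !shiftE (negPf db) mul0r.
rewrite sb mxE col_mxEd !mxE eq_rlshift subr0 mulrNN mulr1 scale1r.
by rewrite addrC subrK.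
Qed.

Lemma zmapE y i :
  zmap y 0 i = ucoord y (lshift n i) 0 * ucoord y (rshift n i) 0.
Proof. by rewrite mxE. Qed.

Lemma zmap_sec w : zmap (sec w) = w.
Proof.
by apply/rowP => i; rewrite zmapE ucoord_sec col_mxEu col_mxEd !mxE mulr1.
Qed.

Lemma Sp_sec w : Sp (sec w).
Proof. by apply: Sp_mul (Sp_inv hS); apply: Sp_mul hS _; exact: Sp_transv. Qed.

Lemma polymap_zmap : polymap zmap.
Proof.
have up a : polyfun (fun y => ucoord y a 0).
  have -> : (fun y => ucoord y a 0) = fun y => \sum_k (\sum_l invmx h a l * y l k) * v0 k 0.
    by apply/funext => y; rewrite mxE; apply: eq_bigr => k _; rewrite mxE.
  apply: polyfun_sum => k; apply: polyfunM; last exact: polyfun_const.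
  apply: polyfun_sum => l; apply: polyfunM; [exact: polyfun_const|exact: polyfun_entry].
move=> i j; under eq_fun do rewrite mxE.
by apply: polyfunM.
Qed.

Lemma polymap_sec : polymap sec.
Proof.
have qp a : polyfun (fun w => (onecol w - bvec K (lshift n i1)) a 0).
  under eq_fun do rewrite mxE; apply: polyfunD; last first.
    by under eq_fun do rewrite mxE; exact: polyfun_const.
  case: (split_ordP a) => i ->.
    by under eq_fun do rewrite col_mxEu mxE; exact: polyfun_entry.
  by under eq_fun do rewrite col_mxEd mxE; exact: polyfun_const.
have tp a b : polyfun (fun w => transv (onecol w - bvec K (lshift n i1)) (-1) a b).
  have -> : (fun w => transv (onecol w - bvec K (lshift n i1)) (-1) a b) = fun w =>
      (a == b)%:R + (-1) * ((onecol w - bvec K (lshift n i1)) a 0 *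
        \sum_l (onecol w - bvec K (lshift n i1)) l 0 * symp_form K n l b).
    apply/funext => w; rewrite mxE [1%:M a b]mxE; congr (_ + _).
    rewrite mxE; congr (_ * _); rewrite mxE big_ord1; congr (_ * _).
    by rewrite mxE; apply: eq_bigr => l _; rewrite [_^T _ _]mxE.
  apply: polyfunD; first exact: polyfun_const.
  apply: polyfunM; first exact: polyfun_const.
  apply: polyfunM => //; apply: polyfun_sum => l; apply: polyfunM => //; exact: polyfun_const.
move=> a b; have -> : (fun w => sec w a b) = fun w => \sum_k (\sum_l h a l *
    transv (onecol w - bvec K (lshift n i1)) (-1) l k) * invmx h k b.
  by apply/funext => w; rewrite mxE; apply: eq_bigr => k _; rewrite mxE.
apply: polyfun_sum => k; apply: polyfunM; last exact: polyfun_const.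
by apply: polyfun_sum => l; apply: polyfunM => //; exact: polyfun_const.
Qed.

Lemma parabolic_line p : P p -> exists c, [/\ c != 0, p *m v0 = c *: v0 & chi p = c ^+ 2].
Proof.
move=> Pp; have := Pp; rewrite PE => -[_ [c cN0 pc]]; exists c; split=> //.
exact: chiP.
Qed.

Lemma ucoord_act y p c : p *m v0 = c *: v0 -> ucoord (y *m p) = c *: ucoord y.
Proof. by move=> pc; rewrite /ucoord -!mulmxA pc -!scalemxAr. Qed.

Lemma zmap_act y p : P p -> zmap (y *m p) = chi p *: zmap y.
Proof.
move=> /parabolic_line[c [_ pc ->]]; apply/rowP => i.
rewrite zmapE (ucoord_act _ pc) [RHS]mxE zmapE.
by rewrite !colZE; ring.
Qed.

Lemma ucoord_torus z y : ucoord (ad h z *m y) = dz z *m ucoord y.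
Proof. by rewrite /ucoord /ad !mulmxA mulVmx // mul1mx. Qed.

Lemma zmap_torus t y : T t -> zmap (t *m y) = zmap y.
Proof.
rewrite Th => -[z zG <-]; apply/rowP => i; rewrite !zmapE ucoord_torus.
by rewrite !dz_colE /dv !shiftE mulrACA divff ?mul1r //; exact: zG.
Qed.

Lemma chi_surj c : c != 0 -> exists2 p, P p & chi p = c.
Proof.
move=> cN0; pose z : 'rV[K]_n := const_mx (sqrtC c).
have zG : Gm z by move=> i; rewrite mxE sqrtC_eq0.
have Pz : P (ad h z).
  rewrite PE; split; first exact: Sp_ad.
  by exists (z 0 i1); [exact: zG|rewrite ad_v0].
exists (ad h z) => //; rewrite (@chiP _ (z 0 i1)) ?ad_v0 //.
by rewrite mxE sqrtCK.
Qed.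

Lemma parabolic_subgroup : subgroup P.
Proof. by rewrite PE; exact: line_stab_subgroup. Qed.

Lemma ucoord_neq0 y : Sp y -> ucoord y != 0.
Proof.
move=> yS; apply/eqP => /(congr1 (mulmx (invmx y *m h))).
rewrite /ucoord mulmx0 -!mulmxA mulKVmx // mulKmx ?Sp_unitmx // => /eqP.
by rewrite (negPf (v0_neq0 hS i1)).
Qed.

(** The square of a coordinate of [y v0] that is not zero: the coordinates are scaled by [c] when
    [chi p = c ^+ 2]. *)
Lemma local_section y : Sp y -> exists l : 'M[K]_(n + n) -> K, [/\ polyfun l, l y != 0 &
  forall y' p, P p -> l (y' *m p) = chi p * l y'].
Proof.
move=> yS; have /eqP := ucoord_neq0 yS.
have [a ua _] : exists2 a, ucoord y a 0 != 0 & true.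
  apply: contrapT => H; move/eqP: (ucoord_neq0 yS); apply; apply/colP => a; rewrite [RHS]mxE.
  by apply/eqP/negPn/negP => h'; apply: H; exists a.
exists (fun y' => ucoord y' a 0 ^+ 2); split; last 1 first.
- by move=> y' p /parabolic_line[c [_ pc ->]]; rewrite (ucoord_act _ pc) mxE exprMn.
- apply: polyfunX.
  have -> : (fun y => ucoord y a 0) = fun y => \sum_k (\sum_l invmx h a l * y l k) * v0 k 0.
    by apply/funext => y'; rewrite mxE; apply: eq_bigr => k _; rewrite mxE.
  apply: polyfun_sum => k; apply: polyfunM; last exact: polyfun_const.
  apply: polyfun_sum => l; apply: polyfunM; [exact: polyfun_const|exact: polyfun_entry].
- by rewrite expf_neq0.
Qed.

Section Invariant.
Variables (k : nat) (W : set 'M[K]_(n + n)) (f : 'M[K]_(n + n) -> K).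
Hypothesis W_open : zopen (@Sp K n) W.
Hypothesis W_sat : forall y y', Sp y' -> zmap y = zmap y' -> W y -> W y'.
Hypothesis f_reg : zregular W f.
Hypothesis f_act : forall y p, W y -> P p -> f (y *m p) = chi p ^+ k * f y.
Hypothesis f_torus : forall y t, W y -> T t -> f (t *m y) = f y.

Lemma invariant_generic y : W y -> (forall i, ucoord y (rshift n i) 0 != 0) ->
  f y = f (sec (zmap y)).
Proof.
move=> Wy uN0; have yS : Sp y by case: W_open => WS _; exact: WS.
pose z : 'rV[K]_n := \row_i ucoord y (rshift n i) 0.
have zE i : z 0 i = ucoord y (rshift n i) 0 by rewrite mxE.
have zG : Gm z by move=> i; rewrite zE.
have Tz : T (ad h z) by rewrite Th; exists z.
pose s := sec (zmap y); have sS : Sp s := Sp_sec _.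
have sU := Sp_unitmx sS.
have uE : ucoord (ad h z *m y) = ucoord s.
  rewrite ucoord_torus ucoord_sec; apply/colP => a; rewrite dz_colE.
  case: (split_ordP a) => i ->; rewrite /dv !shiftE zE.
    by rewrite col_mxEu [RHS]mxE zmapE mulrC.
  by rewrite col_mxEd [RHS]mxE mulVf.
(* Two elements with the same image of [v0] differ on the right by an element fixing [v0], on which
   [chi] is [1]. *)
pose p := invmx s *m (ad h z *m y).
have pv : p *m v0 = 1 *: v0.
  by rewrite scale1r; exact: ucoord_eq.
have Pp : P p.
  rewrite PE; split; last by exists 1; rewrite ?oner_eq0.
  by apply: Sp_mul; [exact: Sp_inv|apply: Sp_mul yS; exact: Sp_ad].
rewrite -(f_torus Wy Tz); have -> : ad h z *m y = s *m p by rewrite /p mulKVmx.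
rewrite f_act //; last by apply: W_sat Wy; rewrite ?zmap_sec.
by rewrite (chiP Pp pv) expr1n expr1n mul1r.
Qed.

(** A transvection along such a [q] moves [v] off every coordinate hyperplane. If the all-ones
    vector is orthogonal to [v], adding one basis vector repairs this and leaves only entries [1]
    and [2]. *)
Lemma transverse_vector (v : 'cV[K]_(n + n)) : v != 0 ->
  exists q : 'cV[K]_(n + n), sform q v != 0 /\ forall a, q a 0 != 0.
Proof.
move=> vN0; have [b vb] : exists b, v b 0 != 0.
  apply: contrapT => H; move/eqP: vN0; apply; apply/colP => a; rewrite [RHS]mxE.
  by apply/eqP/negPn/negP => h'; apply: H; exists a.
pose q1 : 'cV[K]_(n + n) := const_mx 1.
have [q0|qN0] := eqVneq (sform q1 v) 0; last first.
  by exists q1; split=> // a; rewrite mxE oner_eq0.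
exists (q1 + bvec K (star b)); split.
  rewrite sformDl q0 add0r /sform /bvec trmx_delta -rowE mxE (bigD1 b) //= big1 ?addr0 => [|d db].
    rewrite mxE symp_form_star; have -> : b == star (star b).
      by case: (split_ordP b) => l ->; rewrite !shiftE.
    by rewrite mulf_neq0 // signr_eq0.
  rewrite mxE symp_form_star ifF ?mul0r //; apply/negbTE; apply: contra db => /eqP ->.
  by case: (split_ordP b) => l ->; rewrite !shiftE.
by move=> a; rewrite !mxE -(natrD _ 1) pnatr_eq0.
Qed.

(** A curve of transvections through [y] has a generic point without vanishing coordinate [x_(n+i)];
    both sides are regular along it and agree generically by [invariant_generic]. *)
Lemma invariant_factor y : W y -> f y = f (sec (zmap y)).
Proof.
move=> Wy; have yS : Sp y by case: W_open => WS _; exact: WS.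
have [q [qv qN0]] := transverse_vector (ucoord_neq0 yS).
set v := ucoord y in qv.
pose Y s := h *m transv q s *m invmx h *m y.
have Y0 : Y 0 = y.
  by rewrite /Y /transv scale0r addr0 mulmx1 mulmxV // mul1mx.
have YS s : Sp (Y s).
  apply: Sp_mul yS; apply: Sp_mul (Sp_inv hS); apply: Sp_mul hS _; exact: Sp_transv.
have uY s : ucoord (Y s) = v + (s * sform q v) *: q.
  by rewrite /ucoord /Y !mulmxA mulVmx // mul1mx -!mulmxA -transvE /v /ucoord !mulmxA.
have Ycurve : polycurve Y.
  move=> a b; pose B := h *m (q *m (q^T *m symp_form K n)) *m invmx h *m y.
  exists ((y a b)%:P + (B a b) *: 'X) => s.
  rewrite hornerD hornerC hornerZ hornerX.
  have -> : Y s = y + s *: B.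
    rewrite /Y /transv mulmxDr mulmx1 !mulmxDl mulmxV // mul1mx; congr (_ + _).
    by rewrite -scalemxAr -!scalemxAl.
  by rewrite !mxE mulrC.
have /zopenP[_ /(_ _ Wy)[e [eP ey eW]]] := W_open.
have [E EE] := polyfun_curve Ycurve eP.
have E0 : E.[0] != 0 by rewrite -EE Y0; exact/eqP.
(* The product of the coordinates [x_(n+i)] along the curve, each of degree one by the choice of
   [q]; [E] is nonzero only where the curve stays in [W]. *)
pose d : {poly K} := \prod_i ((v (rshift n i) 0)%:P + (sform q v * q (rshift n i) 0) *: 'X).
have dN0 : d != 0.
  apply/prodf_neq0 => i _; apply: contraNneq (mulf_neq0 qv (qN0 (rshift n i))) => e0.
  have := congr1 (fun p : {poly K} => p`_1) e0.
  by rewrite coefD coefC coefZ coefX /= add0r mulr1 coef0 => ->.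
have SW s : E.[s] != 0 -> W (Y s) by rewrite -EE => /eqP; exact: eW (YS s).
have H := @locally_rational_eq K d E (f \o Y) (f \o sec \o zmap \o Y) dN0 (horner_neq0 E0).
have := H _ _ _ 0 E0; rewrite /= Y0; apply.
- exact: zregular_curve f_reg.
- apply: (@zregular_curve _ _ _ W (f \o sec \o zmap)) => //.
  have -> : f \o sec \o zmap = f \o (sec \o zmap) by [].
  apply: zregular_comp f_reg.
    by move=> a b; apply: (@polyfun_comp K _ _ _ _ (fun w => sec w a b) zmap); [exact: polymap_zmap|exact: polymap_sec].
  by move=> y' Wy'; apply: W_sat Wy'; rewrite ?zmap_sec //; exact: Sp_sec.
- move=> s Es ds; apply: invariant_generic; first exact: SW.
  move=> i; rewrite uY mxE colZE; move: ds; rewrite horner_prod => /prodf_neq0/(_ i isT).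
  by rewrite hornerD hornerC hornerZ hornerX [_ * s]mulrC mulrA.
Qed.

End Invariant.

End Coordinates.

Lemma zregular_mxZ (K : numClosedFieldType) a b c d (W : set 'M[K]_(a, b))
    (f : 'M[K]_(a, b) -> K) (G : 'M[K]_(a, b) -> 'M[K]_(c, d)) :
  zregular W f -> zregular_mx W G -> zregular_mx W (fun y => f y *: G y).
Proof.
move=> fr Gr i j; have -> : (fun y => (f y *: G y) i j) = fun y => f y * G y i j.
  by apply/funext => y; rewrite mxE.
exact: zregularM.
Qed.

(** * The quotient and its descents *)

(* All that is used of the flag variety: [zmap] is the quotient map and [sec] a slice
   of it, on which invariant functions are determined by [gd_factor]. *)
Record git_data (K : numClosedFieldType) (n : nat) (P T : set 'M[K]_(n + n))
    (chi : 'M[K]_(n + n) -> K) (zmap : 'M[K]_(n + n) -> 'M[K]_(1, n))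
    (sec : 'M[K]_(1, n) -> 'M[K]_(n + n)) : Prop := GitData {
  gd_subgroup : subgroup P;
  gd_torus : T `<=` @Sp K n;
  gd_chi : is_character P chi;
  gd_chi_surj : forall c, c != 0 -> exists2 p, P p & chi p = c;
  gd_local_section : forall y, Sp y -> exists l : 'M[K]_(n + n) -> K,
    [/\ polyfun l, l y != 0 & forall y' p, P p -> l (y' *m p) = chi p * l y'];
  gd_zmap : polymap zmap;
  gd_sec : polymap sec;
  gd_sec_Sp : forall w, Sp (sec w);
  gd_zmap_sec : forall w, zmap (sec w) = w;
  gd_zmap_act : forall y p, P p -> zmap (y *m p) = chi p *: zmap y;
  gd_zmap_torus : forall t y, T t -> zmap (t *m y) = zmap y;
  gd_factor : forall k (W : set 'M[K]_(n + n)) f, zopen (@Sp K n) W ->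
    (forall y y', Sp y' -> zmap y = zmap y' -> W y -> W y') -> zregular W f ->
    (forall y p, W y -> P p -> f (y *m p) = chi p ^+ k * f y) ->
    (forall y t, W y -> T t -> f (t *m y) = f y) ->
    forall y, W y -> f y = f (sec (zmap y)) }.

Definition mkframe (K : fieldType) (X : Defs.space K) (L : bundle X) (x : X) (v : fib L x)
  (vN0 : v != 0) : frame_at L x := exist (fun v : fib L x => is_true (v != 0)) v vN0.

Lemma pullback_fibre_linE (K : fieldType) a b (H : Type) (Y : set 'M[K]_(a, b)) (D : set H)
    (ract : 'M[K]_(a, b) -> H -> 'M[K]_(a, b)) (chi : H -> K) (X : Defs.space K)
    (f : X -> orbit_space Y D ract) x (c : K) (u v : fib (pullback f (assoc_bundle Y D ract chi)) x) y :
  val (c *: u + v) y = c * val u y + val v y.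
Proof. by []. Qed.

Lemma line_map_bij (K : fieldType) (U V : lmodType K) (f : {linear U -> V}) (u : U) :
  (forall u', exists c : K, u' = c *: u) -> f u != 0 ->
  (forall v v' : V, v != 0 -> exists c : K, v' = c *: v) -> bijective f.
Proof.
move=> Uu fu0 Vl; have cP v : exists c : K, v = c *: f u by exact: Vl.
pose g v := projT1 (cid (cP v)) *: u.
have gP v : f (g v) = v by rewrite linearZ /= -(projT2 (cid (cP v))).
exists g => // x; have [c xE] := Uu x; have := gP (f x).
rewrite /g; set d := projT1 _; rewrite xE !linearZ /= => /eqP.
rewrite -subr_eq0 -scalerBl scaler_eq0 (negPf fu0) orbF subr_eq0 => /eqP ->.
by [].
Qed.

Lemma linear_map_ex (K : fieldType) (U V : lmodType K) (f : U -> V) :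
  linear f -> exists g : {linear U -> V}, g =1 f.
Proof.
move=> fl; pose m := GRing.isLinear.Build K U V *:%R f fl.
by exists (HB.pack_for {linear U -> V} f m).
Qed.

(** * The ring of invariants *)

Section GitQuotient.
Variables (K : numClosedFieldType) (n : nat).
Hypothesis n_gt0 : (0 < n)%N.
Variables (P T : set 'M[K]_(n + n)) (chi : 'M[K]_(n + n) -> K).
Variables (zmap : 'M[K]_(n + n) -> 'M[K]_(1, n)) (sec : 'M[K]_(1, n) -> 'M[K]_(n + n)).
Hypothesis D : git_data P T chi zmap sec.
Local Notation X := (flag_variety P).
Local Notation L := (hom_bundle P chi).
Local Notation TG := [set t : @Sp K n | T (val t)].
Local Notation flin := (@flag_lin K n P chi).
Local Notation invs := (@invariant_section K (@Sp K n) X L (@flag_act K n P) flin TG).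
Implicit Types (y p : 'M[K]_(n + n)) (A : X) (w : 'M[K]_(1, n)).

Lemma flag_orbit_action : orbit_action (@Sp K n) P mulmx.
Proof.
have [PS P1 PM PV] := gd_subgroup D; split.
- by exists 1%:M; exact: PS.
- by move=> y p yS /PS; exact: Sp_mul.
- by move=> y yS; exists 1%:M; rewrite ?mulmx1.
- move=> y p yS Pp; exists (invmx p); first exact: PV.
  by rewrite mulmxK // Sp_unitmx //; exact: PS.
- by move=> y p q yS Pp Pq; exists (p *m q); [exact: PM|rewrite mulmxA].
Qed.
Local Notation aX := flag_orbit_action.
Definition fcls y : X := cls flag_orbit_action y.

Lemma flag_sectE (U : set X) (s : forall A, fib L A) :
  sect U s <-> zregular [set y | Sp y /\ U (fcls y)] (fun y => val (s (fcls y)) y).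
Proof. exact: (@orbit_sectE _ _ _ _ _ _ _ chi aX U s). Qed.

Lemma flag_regE (U : set X) (f : X -> K) :
  reg U f <-> zregular [set y | Sp y /\ U (fcls y)] (fun y => f (fcls y)).
Proof. exact: (orbit_regE aX). Qed.

Lemma flag_opnE (U : set X) : opn U = zopen (@Sp K n) [set y | Sp y /\ U (fcls y)].
Proof. exact: (orbit_opnE aX). Qed.

Lemma fclsP y : Sp y -> val (fcls y) y. Proof. exact: clsP. Qed.

Lemma fcls_eq A y : val A y -> fcls y = A. Proof. exact: cls_eq. Qed.

Lemma orbit_Sp A y : val A y -> Sp y. Proof. exact: (orbit_inY aX). Qed.

Lemma fcls_act y p : Sp y -> P p -> fcls (y *m p) = fcls y.
Proof. exact: (cls_act aX). Qed.

Lemma orbit_P A y y' : val A y -> val A y' -> P (invmx y *m y').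
Proof.
move=> Ay Ay'; have [p Pp ->] := orbit_same aX Ay Ay'.
by rewrite mulKmx // Sp_unitmx //; exact: orbit_Sp Ay.
Qed.

Lemma git_chi1 : chi 1%:M = 1.
Proof.
have [c0 cM _] := gd_chi D; have [_ P1 _ _] := gd_subgroup D.
by apply: (mulfI (c0 _ P1)); rewrite -cM // mul1mx mulr1.
Qed.

Lemma git_chi0 p : P p -> chi p != 0. Proof. by case: (gd_chi D) => H _ _; exact: H. Qed.

Lemma git_chiM p q : P p -> P q -> chi (p *m q) = chi p * chi q.
Proof. by case: (gd_chi D) => _ H _; exact: H. Qed.

Lemma unit_vector_at A y : val A y -> exists e : frame_at L A, val (val e) y = 1.
Proof.
move=> Ay; pose G x := chi (invmx y *m x).
have GP : equivariant_on chi A G.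
  move=> x p Ax Pp; rewrite /G mulmxA git_chiM // 1?mulrC //; exact: orbit_P Ax.
have vE : val (mkfib chi A G) y = 1.
  by rewrite mkfibE //; last exact: aX; rewrite /G mulVmx ?git_chi1 // Sp_unitmx //; exact: orbit_Sp Ay.
have vN0 : mkfib chi A G != 0 by rewrite (fibre_neq0 aX _ Ay) vE oner_eq0.
by exists (mkframe vN0 : frame_at L A).
Qed.

Definition orep A : 'M[K]_(n + n) := projT1 (cid (orbit_elt aX A)).

Lemma orepP A : val A (orep A). Proof. exact: projT2 (cid (orbit_elt aX A)). Qed.

(* Homogeneous of degree [-1] in the vector of the frame, like the function attached to
   a section of [L]: the invariants will be the [q \o zeta] with [q] homogeneous. *)
Definition zeta (e : frame L) : 'M[K]_(1, n) :=
  (val (val (projT2 e)) (orep (projT1 e)))^-1 *: zmap (orep (projT1 e)).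

Lemma frame_val_neq0 A (e : frame_at L A) y : val A y -> val (val e) y != 0.
Proof. by move=> Ay; rewrite -(fibre_neq0 aX _ Ay); exact: valP e. Qed.

Lemma zetaE A (e : frame_at L A) y : val A y ->
  zeta (existT _ A e) = (val (val e) y)^-1 *: zmap y.
Proof.
move=> Ay; rewrite /zeta /=; have [p Pp ->] := orbit_same aX Ay (orepP A).
rewrite (fibre_actE (val e) Ay Pp) (gd_zmap_act D) // scalerA invfM mulrAC mulVf ?mul1r //.
exact: git_chi0.
Qed.

Lemma zeta_surj w : exists e, zeta e = w.
Proof.
have [e ee] := unit_vector_at (fclsP (gd_sec_Sp D w)).
exists (existT _ _ e); rewrite (zetaE _ (fclsP (gd_sec_Sp D w))) ee invr1 scale1r.
exact: gd_zmap_sec D _.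
Qed.

Lemma flag_actE (t : @Sp K n) A y : val A y -> val (flag_act t A) (val t *m y).
Proof. by move=> Ay; exists y. Qed.

Lemma flag_linE (t : @Sp K n) A (v : fib L A) y :
  val (flag_lin t v) (val t *m y) = val v y.
Proof. by rewrite /= mulKmx // Sp_unitmx //; exact: (set_mem (valP t)). Qed.

Lemma frame_flag_lin (t : @Sp K n) A (v : frame_at L A) :
  exists w : frame_at L (flag_act t A), val w = flag_lin t (val v).
Proof.
have wN0 : flag_lin t (val v) != 0.
  rewrite (fibre_neq0 aX _ (flag_actE t (orepP A))) flag_linE.
  exact: frame_val_neq0 (orepP A).
by exists (mkframe wN0 : frame_at L _).
Qed.

Lemma frame_scale A (e e' : frame_at L A) y : val A y ->
  val e = (val (val e) y / val (val e') y) *: val e'.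
Proof.
move=> Ay; apply: (fibre_ext aX Ay).
by rewrite fibre_scale divfK //; exact: frame_val_neq0.
Qed.

Section PowerSections.
Variables (k : nat) (F : frame L -> K).
Hypothesis F_power : power_section k F.

(* The section [F] of the [k]-th power as an equivariant function on the group. *)
Definition ufun y : K := F (existT _ (fcls y) (projT1 (cid (unit_vector_at (orepP (fcls y)))))) *
  (val (val (projT1 (cid (unit_vector_at (orepP (fcls y)))))) y) ^+ k.

Lemma ufunE A (e : frame_at L A) y : val A y ->
  F (existT _ A e) * (val (val e) y) ^+ k = ufun y.
Proof.
move=> Ay; rewrite /ufun; move: (cid _) => [e' _] /=; move: e'.
rewrite (fcls_eq Ay) => e'; have [FZ _] := F_power.
rewrite (FZ _ _ _ _ (frame_scale e e' Ay)) expr_div_n invf_div mulrAC.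
by rewrite divfK 1?mulrC // expf_neq0 //; exact: frame_val_neq0.
Qed.

Lemma ufun_act y p : Sp y -> P p -> ufun (y *m p) = chi p ^+ k * ufun y.
Proof.
move=> yS Pp; have [e ey] := unit_vector_at (fclsP yS).
have Ayp : val (fcls y) (y *m p) by rewrite -(fcls_act yS Pp); apply: fclsP; apply: Sp_mul => //; case: (gd_subgroup D) => PS _ _ _; exact: PS.
rewrite -(ufunE e Ayp) -(ufunE e (fclsP yS)) (fibre_actE (val e) (fclsP yS) Pp).
by rewrite exprMn mulrCA.
Qed.

(** A power section is known to be regular only against regular frames, so one is built near [y0]
    from a local section. Outside [U] its vectors are arbitrary. *)
Lemma local_frame y0 : Sp y0 -> exists (l : 'M[K]_(n + n) -> K) (U : set X)
    (e : forall A, frame_at L A),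
  [/\ polyfun l, l y0 != 0, (forall y, Sp y -> U (fcls y) <-> l y != 0), opn U &
   sect U (fun A => val (e A)) /\ forall A y, U A -> val A y -> val (val (e A)) y = l y].
Proof.
move=> y0S; have [l [lP ly0 lact]] := gd_local_section D y0S.
pose U : set X := [set A | l (orep A) != 0].
have UE A y : val A y -> U A <-> l y != 0.
  move=> Ay; rewrite /U /=; have [p Pp ->] := orbit_same aX Ay (orepP A).
  by rewrite lact // mulf_eq0 negb_or git_chi0.
have H A : exists e : frame_at L A, U A -> forall y, val A y -> val (val e) y = l y.
  have [UA|nUA] := pselect (U A); last first.
    by have [e _] := unit_vector_at (orepP A); exists e.
  have lE : equivariant_on chi A l by move=> y p _ Pp; exact: lact.
  have vN0 : mkfib chi A l != 0 by rewrite (fibre_neq0 aX _ (orepP A)) (mkfibE aX) //; exact: orepP.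
  by exists (mkframe vN0 : frame_at L A) => _ y Ay; rewrite /= (mkfibE aX).
pose e A := projT1 (cid (H A)); have eP A := projT2 (cid (H A)).
exists l, U, e; split=> //.
- by move=> y yS; apply: UE; exact: fclsP.
- rewrite flag_opnE; have -> : [set y | Sp y /\ U (fcls y)] = [set y | Sp y /\ l y != 0].
    by apply/seteqP; split=> y [yS /(UE _ _ (fclsP yS)) ?].
  exact: zopen_poly.
- split=> [|A y UA Ay]; last exact: eP.
  apply/flag_sectE; apply: (zregular_eq (f := l)); last exact: zregular_polyfun.
  by move=> y [yS Uy]; rewrite eP //; exact: fclsP.
Qed.

Lemma ufun_reg : zregular (@Sp K n) ufun.
Proof.
apply: (@zregular_local _ _ _ (@Sp K n)) => // y0 y0S.
have [l [U [e [lP ly0 UE Uo [eS eE]]]]] := local_frame y0S.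
exists [set y | Sp y /\ l y != 0], (fun y => F (existT _ (fcls y) (e (fcls y))) * l y ^+ k).
have [_ /(_ U e Uo eS)/flag_regE H] := F_power.
split=> //; first exact: zopen_poly.
  apply: zregularM; last by apply: zregularX; exact: zregular_polyfun.
  by apply: zregular_sub H => y [_ [yS ly]]; split=> //; apply/UE.
move=> y yS [_ ly]; rewrite -(ufunE (e (fcls y)) (fclsP yS)) eE //; last exact: fclsP.
exact/UE.
Qed.

End PowerSections.

Lemma zregular_line_poly (f : 'M[K]_(1, n) -> K) (W : set 'M[K]_(1, n)) (a b : 'M[K]_(1, n)) :
  zregular W f -> (forall s, W (a + s *: b)) -> exists p : {poly K}, forall s, f (a + s *: b) = p.[s].
Proof.
move=> fr Wab; apply: (@locally_rational_poly _ (f \o (fun s => a + s *: b))).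
apply: zregular_curve fr => // i j.
by exists ((a i j)%:P + b i j *: 'X) => s; rewrite !mxE hornerD hornerC hornerZ hornerX mulrC.
Qed.

Lemma homog_mxeval k (phi : 'M[K]_(1, n) -> K) :
  zregular [set w | w != 0] phi -> (forall c w, c != 0 -> w != 0 -> phi (c *: w) = c ^+ k * phi w) ->
  exists2 q : {mpoly K[1 * n]}, q \is k.-homog & forall w, w != 0 -> phi w = mxeval q w.
Proof.
move=> phir phiZ; have n1 : (0 < 1 * n)%N by rewrite mul1n.
pose phi' (v : 'rV[K]_(1 * n)) := phi (vec_mx v).
have vec0 (v : 'rV[K]_(1 * n)) : (vec_mx v != 0 :> 'M[K]_(1, n)) = (v != 0).
  by congr (~~ _); apply/eqP/eqP => [/(congr1 mxvec)|->]; rewrite ?vec_mxK !linear0.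
have [c v cN0 vN0|a b ab|q [qh qE]] := @homog_line_mpoly _ _ n1 k phi'.
- by rewrite /phi' linearZ /= phiZ // vec0.
- have [|p pE] := @zregular_line_poly phi [set w | w != 0] (vec_mx a) (vec_mx b) phir.
    by move=> s /=; rewrite -linearZ -linearD /= vec0; exact: ab.
  by exists p => s; rewrite /phi' linearD linearZ /= pE.
exists q => // w wN0; rewrite -[w]mxvecK -/(phi' _) qE //.
  by rewrite mxvecK.
by rewrite -vec0 mxvecK.
Qed.

(** An invariant is determined by its function [psi] on the slice. As [chi] takes all nonzero
    values, the right action of [P] realizes every scaling of [w], and equivariance becomes
    homogeneity of degree [k]. *)
Lemma invariant_sectionE k : invs k =
  [set F | exists2 q, q \is k.-homog & F = fun e => mxeval q (zeta e)].
Proof.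
apply/seteqP; split=> F.
  move=> [Fp Finv]; set f := ufun k F.
  have fr : zregular (@Sp K n) f := ufun_reg Fp.
  have fac y : Sp y -> f y = f (sec (zmap y)).
    apply: (@gd_factor _ _ _ _ _ _ _ D k (@Sp K n)) => //; first exact: zopenT.
      by move=> y' p y'S Pp; exact: (ufun_act Fp).
    move=> {}y t yS Tt; have tS := gd_torus D Tt.
    pose tt : @Sp K n := exist _ t (mem_set tS).
    have [e ey] := unit_vector_at (fclsP yS).
    have [e' e'E] := frame_flag_lin tt e.
    have := Finv tt Tt _ _ _ e'E => E.
    rewrite /f -(ufunE Fp e (fclsP yS)) -(ufunE Fp e' (flag_actE tt (fclsP yS))) E.
    by congr (_ * _ ^+ _); rewrite e'E flag_linE.
  pose psi w := f (sec w).
  have psir : zregular setT psi.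
    by apply: (zregular_comp (gd_sec D) _ fr) => w _; exact: gd_sec_Sp D _.
  have psiZ c w : c != 0 -> psi (c *: w) = c ^+ k * psi w.
    move=> cN0; have [p Pp <-] := gd_chi_surj D cN0.
    have sS := gd_sec_Sp D w; have spS : Sp (sec w *m p).
      by apply: Sp_mul => //; case: (gd_subgroup D) => PS _ _ _; exact: PS.
    by rewrite /psi -(ufun_act Fp sS Pp) -/f (fac _ spS) (gd_zmap_act D) // (gd_zmap_sec D).
  have [||q qh qE] := @homog_mxeval k psi.
  - by apply: zregular_sub psir.
  - by move=> c w cN0 _; exact: psiZ.
  (* Frames over points that are not semistable have [zeta] equal to [0], so the identity is needed
     at the origin as well, where it is extended along a line. *)
  have qE' w : psi w = mxeval q w.
    have [->|/qE //] := eqVneq w 0.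
    pose e : 'M[K]_(1, n) := delta_mx 0 (Ordinal n_gt0).
    have eN0 : e != 0 by exact: delta_neq0.
    have [p pE] := zregular_line_poly (a := 0) (b := e) psir (fun=> I).
    have := pE 0; rewrite scale0r addr0 => ->.
    rewrite -(scale0r e) mxeval_ray; congr (_.[_]).
    apply: (@poly_eq_cofinite _ 'X); first by rewrite polyX_eq0.
    move=> s; rewrite hornerX => sN0; rewrite -mxeval_ray -qE ?scaler_eq0 ?negb_or ?sN0 //.
    by rewrite -pE add0r.
  exists q => //; apply/funext => -[A e]; have Ar := orepP A.
  rewrite (zetaE e Ar) (mxeval_homogZ _ _ qh) -qE' -/(psi _) /psi -fac; last exact: orbit_Sp Ar.
  rewrite /f -(ufunE Fp e Ar) exprVn mulrC mulfK // expf_neq0 //; exact: frame_val_neq0.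
move=> [q qh ->]; split; first split.
- move=> A v w c vw; have Ar := orepP A.
  rewrite !(zetaE _ Ar) vw fibre_scale invfM -scalerA (mxeval_homogZ _ _ qh).
  by rewrite exprVn.
- move=> U e Uo /flag_sectE eS; apply/flag_regE.
  apply: (zregular_eq (f := fun y => mxeval q ((val (val (e (fcls y))) y)^-1 *: zmap y))).
    by move=> y [yS _]; rewrite (zetaE _ (fclsP yS)).
  apply: zregular_mxeval; apply: zregular_mxZ.
    by apply: zregularV => // y [yS _]; exact: frame_val_neq0 (fclsP yS).
  by move=> i j; apply: zregular_polyfun; exact: (gd_zmap D).
- move=> t Tt A v w vw; have Ar := orepP A.
  rewrite (zetaE w (flag_actE t Ar)) (zetaE v Ar) vw flag_linE (gd_zmap_torus D) //.
Qed.

(** * The semistable locus and the quotient map *)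

Local Notation SS := (@semistable K (@Sp K n) X L (@flag_act K n P) flin TG).
Local Notation Z := (@git_quotient K (@Sp K n) X L (@flag_act K n P) flin TG).
Local Notation incl := (@ss_incl K (@Sp K n) X L (@flag_act K n P) flin TG).
Local Notation gitmap := (@git_map K (@Sp K n) X L (@flag_act K n P) flin TG).

Lemma zeta_surj_nz w : w != 0 -> exists e, zeta e = w.
Proof. by move=> _; exact: zeta_surj. Qed.
Local Notation grE := (invariant_sectionE).

Definition qpt w : Z := ppt n_gt0 grE zeta_surj_nz w.

Definition qcone (U : set Z) : set 'M[K]_(1, n) := [set w | w != 0 /\ U (qpt w)].

Lemma qpt_surj (z : Z) : exists2 w, w != 0 & qpt w = z.
Proof. exact: (ppt_surj n_gt0 grE zeta_surj_nz). Qed.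

Lemma qpt_scale w c : c != 0 -> qpt (c *: w) = qpt w.
Proof. exact: ppt_scale. Qed.

Lemma qpt_eq w w' : w != 0 -> w' != 0 -> qpt w = qpt w' -> exists2 c, c != 0 & w' = c *: w.
Proof. exact: ppt_eq. Qed.

Lemma q_opnE (U : set Z) : opn U <-> zopen [set w | w != 0] (qcone U).
Proof. exact: (proj_opnE n_gt0 grE zeta_surj_nz). Qed.

Lemma q_regE (U : set Z) (f : Z -> K) : opn U -> (reg U f <-> zregular (qcone U) (f \o qpt)).
Proof. exact: (proj_regE n_gt0 grE zeta_surj_nz). Qed.

(** Forms of positive degree vanish where all [w_i] do, and the [w_i] are themselves invariants of
    degree one. *)
Lemma semistableE A y : val A y -> SS A <-> zmap y != 0.
Proof.
move=> Ay; split=> [[k [F [v [k0 FI Fv]]]]|/row_neq0P[i zi]].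
  apply/eqP => z0; apply: Fv; move: FI; rewrite grE => -[q qh ->].
  rewrite (zetaE v Ay) z0 scaler0 -(scale0r 0) (mxeval_homogZ _ _ qh) expr0n.
  by rewrite eqn0Ngt k0 mul0r.
have [e ee] := unit_vector_at Ay; exists 1%N, (fun e => mxeval (lin K i) (zeta e)), e.
split=> //; first by rewrite grE; exists (lin K i) => //; exact: lin_homog.
by rewrite (zetaE e Ay) ee invr1 scale1r mxeval_lin; apply/eqP.
Qed.

Definition base_vec : 'M[K]_(1, n) := delta_mx 0 (Ordinal n_gt0).

Lemma base_vec_neq0 : base_vec != 0. Proof. exact: delta_neq0. Qed.

Lemma base_semistable : SS (fcls (sec base_vec)).
Proof.
apply/(semistableE (fclsP (gd_sec_Sp D base_vec))).
by rewrite (gd_zmap_sec D) base_vec_neq0.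
Qed.

(* The class of [y], or that of a fixed semistable point if [y] is not semistable. *)
Definition scls y : Defs.subspace SS :=
  match pselect (SS (fcls y)) with
  | left h => exist (fun A => A \in SS) (fcls y) (mem_set h)
  | right _ => exist (fun A => A \in SS) (fcls (sec base_vec)) (mem_set base_semistable)
  end.

Definition ssY : set 'M[K]_(n + n) := [set y | Sp y /\ zmap y != 0].

Lemma incl_scls y : ssY y -> incl (scls y) = fcls y.
Proof.
move=> [yS zy]; rewrite /scls; case: pselect => // h; case: h.
by apply/(semistableE (fclsP yS)).
Qed.

Lemma incl_inj (x x' : Defs.subspace SS) : incl x = incl x' -> x = x'.
Proof. by move=> e; apply: val_inj. Qed.

Lemma scls_in y : ssY y -> val (incl (scls y)) y.
Proof. by move=> sy; rewrite incl_scls //; apply: fclsP; case: sy. Qed.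

Lemma ssY_in (x : Defs.subspace SS) y : val (incl x) y -> ssY y.
Proof.
move=> xy; split; first exact: (orbit_Sp) xy.
by apply/(semistableE xy); exact: (set_mem (valP x)).
Qed.

Lemma scls_eq (x : Defs.subspace SS) y : val (incl x) y -> scls y = x.
Proof.
by move=> xy; apply: incl_inj; rewrite incl_scls; [exact: (fcls_eq xy)|exact: ssY_in xy].
Qed.

Lemma ss_rep (x : Defs.subspace SS) : exists2 y, ssY y & scls y = x.
Proof.
have xr := orepP (incl x); exists (orep (incl x)); first exact: ssY_in xr.
exact: scls_eq.
Qed.

Lemma ssY_act y p : ssY y -> P p -> ssY (y *m p) /\ scls (y *m p) = scls y.
Proof.
move=> sy Pp; have [yS zy] := sy.
have syp : ssY (y *m p).
  split; first by apply: Sp_mul => //; case: (gd_subgroup D) => PS _ _ _; exact: PS.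
  by rewrite (gd_zmap_act D) // scaler_eq0 negb_or zy (git_chi0).
by split=> //; apply: incl_inj; rewrite !incl_scls // (fcls_act).
Qed.

Lemma ssY_torus y t : ssY y -> T t -> ssY (t *m y).
Proof.
move=> [yS zy] Tt; split; last by rewrite (gd_zmap_torus D).
by apply: Sp_mul yS; exact: gd_torus D _ Tt.
Qed.

Lemma ssY_sec w : w != 0 -> ssY (sec w).
Proof. by move=> wN0; split; [exact: gd_sec_Sp D _|rewrite (gd_zmap_sec D)]. Qed.

Lemma zopen_nonzero (Y : set 'M[K]_(n + n)) : zopen Y [set y | Y y /\ zmap y != 0].
Proof.
apply: zopen_local => y [Yy /row_neq0P[i zi]].
exists [set y | Y y /\ zmap y 0 i != 0]; split=> //; first by apply: zopen_poly; exact: gd_zmap D 0 i.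
by move=> y' [Yy' zi']; split=> //; apply/row_neq0P; exists i.
Qed.

Lemma sub_opnE (U : set (Defs.subspace SS)) :
  opn U <-> zopen (@Sp K n) [set y | ssY y /\ U (scls y)].
Proof.
rewrite -[opn U]/(@opn K X ((val : set_type SS -> X) @` U)) (flag_opnE).
have -> // : [set y | Sp y /\ ((val : set_type SS -> X) @` U) (fcls y)] =
    [set y | ssY y /\ U (scls y)].
apply/seteqP; split=> y [].
  move=> yS [x Ux xE]; have xy : val (incl x) y by rewrite /ss_incl xE; exact: fclsP.
  by split; [exact: ssY_in xy|rewrite (scls_eq xy)].
by move=> sy Uy; split; [case: sy|exists (scls y) => //; exact: incl_scls].
Qed.

Lemma sub_regE (U : set (Defs.subspace SS)) (f : Defs.subspace SS -> K) :
  reg U f <-> zregular [set y | ssY y /\ U (scls y)] (fun y => f (scls y)).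
Proof.
have e : [set y | Sp y /\ ((val : set_type SS -> X) @` U) (fcls y)] =
    [set y | ssY y /\ U (scls y)].
  apply/seteqP; split=> y [].
    move=> yS [x Ux xE]; have xy : val (incl x) y by rewrite /ss_incl xE; exact: fclsP.
    by split; [exact: ssY_in xy|rewrite (scls_eq xy)].
  by move=> sy Uy; split; [case: sy|exists (scls y) => //; exact: incl_scls].
split=> [[g /(flag_regE)]|fr].
  rewrite e => gr gE; apply: zregular_eq gr => y [sy Uy].
  by rewrite gE // -[val (scls y)]/(incl (scls y)) incl_scls.
exists (fun A => f (scls (orep A))); last first.
  by move=> x Ux; congr f; rewrite (@scls_eq x) //; exact: orepP.
apply/(flag_regE); rewrite e; apply: zregular_eq fr => y [sy Uy].
congr f; apply: incl_inj; rewrite !incl_scls //.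
  by rewrite (fcls_eq (orepP _)).
have H : val (incl (scls y)) (orep (fcls y)) by rewrite incl_scls //; exact: orepP.
exact: ssY_in H.
Qed.

Lemma sect_val (s : forall A, fib L A) A y : val A y -> val (s (fcls y)) y = val (s A) y.
Proof. by move=> Ay; rewrite (fcls_eq Ay). Qed.

(** Replaces [scls y] by [x] in a value of a section: [g] hides the dependence of the fibre on the
    point, which blocks a direct rewriting. *)
Lemma ss_val (V : bundle (Defs.subspace SS)) (g : forall x, fib V x -> 'M[K]_(n + n) -> K)
    (s : forall x, fib V x) x y : val (incl x) y -> g _ (s (scls y)) y = g _ (s x) y.
Proof. by move=> xy; rewrite (scls_eq xy). Qed.

Lemma ss_sectE (U : set (Defs.subspace SS)) (s : forall x, fib (pullback incl L) x) :
  opn U -> (sect U s <->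
    zregular [set y | ssY y /\ U (scls y)] (fun y => val (s (scls y)) y)).
Proof.
move=> Uo; split=> [sP|sr x Ux].
  apply: (@zregular_local _ _ _ (@Sp K n)); last by move=> y [[]].
  move=> y [sy Uy]; have [V [W [g [t [Vo WV [Wo Wx WU] [gr tS] sE]]]]] := sP _ Uy.
  exists [set y | ssY y /\ W (scls y)], (fun y => g (scls y) * val (t (fcls y)) y); split=> //.
  - exact/sub_opnE.
  - apply: zregularM; first by move/sub_regE: gr; apply: zregular_sub => y' [].
    move/(flag_sectE): tS; apply: zregular_sub => y' [_ [sy' Wy']].
    by split; [case: sy'|rewrite -incl_scls //; exact: WV].
  - move=> y' [sy' Uy'] [_ Wy']; rewrite sE // fibre_scale; congr (_ * _).
    by rewrite (sect_val t (scls_in sy')).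
have [y0 sy0 xE] := ss_rep x.
pose V : set X := [set A | exists2 x, U x & incl x = A].
pose G y : K := val (s (scls y)) y.
exists V, U, (fun=> 1), (fun A => mkfib chi A G).
have VE y : V (fcls y) -> Sp y -> ssY y /\ U (scls y).
  move=> [x' Ux' x'E] yS; have x'y : val (incl x') y by rewrite x'E; exact: fclsP.
  by split; [exact: ssY_in x'y|rewrite (scls_eq x'y)].
have Gact A : V A -> equivariant_on chi A G.
  move=> [x' Ux' <-] y p x'y Pp; rewrite /G.
  have [syp e] := ssY_act (ssY_in x'y) Pp.
  have x'yp : val (incl x') (y *m p) by exact: orbit_act aX _ _ _ x'y Pp.
  rewrite (@ss_val (pullback incl L) (fun _ v => val v) s _ _ x'yp).
  rewrite (@ss_val (pullback incl L) (fun _ v => val v) s _ _ x'y).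
  exact: (fibre_actE (s x') x'y Pp).
have e : [set y | Sp y /\ V (fcls y)] = [set y | ssY y /\ U (scls y)].
  apply/seteqP; split=> y [].
    by move=> yS Vy; exact: VE.
  by move=> sy Uy; split; [case: sy|exists (scls y) => //; exact: incl_scls].
split.
- by rewrite (flag_opnE) e; exact/sub_opnE.
- by move=> x' Ux'; exists x'.
- by split.
- split; first by apply/sub_regE/zregular_polyfun/polyfun_const.
  apply/(flag_sectE); rewrite e; apply: zregular_eq sr => y [sy Uy].
  rewrite (mkfibE aX) //; last by apply: fclsP; case: sy.
  by apply: Gact; exists (scls y) => //; exact: incl_scls.
- move=> x' Ux'; rewrite scale1r; have [y sy x'E] := ss_rep x'.
  have x'y : val (incl x') y by rewrite -x'E; exact: scls_in.
  apply: (fibre_ext aX x'y); rewrite (mkfibE aX) //; last by apply: Gact; exists x'.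
  by rewrite /G (@ss_val (pullback incl L) (fun _ v => val v) s _ _ x'y).
Qed.

(** On the frames at a semistable point [zeta] takes as values all nonzero multiples of [zmap y], so
    vanishing on these frames is vanishing along the line of [zmap y]. *)
Lemma git_mapE (pi : Defs.subspace SS -> Z) :
  gitmap pi <-> forall x y, val (incl x) y -> pi x = qpt (zmap y).
Proof.
have H x y : val (incl x) y ->
    [set f | graded_sum invs f /\ forall v : frame_at L (incl x), f (existT _ (incl x) v) = 0] =
    val (qpt (zmap y)).
  move=> xy; have [_ zy] := ssY_in xy.
  rewrite val_ppt //; apply/seteqP; split=> f.
    move=> []; rewrite (graded_sumE grE) => -[q _ <-] q0; exists q => //.
    apply: (@poly_eq0_cofinite _ 'X); first by rewrite polyX_eq0.
    move=> c; rewrite hornerX -mxeval_ray => cN0.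
    have [e ee] := unit_vector_at xy.
    have vN0 : c^-1 *: val e != 0 by rewrite scaler_eq0 negb_or invr_eq0 cN0; exact: valP e.
    have := q0 (mkframe vN0); rewrite /pb (zetaE _ xy) fibre_scale ee mulr1 invrK.
    by [].
  move=> [q -> q0]; split; first by rewrite (graded_sumE grE); exists q.
  by move=> v; rewrite /pb (zetaE v xy) mxeval_ray q0 horner0.
split=> [pP x y xy|pE x].
  by apply: val_inj; rewrite -(H _ _ xy); exact: pP.
by have [y sy xE] := ss_rep x; have xy : val (incl x) y by [rewrite -xE; exact: scls_in]; rewrite (pE _ _ xy) -(H _ _ xy).
Qed.

(** * A descent obtained from [O(1)] *)

Local Notation aS := (scale_orbit_action K n_gt0).
Local Notation pcls := (@pcls K n n_gt0).
Local Notation O := (O1 K n).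

Definition piso : Z -> proj_space K n :=
  proj_iso n_gt0 (invariant_sectionE) (zeta_surj_nz).

Lemma piso_qpt w : w != 0 -> piso (qpt w) = pcls w.
Proof. exact: proj_isoE. Qed.

Lemma piso_isomorphism : isomorphism piso.
Proof. exact: proj_iso_isomorphism. Qed.

Lemma piso_in w : w != 0 -> val (piso (qpt w)) w.
Proof. by move=> wN0; rewrite piso_qpt //; exact: pclsP. Qed.

Lemma piso_rep (z : Z) w : val (piso z) w -> w != 0 /\ qpt w = z.
Proof.
move=> zw; have wN0 : w != 0 := orbit_inY aS zw; split=> //.
have [w' w'N0 zE] := qpt_surj z; rewrite -zE in zw *.
by have [c cN0 ->] := orbit_same aS (piso_in w'N0) zw; rewrite qpt_scale.
Qed.

Lemma val_section (B : bundle Z) (g : forall z, fib B z -> 'M[K]_(1, n) -> K)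
    (s : forall z, fib B z) z w : val (piso z) w -> g _ (s (qpt w)) w = g _ (s z) w.
Proof. by move=> /piso_rep[_ ->]. Qed.

Lemma O1_sectE (U : set (proj_space K n)) (t : forall A : proj_space K n, fib O A) :
  sect U t <-> zregular [set w | w != 0 /\ U (pcls w)] (fun w => val (t (pcls w)) w).
Proof. exact: (@orbit_sectE _ _ _ _ _ _ _ id aS U t). Qed.

(** Since it is the pullback of [O(1)] along [piso], a bundle isomorphism from [M] to [M0] is
    already a polarized isomorphism of [M] with [O(1)]. *)
Definition M0 : bundle Z := pullback piso O.

Lemma M0_sectE (U : set Z) (s : forall z, fib M0 z) : opn U ->
  (sect U s <-> zregular (qcone U) (fun w => val (s (qpt w)) w)).
Proof.
move=> Uo; split=> [sP|sr z Uz].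
  apply: (@zregular_local _ _ _ [set w | w != 0]); last by move=> w [].
  move=> w [wN0 Uw]; have [V [W [g [t [Vo WV [Wo Wz WU] [gr tS] sE]]]]] := sP _ Uw.
  exists (qcone W), (fun w => g (qpt w) * val (t (pcls w)) w); split.
  - exact/q_opnE.
  - by split.
  - apply: zregularM; first by move/(q_regE _ Wo): gr; apply: zregular_sub => w' [].
    move/O1_sectE: tS; apply: zregular_sub => w' [_ [w'N0 Ww']]; split=> //.
    by rewrite -piso_qpt //; exact: WV.
  - move=> w' [w'N0 Uw'] [_ Ww']; rewrite sE // fibre_scale; congr (_ * _).
    by rewrite piso_qpt.
have [g0 [_ gK Kg]] := piso_isomorphism.2.
pose V : set (proj_space K n) := [set A | exists2 z, U z & piso z = A].
pose G w : K := val (s (qpt w)) w.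
exists V, U, (fun=> 1), (fun A : proj_space K n => mkfib id A G).
have e : [set w | w != 0 /\ V (pcls w)] = qcone U.
  apply/seteqP; split=> w [wN0].
    move=> [z' Uz' z'E]; split=> //; have z'w : val (piso z') w by rewrite z'E; exact: pclsP.
    by have [_ ->] := piso_rep z'w.
  by move=> Uw; split=> //; exists (qpt w) => //; exact: piso_qpt.
have Gact (A : proj_space K n) : V A -> equivariant_on id A G.
  move=> [z' Uz' <-] w c zw cN0; have zcw := orbit_act aS zw cN0.
  rewrite /G (@val_section M0 (fun _ v => val v) s _ _ zw) (@val_section M0 (fun _ v => val v) s _ _ zcw).
  exact: (fibre_actE (s z') zw cN0).
split.
- by rewrite (orbit_opnE aS) -/pcls e; exact/q_opnE.
- by move=> z' Uz'; exists z'.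
- by split.
- split; first by apply/(q_regE _ Uo)/zregular_polyfun/polyfun_const.
  apply/O1_sectE; rewrite e; apply: zregular_eq sr => w [wN0 Uw].
  rewrite (mkfibE aS) //; last exact: pclsP.
  by apply: Gact; exists (qpt w) => //; exact: piso_qpt.
- move=> z' Uz'; rewrite scale1r; have [w wN0 z'E] := qpt_surj z'.
  have z'w : val (piso z') w by rewrite -z'E; exact: piso_in.
  apply: (fibre_ext aS z'w); rewrite (mkfibE aS) //; last by apply: Gact; exists z'.
  by rewrite /G (@val_section M0 (fun _ v => val v) s _ _ z'w).
Qed.

Lemma M0_local w0 (i : 'I_n) : w0 0 i != 0 -> exists (U : set Z) (e : forall z, frame_at M0 z),
  [/\ opn U, forall w, w != 0 -> U (qpt w) <-> w 0 i != 0 &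
    forall w, w 0 i != 0 -> val (val (e (qpt w))) w = w 0 i].
Proof.
move=> w0i; pose U : set Z := [set z | exists2 w : 'M[K]_(1, n), w 0 i != 0 & qpt w = z].
have nz w : w 0 i != 0 -> w != 0 by move=> wi; apply/row_neq0P; exists i.
have UE w : w != 0 -> U (qpt w) <-> w 0 i != 0.
  move=> wN0; split=> [[w' w'i e]|wi]; last by exists w.
  have [c cN0 ->] := qpt_eq (nz _ w'i) wN0 e.
  by rewrite mxE mulf_neq0.
have H z : exists e : frame_at M0 z, U z -> forall w, val (piso z) w -> val (val e) w = w 0 i.
  have [w wN0 zE] := qpt_surj z; have zw : val (piso z) w by rewrite -zE; exact: piso_in.
  have /row_neq0P[j wj] := wN0.
  (* Outside [U] the coordinate [j], nonzero at [z], still provides a nonzero vector. *)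
  pose l := if pselect (U z) then i else j.
  have Gact : equivariant_on id (piso z) (fun w => w 0 l) by move=> w' c _ _; rewrite mxE.
  have vN0 : mkfib id (piso z) (fun w => w 0 l) != 0 :> fib M0 z.
    rewrite (fibre_neq0 aS _ zw) (mkfibE aS) // /l; case: pselect => // Uz.
    by apply/(UE _ wN0); rewrite zE.
  exists (mkframe vN0) => Uz w' zw'; rewrite /= (mkfibE aS) // /l.
  by case: pselect.
exists U, (fun z => projT1 (cid (H z))); split=> //.
- apply/(q_opnE); have -> : qcone U = [set w : 'M[K]_(1, n) | w != 0 /\ w 0 i != 0].
    by apply/seteqP; split=> w [wN0 /(UE _ wN0) ?].
  by apply: zopen_poly; exact: polyfun_entry.
- move=> w wi; have := projT2 (cid (H (qpt w))); apply.
    by apply/UE; [exact: nz|].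
  exact: piso_in (nz _ wi).
Qed.

Lemma M0_line_bundle : line_bundle M0.
Proof.
split.
- move=> z; have [w wN0 zE] := qpt_surj z; have /row_neq0P[i wi] := wN0.
  have [U [e [_ _ _]]] := M0_local wi; exists (val (e z)); first exact: valP (e z).
  by move=> v; apply: (fibre_colinear aS); exact: valP (e z).
- move=> U s s' Uo ss' /(M0_sectE _ Uo) sr; apply/(M0_sectE _ Uo); apply: zregular_eq sr => w [_ Uw].
  by rewrite ss'.
- move=> U s Uo; split=> [sS x Ux|sP]; first by exists U; split.
  apply/(M0_sectE _ Uo); apply: (@zregular_local _ _ _ [set w | w != 0]); last by move=> w [].
  move=> w [wN0 Uw]; have [V [Vo Vw VU /(M0_sectE _ Vo) sr]] := sP _ Uw.
  exists (qcone V), (fun w => val (s (qpt w)) w); split=> //; first exact/q_opnE.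
  by apply: zregular_sub sr => w' [].
- move=> z; have [w wN0 zE] := qpt_surj z; have /row_neq0P[i wi] := wN0.
  have [U [e [Uo UE eE]]] := M0_local wi; exists U, e; split=> //.
    by rewrite -zE; apply/UE.
  move=> V f Vo VU; rewrite (M0_sectE _ Vo) (q_regE _ Vo).
  have wi' w' : qcone V w' -> w' 0 i != 0 by move=> [w'N0 Vw']; apply/UE => //; exact: VU.
  split=> H.
    apply: (zregular_eq (f := fun w' => f (qpt w') * w' 0 i * (w' 0 i)^-1)).
      by move=> w' /wi' w'i; rewrite mulfK.
    apply: zregularM.
      by apply: zregular_eq H => w' /wi' w'i; rewrite fibre_scale eE.
    by apply: zregularV => [w' /wi'//|]; apply: zregular_polyfun; exact: polyfun_entry.
  apply: (zregular_eq (f := fun w' => f (qpt w') * w' 0 i)).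
    by move=> w' /wi' w'i; rewrite fibre_scale eE.
  by apply: zregularM => //; apply: zregular_polyfun; exact: polyfun_entry.
Qed.

Lemma existT_eq (A B : X) (v : fib L A) (u : fib L B) y : val A y -> val B y -> val v y = val u y ->
  existT (fib L) A v = existT (fib L) B u.
Proof.
move=> Ay By; have e : A = B by exact: (orbit_eq aX Ay By).
by case: B / e u By => u _ vu; congr existT; exact: (fibre_ext aX Ay).
Qed.

Lemma pi0_ex : exists pi : Defs.subspace SS -> Z,
  forall x y, val (incl x) y -> pi x = qpt (zmap y).
Proof.
exists (fun x => qpt (zmap (orep (incl x)))) => x y xy.
have [p Pp ->] := orbit_same aX xy (orepP (incl x)).
by rewrite (gd_zmap_act D) // qpt_scale // (git_chi0).
Qed.

Section Projection.
Variable pi : Defs.subspace SS -> Z.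
Hypothesis piE : forall x y, val (incl x) y -> pi x = qpt (zmap y).

Lemma pi_scls y : ssY y -> pi (scls y) = qpt (zmap y).
Proof. by move=> sy; apply: piE; exact: scls_in. Qed.

Lemma pi_opn (U : set Z) : opn U -> opn (pi @^-1` U).
Proof.
move=> /(q_opnE) Uo; apply/(sub_opnE).
have -> : [set y | ssY y /\ (pi @^-1` U) (scls y)] = [set y | Sp y /\ qcone U (zmap y)].
  apply/seteqP; split=> y [].
    by move=> sy /=; rewrite pi_scls //; case: sy.
  move=> yS [zy Uy]; have sy : ssY y by split.
  by split=> //=; rewrite pi_scls.
have := zopen_preimage (@Sp K n) (gd_zmap D) Uo.
by apply: zopen_trans; exact: zopen_nonzero _.
Qed.

Lemma pi_zregular (U : set Z) (f : 'M[K]_(1, n) -> K) : zregular (qcone U) f ->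
  zregular [set y | ssY y /\ U (pi (scls y))] (f \o zmap).
Proof.
apply: zregular_comp (gd_zmap D) _ => y [sy]; rewrite pi_scls // => Uy.
by split=> //; case: sy.
Qed.

Lemma pi_morphism : @morphism K (Defs.subspace SS) Z pi.
Proof.
split=> [U|U f Uo]; first exact: pi_opn.
move=> /(q_regE _ Uo) fr; apply/(sub_regE).
apply: zregular_eq (pi_zregular fr) => y [sy _] /=.
by rewrite pi_scls.
Qed.

(** [zmap] turns the degree one of [O(1)] under scalars into the character [chi] of [L]. *)
Definition psi0 (x : Defs.subspace SS) (v : fib M0 (pi x)) : fib L (incl x) :=
  mkfib chi (incl x) (fun y => val v (zmap y)).

Lemma pi_in x y : val (incl x) y -> val (piso (pi x)) (zmap y).
Proof.
move=> xy; rewrite (piE xy); apply: piso_in.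
by case: (ssY_in xy).
Qed.

Lemma psi0E x (v : fib M0 (pi x)) y : val (incl x) y -> val (psi0 v) y = val v (zmap y).
Proof.
move=> xy; rewrite /psi0 (mkfibE aX) // => y' p xy' Pp.
rewrite (gd_zmap_act D) //; have c0 := git_chi0 Pp.
exact: (fibre_actE v (pi_in xy') c0).
Qed.

Lemma psi0_linear x : linear (@psi0 x).
Proof.
move=> c u v; have [y sy xE] := ss_rep x; have xy : val (incl x) y by rewrite -xE; exact: scls_in.
apply: (fibre_ext aX xy); rewrite fibre_addE fibre_scale.
rewrite (psi0E (c *: u + v) xy) (psi0E u xy) (psi0E v xy).
exact: (pullback_fibre_linE (f := piso)).
Qed.

Lemma M0_descent_data : exists psi : forall x, {linear fib (pullback pi M0) x -> fib (pullback incl L) x},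
  [/\ bundle_iso psi, (forall x (v : fib M0 (pi x)) y, val (incl x) y -> val (psi x v) y = val v (zmap y)) &
  forall t, TG t -> forall x x' : Defs.subspace SS, incl x' = flag_act t (incl x) ->
   forall m : forall z, fib M0 z,
     existT (fib L) (incl x') (psi x' (m (pi x'))) =
     existT (fib L) (flag_act t (incl x)) (@flag_lin K n P chi t (incl x) (psi x (m (pi x))))].
Proof.
pose psi x := projT1 (cid (linear_map_ex (@psi0_linear x))).
have psiE x v : psi x v = psi0 v by rewrite /psi; case: cid => /= g ->.
have psiV x (v : fib M0 (pi x)) y : val (incl x) y -> val (psi x v) y = val v (zmap y).
  by move=> xy; rewrite psiE psi0E.
exists psi; split=> //; last first.
  move=> t Tt x x' x'E m.
  have [y sy xE] := ss_rep x; have xy : val (incl x) y by rewrite -xE; exact: scls_in.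
  have x'ty : val (incl x') (val t *m y) by rewrite x'E; exact: flag_actE.
  apply: (existT_eq x'ty (flag_actE t xy)).
  rewrite (flag_linE t) !psiV // (gd_zmap_torus D) //.
  have -> // : pi x' = pi x by rewrite (piE x'ty) (piE xy) (gd_zmap_torus D).
split=> [x|U s Uo].
  have [y sy xE] := ss_rep x; have xy : val (incl x) y by rewrite -xE; exact: scls_in.
  have [H1 _ _ _] := M0_line_bundle; have [v vN0 vP] := H1 (pi x).
  apply: (line_map_bij vP); last by move=> ? ?; exact: (fibre_colinear aX).
  by rewrite (fibre_neq0 aX _ xy) psiV // -(fibre_neq0 aS v (pi_in xy)).
rewrite (ss_sectE _ Uo); split=> [sP|sr x Ux].
  apply: (@zregular_local _ _ _ (@Sp K n)); last by move=> y [[]].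
  move=> y [sy Uy]; have [V [W [g [t [Vo WV [Wo Wx WU] [gr tS] sE]]]]] := sP _ Uy.
  exists [set y | ssY y /\ W (scls y)], (fun y => g (scls y) * val (t (qpt (zmap y))) (zmap y)).
  split.
  - exact/(sub_opnE).
  - by split.
  - apply: zregularM; first by move/(sub_regE): gr; apply: zregular_sub => y' [].
    move/(M0_sectE _ Vo): tS => /pi_zregular; apply: zregular_sub => y' [_ [sy' Wy']].
    by split=> //; exact: WV.
  - move=> y' [sy' Uy'] [_ Wy']; rewrite psiV; last exact: scls_in.
    rewrite sE // fibre_scale; congr (_ * _).
    by rewrite (@val_section M0 (fun _ v => val v) t _ _ (pi_in (scls_in sy'))).
have [y sy xE] := ss_rep x; have xy : val (incl x) y by rewrite -xE; exact: scls_in.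
have [_ /row_neq0P[i zi]] := sy.
have [V [e [Vo VE eE]]] := M0_local zi.
pose W := U `&` (pi @^-1` V).
have piV y' : ssY y' -> V (pi (scls y')) <-> zmap y' 0 i != 0.
  by move=> sy'; rewrite pi_scls //; apply: VE; case: sy'.
have Wo : opn W.
  apply/(sub_opnE).
  have -> : [set y | ssY y /\ W (scls y)] = [set y | ssY y /\ U (scls y)] `&`
      [set y | ssY y /\ (pi @^-1` V) (scls y)].
    by apply/seteqP; split=> y' [] => [? []|[? ?] []].
  by apply: zopenI; apply/(sub_opnE) => //; exact: pi_opn.
have oE x' : W x' -> exists y', [/\ ssY y', scls y' = x', val (incl x') y' & zmap y' 0 i != 0].
  move=> [_ Vx']; have [y' sy' x'E] := ss_rep x'.
  by exists y'; split=> //; [rewrite -x'E; exact: scls_in|apply/piV => //; rewrite x'E].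
(* The coefficient of the section in the local frame [w_i] of [M0]. It does not depend on the
   representative, as numerator and denominator are both scaled by [chi p]. *)
pose g x' : K := val (psi x' (s x')) (orep (incl x')) / zmap (orep (incl x')) 0 i.
have gE x' y' : W x' -> val (incl x') y' -> g x' = val (psi x' (s x')) y' / zmap y' 0 i.
  move=> Wx' xy'; have [p Pp e'] := orbit_same aX xy' (orepP (incl x')).
  rewrite /g e' (fibre_actE (psi x' (s x')) xy' Pp) (gd_zmap_act D) // mxE.
  by rewrite -mulf_div divff ?mul1r // (git_chi0).
exists V, W, g, (fun z => val (e z)); split=> //.
- by move=> x' [].
- split=> //; first split=> //.
    by rewrite -xE; apply/piV.
  by move=> x' [].
- split.
    apply/(sub_regE).
    apply: (zregular_eq (f := fun y' => val (psi _ (s (scls y'))) y' * (zmap y' 0 i)^-1)).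
      by move=> y' [sy' Wy']; rewrite (gE _ y') //; exact: scls_in.
    apply: zregularM; first by apply: zregular_sub sr => y' [? []].
    apply: zregularV; last by apply: zregular_polyfun; exact: (gd_zmap D).
    by move=> y' [sy' [_ Vy']]; apply/piV.
  apply/(M0_sectE _ Vo); apply: (zregular_eq (f := fun w => w 0 i)).
    by move=> w [wN0 /(VE _ wN0) wi]; rewrite eE.
  by apply: zregular_polyfun; exact: polyfun_entry.
- move=> x' Wx'; have [y' [sy' x'E x'y' zi']] := oE _ Wx'.
  apply: (fibre_ext aS (pi_in x'y')); rewrite fibre_scale (gE _ _ Wx' x'y').
  rewrite psiV //; have := @val_section M0 (fun _ v => val v) (fun z => val (e z)) _ _ (pi_in x'y') => <-.
  by rewrite eE // divfK.
Qed.

End Projection.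

Lemma M0_is_descent : @is_descent K (@Sp K n) X L (@flag_act K n P) flin TG M0.
Proof.
split; first exact: M0_line_bundle.
have [pi piE] := pi0_ex; have [psi [psi_iso _ psi_eq]] := M0_descent_data piE.
exists pi, psi; split=> //; first by apply/(git_mapE).
exact: pi_morphism.
Qed.

(** * Uniqueness of the descent *)

Section Uniqueness.
Variable M : bundle Z.
Hypothesis M_line : line_bundle M.
Variables (pi : Defs.subspace SS -> Z)
  (psi : forall x, {linear fib (pullback pi M) x -> fib (pullback incl L) x}).
Hypothesis piE : forall x y, val (incl x) y -> pi x = qpt (zmap y).
Hypothesis psi_iso : bundle_iso psi.
Hypothesis psi_eq : forall t, TG t -> forall x x' : Defs.subspace SS,
  incl x' = flag_act t (incl x) -> forall m : forall z, fib M z,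
  existT (fib L) (incl x') (psi x' (m (pi x'))) =
  existT (fib L) (flag_act t (incl x)) (@flag_lin K n P chi t (incl x) (psi x (m (pi x)))).

(* The pullback of [m], as a function on the semistable part of the group. *)
Definition Psi (m : forall z, fib M z) y : K := val (psi (scls y) (m (pi (scls y)))) y.

Lemma Psi_val m x y : val (incl x) y -> Psi m y = val (psi x (m (pi x))) y.
Proof. by move=> xy; rewrite /Psi (scls_eq xy). Qed.

Lemma Psi_act m y p : ssY y -> P p -> Psi m (y *m p) = chi p * Psi m y.
Proof.
move=> sy Pp; have xy := scls_in sy.
rewrite (Psi_val m xy) (Psi_val m (orbit_act aX xy Pp)).
exact: (fibre_actE (psi (scls y) (m (pi (scls y)))) xy Pp).
Qed.

Lemma Psi_torus m y t : ssY y -> T t -> Psi m (t *m y) = Psi m y.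
Proof.
move=> sy Tt; have xy := scls_in sy.
have sty := ssY_torus sy Tt; have x'y := scls_in sty.
pose tt : @Sp K n := exist _ t (mem_set (gd_torus D Tt)).
have e : incl (scls (t *m y)) = flag_act tt (incl (scls y)).
  exact: (orbit_eq aX x'y (flag_actE tt xy)).
have := psi_eq (t := tt) Tt e m => /(congr1 (fun s : {A : X & fib L A} => val (projT2 s) (t *m y))).
rewrite -(Psi_val m x'y) => ->.
by rewrite (Psi_val m xy); exact: flag_linE.
Qed.

Lemma Psi_lin m m1 m2 (c : K) y : m (pi (scls y)) = c *: m1 (pi (scls y)) + m2 (pi (scls y)) ->
  Psi m y = c * Psi m1 y + Psi m2 y.
Proof.
move=> e; rewrite /Psi e.
rewrite (linearP (psi (scls y)) c (m1 (pi (scls y))) (m2 (pi (scls y)))).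
exact: (pullback_fibre_linE (f := incl)).
Qed.

Lemma Psi_ext m m' y : m (pi (scls y)) = m' (pi (scls y)) -> Psi m y = Psi m' y.
Proof. by rewrite /Psi => ->. Qed.

Lemma Psi_scale m m' (c : K) y : m (pi (scls y)) = c *: m' (pi (scls y)) -> Psi m y = c * Psi m' y.
Proof.
pose m0 z : fib M z := 0; have z0 : Psi m0 y = 0.
  have : m0 (pi (scls y)) = (-1) *: m0 (pi (scls y)) + m0 (pi (scls y)) by rewrite scaler0 addr0.
  by move=> /Psi_lin; rewrite mulN1r addNr.
by move=> e; rewrite (@Psi_lin m m' m0 c) ?z0 ?addr0.
Qed.

Lemma Psi_neq0 m y : ssY y -> m (pi (scls y)) != 0 -> Psi m y != 0.
Proof.
move=> sy mN0; have xy := scls_in sy.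
rewrite /Psi -(fibre_neq0 aX (psi (scls y) (m (pi (scls y)))) xy).
apply: contraNneq mN0 => p0; have [/(_ (scls y))/bij_inj inj _] := psi_iso.
apply/eqP; apply: inj; rewrite p0; exact: (esym (linear0 (psi (scls y)))).
Qed.

Lemma Psi_regular (U : set Z) (s : forall z, fib M z) : opn U -> sect U s ->
  zregular [set y | ssY y /\ U (pi (scls y))] (Psi s).
Proof.
move=> Uo sS; have Vo := pi_opn piE Uo.
have [_ /(_ (pi @^-1` U) (fun x => s (pi x)) Vo)[H _]] := psi_iso.
apply: ((ss_sectE (fun x => psi x (s (pi x))) Vo).1 (H _)) => x Ux.
exists U, (pi @^-1` U), (fun=> 1), s; split=> //.
- by split.
- split; last exact: sS.
  apply: (sub_regE (pi @^-1` U) (fun=> 1)).2.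
  by apply: zregular_polyfun; exact: polyfun_const.
- by move=> x' _; rewrite scale1r.
Qed.

Lemma line_frame (z : Z) : exists (U : set Z) (e : forall z', frame_at M z'),
  [/\ opn U, U z, sect U (fun z' => val (e z')) &
    forall (V : set Z) (f : Z -> K), opn V -> V `<=` U -> reg V f -> sect V (fun z' => f z' *: val (e z'))].
Proof.
have [_ _ _ /(_ z)[U [e [Uo Uz eP]]]] := M_line; exists U, e; split=> //.
  have -> : (fun z' => val (e z')) = (fun z' => 1 *: val (e z')).
    by apply: functional_extensionality_dep => z'; rewrite scale1r.
  by apply/(eP U (fun=> 1)) => //; apply/(q_regE _ Uo)/zregular_polyfun/polyfun_const.
by move=> V f Vo VU fr; apply/eP.
Qed.

Lemma frame_coef (z : Z) (e : frame_at M z) v : exists c : K, v = c *: val e.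
Proof.
have [/(_ z)[u uN0 uP] _ _ _] := M_line; have [a ea] := uP (val e); have [b ->] := uP v.
have aN0 : a != 0 by apply: contraTneq (valP e) => a0; rewrite ea a0 scale0r eqxx.
by exists (b / a); rewrite ea scalerA divfK.
Qed.

(** [m] is arbitrary, but at one point it is a multiple of a regular local frame, whose pullback is
    invariant and falls under [gd_factor] with [k = 1]. As [y] and [sec (zmap y)] lie over the same
    point of the quotient, the multiple is the same for both. *)
Lemma Psi_factor m y : ssY y -> Psi m y = Psi m (sec (zmap y)).
Proof.
move=> sy; have [_ zy] := sy; have ssec := ssY_sec zy.
have [U [e [Uo Uz eS _]]] := line_frame (pi (scls y)).
have piz : pi (scls (sec (zmap y))) = pi (scls y).
  by rewrite !(pi_scls piE) // (gd_zmap_sec D).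
pose m0 z := val (e z).
have [c cE] := frame_coef (e (pi (scls y))) (m (pi (scls y))).
rewrite (@Psi_scale m m0 c) // (@Psi_scale m m0 c (sec (zmap y))); last by rewrite /m0 piz.
congr (_ * _).
apply: (@gd_factor _ _ _ _ _ _ _ D 1 [set y | ssY y /\ U (pi (scls y))]) => //.
- by have /(sub_opnE) := pi_opn piE Uo.
- move=> y1 y2 y2S e12 [sy1 Uy1].
  have sy2 : ssY y2 by split=> //; rewrite -e12; case: sy1.
  by split=> //; move: Uy1; rewrite !(pi_scls piE) // e12.
- exact: Psi_regular.
- by move=> y' p [sy' _] Pp; rewrite expr1 Psi_act.
- by move=> y' t [sy' _] Tt; rewrite Psi_torus.
Qed.

Definition phi (m : forall z, fib M z) w : K := Psi m (sec w).

Lemma pi_sec w : w != 0 -> pi (scls (sec w)) = qpt w.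
Proof. by move=> wN0; rewrite (pi_scls piE (ssY_sec wN0)) (gd_zmap_sec D). Qed.

Lemma phi_scale m c w : c != 0 -> w != 0 -> phi m (c *: w) = c * phi m w.
Proof.
move=> cN0 wN0; have [p Pp pc] := gd_chi_surj D cN0; have sw := ssY_sec wN0.
have [swp _] := ssY_act sw Pp.
by rewrite -pc /phi -(Psi_act m sw Pp) (Psi_factor m swp) (gd_zmap_act D) // (gd_zmap_sec D) pc.
Qed.

Lemma phi_ext m m' w : w != 0 -> m (qpt w) = m' (qpt w) -> phi m w = phi m' w.
Proof. by move=> wN0 e; apply: Psi_ext; rewrite pi_sec. Qed.

Lemma phi_regular (U : set Z) (s : forall z, fib M z) : opn U -> sect U s -> zregular (qcone U) (phi s).
Proof.
move=> Uo sS; apply: (zregular_comp (gd_sec D) _ (Psi_regular Uo sS)) => w [wN0 Uw].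
by split; [exact: (ssY_sec wN0)|rewrite pi_sec].
Qed.

(* Extension by zero: fibres at different points have different types. *)
Definition single (z : Z) (v : fib M z) (z' : Z) : fib M z' :=
  match pselect (z = z') with
  | left e => eq_rect z (fun z => fib M z) v z' e
  | right _ => 0
  end.

Lemma singleE z (v : fib M z) : single v z = v.
Proof. by rewrite /single; case: pselect => // e; rewrite (Prop_irrelevance e erefl). Qed.

(** [phi m w] depends only on the value of [m] at the point of [w], so any set-theoretic section
    through [v] gives the same vector. *)
Definition theta_fun z (v : fib M z) : fib M0 z := mkfib id (piso z) (phi (single v)).

Lemma theta_funE (s : forall z, fib M z) z w : val (piso z) w ->
  val (theta_fun (s z)) w = phi s w.
Proof.
move=> zw; have [wN0 zE] := piso_rep zw; rewrite /theta_fun (mkfibE aS) //.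
  by apply: phi_ext => //; rewrite zE singleE.
by move=> w' c zw' cN0; apply: phi_scale => //; case: (piso_rep zw').
Qed.

Lemma piso_elt (z : Z) : exists w, val (piso z) w.
Proof. exact: (orbit_elt aS). Qed.

Lemma theta_fun_linear z : linear (@theta_fun z).
Proof.
move=> c u v; have [w zw] := piso_elt z; have [wN0 zE] := piso_rep zw.
apply: (fibre_ext aS zw).
rewrite (pullback_fibre_linE (f := piso)).
have E (x : fib M z) : val (theta_fun x) w = phi (single x) w.
  by rewrite -{1}(singleE x) (theta_funE (single x) zw).
rewrite !E /phi; apply: Psi_lin; by rewrite pi_sec // zE !singleE.
Qed.

Lemma theta_ex : exists theta : forall z, {linear fib M z -> fib M0 z},
  [/\ bundle_iso theta & forall (s : forall z, fib M z) z w, val (piso z) w ->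
     val (theta z (s z)) w = phi s w].
Proof.
pose theta z := projT1 (cid (linear_map_ex (@theta_fun_linear z))).
have thetaE (s : forall z, fib M z) z w : val (piso z) w -> val (theta z (s z)) w = phi s w.
  move=> zw; rewrite -(theta_funE s zw) /theta; case: cid => /= g ->.
  by [].
exists theta; split=> //; split=> [z|U s Uo].
  have [/(_ z)[v vN0 vP] _ _ _] := M_line; have [w zw] := piso_elt z; have [wN0 zE] := piso_rep zw.
  apply: (line_map_bij vP); last by move=> ? ?; exact: (fibre_colinear aS).
  rewrite (fibre_neq0 aS _ zw) -{1}(singleE v) thetaE //; apply: Psi_neq0; first exact: (ssY_sec wN0).
  by rewrite pi_sec // zE singleE.
have E w : w != 0 -> val (theta (qpt w) (s (qpt w))) w = phi s w.
  by move=> wN0; apply: thetaE; exact: piso_in.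
rewrite (M0_sectE _ Uo); split=> [sS|sr].
  by apply: zregular_eq (phi_regular Uo sS) => w [wN0 _]; rewrite E.
have [_ H2 H3 _] := M_line; apply/(H3 _ _ Uo) => z Uz.
(* In a local frame [e] of [M] the coefficient of [s] is the quotient of the functions attached to
   [s] and to [e], the latter regular without zeros. *)
have [V [e [Vo Vz eS eP]]] := line_frame z.
pose W := U `&` V.
have WE : qcone W = qcone U `&` qcone V.
  by apply/seteqP; split=> w [] => [? []|[? ?] []].
have Wo : opn W by apply/(q_opnE); rewrite WE; apply: zopenI; exact/(q_opnE).
have /choice[f fE] z' : exists c : K, s z' = c *: val (e z') by exact: frame_coef.
exists W; split=> //; first by move=> z' [].
apply: (H2 W (fun z' => f z' *: val (e z'))) => //; apply: eP => //; first by move=> z' [].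
apply/(q_regE _ Wo).
have eN0 w : w != 0 -> phi (fun z' => val (e z')) w != 0.
  move=> wN0; apply: Psi_neq0; first exact: (ssY_sec wN0).
  exact: (valP (e _)).
apply: (zregular_eq (f := fun w => val (theta (qpt w) (s (qpt w))) w * (phi (fun z' => val (e z')) w)^-1)).
  move=> w [wN0 _]; rewrite E // /phi (@Psi_scale s (fun z' => val (e z')) (f (qpt w))).
    by apply: mulfK; exact: eN0.
  by rewrite pi_sec //; exact: fE.
rewrite WE; apply: zregularM; first by apply: zregular_sub sr => w [].
apply: zregularV; first by move=> w [[wN0 _] _]; exact: eN0.
by apply: zregular_sub (phi_regular Vo eS) => w [].
Qed.

End Uniqueness.

(** * Sections of the powers of a descent *)

Section PowerSectionsOfDescent.
Variable M : bundle Z.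
Hypothesis M_line : line_bundle M.
Variable theta : forall z, {linear fib M z -> fib M0 z}.
Hypothesis theta_iso : bundle_iso theta.

Definition prep (z : Z) : 'M[K]_(1, n) := projT1 (cid (piso_elt z)).

Lemma prepP z : val (piso z) (prep z).
Proof. exact: projT2 (cid (piso_elt z)). Qed.

Lemma theta_neq0 z (v : frame_at M z) w : val (piso z) w -> val (theta z (val v)) w != 0.
Proof.
move=> zw; rewrite -(fibre_neq0 aS _ zw); apply: contraNneq (valP v) => t0.
have [/(_ z)/bij_inj inj _] := theta_iso.
by apply/eqP; apply: inj; rewrite t0; exact: (esym (linear0 (theta z))).
Qed.

(** A nonzero vector of a fibre of [O(1)] corresponds to the representative of the point at which it
    takes the value [1]. Through [theta] this puts the frames of [M] in bijection with the nonzero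
    vectors of [K^n]. *)
Definition zetaM (e : frame M) : 'M[K]_(1, n) :=
  (val (theta _ (val (projT2 e))) (prep (projT1 e)))^-1 *: prep (projT1 e).

Lemma zetaME z (v : frame_at M z) w : val (piso z) w ->
  zetaM (existT _ z v) = (val (theta z (val v)) w)^-1 *: w.
Proof.
move=> zw; have [c cN0 ->] := orbit_same aS (prepP z) zw.
rewrite (fibre_actE (theta z (val v)) (prepP z) cN0) /zetaM /= scalerA invfM mulrAC.
by rewrite mulVf ?mul1r.
Qed.

Lemma zetaM_scale z (v v' : frame_at M z) c : val v' = c *: val v ->
  zetaM (existT _ z v') = c^-1 *: zetaM (existT _ z v).
Proof.
move=> e; rewrite !(zetaME _ (prepP z)) scalerA -invfM; congr (_^-1 *: _).
by rewrite e (linearZ_LR (theta z)).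
Qed.

Lemma zetaM_neq0 e : zetaM e != 0.
Proof.
case: e => z v; rewrite (zetaME v (prepP z)) scaler_eq0 invr_eq0 negb_or (theta_neq0 v (prepP z)).
exact: (piso_rep (prepP z)).1.
Qed.

Lemma zetaM_at z (v : frame_at M z) : val (piso z) (zetaM (existT _ z v)).
Proof.
rewrite (zetaME v (prepP z)); apply: (orbit_act aS (prepP z)).
by rewrite /= invr_eq0; exact: theta_neq0 (prepP z).
Qed.

Lemma scale_frame z (v : frame_at M z) (c : K) : c != 0 -> exists v' : frame_at M z, val v' = c *: val v.
Proof.
move=> cN0; have cvN0 : c *: val v != 0 by rewrite scaler_eq0 negb_or cN0; exact: valP v.
by exists (mkframe cvN0 : frame_at M z).
Qed.

Lemma zetaM_surj w : w != 0 -> exists e, zetaM e = w.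
Proof.
move=> wN0; have [/(_ (qpt w))[v vN0 _] _ _ _] := M_line.
have zw := piso_in wN0.
pose v0 : frame_at M (qpt w) := mkframe vN0.
have [v' v'E] := scale_frame v0 (invr_neq0 (theta_neq0 v0 zw)).
exists (existT _ _ v'); rewrite (zetaM_scale v'E) invrK (zetaME v0 zw) scalerA divff ?scale1r //.
exact: theta_neq0.
Qed.

Lemma zetaM_inj : injective zetaM.
Proof.
move=> [z v] [z' v'] e; have zw := zetaM_at v; have z'w := zetaM_at v'; rewrite -e in z'w.
have [wN0 zE] := piso_rep zw; have [_ z'E] := piso_rep z'w.
have zz' : z = z' by rewrite -zE.
case: z' / zz' v' e {z'w z'E} => v' e; congr existT.
apply: val_inj; have [/(_ z)/bij_inj inj _] := theta_iso; apply: inj.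
apply: (fibre_ext aS (prepP z)); apply: invr_inj.
move: e; rewrite !(zetaME _ (prepP z)) => /eqP; rewrite -subr_eq0 -scalerBl scaler_eq0.
by rewrite (negPf (piso_rep (prepP z)).1) orbF subr_eq0 => /eqP.
Qed.

Lemma theta_regular (U : set Z) (e : forall z, frame_at M z) : opn U ->
  sect U (fun z => val (e z)) ->
  zregular (qcone U) (fun w => val (theta (qpt w) (val (e (qpt w)))) w).
Proof.
by move=> Uo; have [_ /(_ U (fun z => val (e z)) Uo) H] := theta_iso => /H/(M0_sectE _ Uo).
Qed.

(** Under the bijection [zetaM] a power section becomes a homogeneous function of degree [k] on
    nonzero vectors. Local frames of [M] show that it is regular, and [homog_mxeval] makes it a
    form. *)
Lemma power_sectionE k : power_section (L := M) k =
  [set F | exists2 q, q \is k.-homog & F = fun e => mxeval q (zetaM e)].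
Proof.
apply/seteqP; split=> F; last first.
  move=> [q qh ->]; split=> [z v v' c vv'|U e Uo eS].
    by rewrite (zetaM_scale vv') (mxeval_homogZ _ _ qh) exprVn.
  apply/(q_regE _ Uo).
  apply: (zregular_eq (f := fun w => mxeval q ((val (theta (qpt w) (val (e (qpt w)))) w)^-1 *: w))).
    by move=> w [wN0 _]; rewrite /= (zetaME _ (piso_in wN0)).
  apply: zregular_mxeval; apply: zregular_mxZ.
    apply: zregularV; last exact: theta_regular.
    by move=> w [wN0 _]; apply: theta_neq0; exact: piso_in.
  by move=> i j; apply: zregular_polyfun; exact: polyfun_entry.
move=> [FZ Freg].
(* [tau] inverts [zetaM] on nonzero vectors; its value at the origin is arbitrary. *)
have /choice[tau tauP] w : exists e : frame M, w != 0 -> zetaM e = w.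
  have [->|/zetaM_surj[e <-]] := eqVneq w 0; last by exists e.
  by have [e _] := zetaM_surj (delta_neq0 K n_gt0); exists e.
pose f w := F (tau w).
have fE e : F e = f (zetaM e).
  by rewrite /f; congr F; apply: zetaM_inj; rewrite tauP // zetaM_neq0.
have fr : zregular [set w | w != 0] f.
  apply: (@zregular_local _ _ _ [set w | w != 0]) => // w0 w0N0.
  have [_ _ _ /(_ (qpt w0))[U [e [Uo Uw0 eP]]]] := M_line.
  have eS : sect U (fun z => val (e z)).
    have -> : (fun z => val (e z)) = (fun z => 1 *: val (e z)).
      by apply: functional_extensionality_dep => z; rewrite scale1r.
    by apply/(eP U (fun=> 1)) => //; apply/(q_regE _ Uo)/zregular_polyfun/polyfun_const.
  pose t w := val (theta (qpt w) (val (e (qpt w)))) w.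
  exists (qcone U), (fun w => F (existT _ (qpt w) (e (qpt w))) * t w ^+ k); split=> //.
  - exact/(q_opnE).
  - apply: zregularM.
      by have /(q_regE _ Uo) := Freg U e Uo eS; apply: zregular_sub => w [].
    by apply: zregularX; apply: zregular_sub (theta_regular Uo eS) => w [].
  - move=> w wN0 [_ Uw]; have zw := piso_in wN0.
    have tN0 : t w != 0 by apply: theta_neq0.
    have [v' v'E] := scale_frame (e (qpt w)) (invr_neq0 tN0).
    have <- : zetaM (existT _ _ v') = w.
      by rewrite (zetaM_scale v'E) invrK (zetaME _ zw) scalerA divff ?scale1r.
    rewrite -fE (FZ _ _ _ _ v'E) exprVn invrK mulrC.
    have -> // : zetaM (existT _ _ v') = w.
      by rewrite (zetaM_scale v'E) invrK (zetaME _ zw) scalerA divff ?scale1r.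
have fZ c w : c != 0 -> w != 0 -> f (c *: w) = c ^+ k * f w.
  move=> cN0 /zetaM_surj[[z v] <-]; have [v' v'E] := scale_frame v (invr_neq0 cN0).
  have <- : zetaM (existT _ _ v') = c *: zetaM (existT _ z v) by rewrite (zetaM_scale v'E) invrK.
  by rewrite -!fE (FZ _ _ _ _ v'E) exprVn invrK.
have [q qh qE] := homog_mxeval fr fZ.
by exists q => //; apply/funext => e; rewrite fE qE // zetaM_neq0.
Qed.

Lemma descent_projectively_normal : projectively_normal M.
Proof.
split; first exact: (pb_integrally_closed n_gt0 power_sectionE zetaM_surj).
exact: (pb_generated power_sectionE).
Qed.
End PowerSectionsOfDescent.

End GitQuotient.

Lemma parabolic_git_data (K : numClosedFieldType) (n : nat) (n_ge2 : (2 <= n)%N)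
    (T : set 'M[K]_(n + n)) (eps : 'I_n -> 'M[K]_(n + n) -> K) (i1 : 'I_n)
    (omega1 : 'rV[int]_n) (chi : 'M[K]_(n + n) -> K) :
  maximal_torus T -> bourbaki_coordinates T eps -> i1 = 0%N :> nat ->
  fundamental_weight i1 omega1 -> is_character (parabolic T eps i1) chi ->
  (forall t, T t -> chi t = weight_char eps (omega1 *+ 2) t) ->
  exists zmap sec, git_data (parabolic T eps i1) T chi zmap sec.
Proof.
move=> T_max eps_coord i1E omega1P chi_char chiT.
have [h hS [Th eps_ad]] := standard_torus T_max eps_coord.
exists (zmap h i1), (sec h i1); split.
- exact: (parabolic_subgroup hS Th eps_ad i1E).
- by case: T_max => -[[]].
- exact: chi_char.
- exact: (chi_surj n_ge2 T_max eps_coord hS Th eps_ad i1E omega1P chi_char chiT).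
- exact: (local_section n_ge2 T_max eps_coord hS Th eps_ad i1E omega1P chi_char chiT).
- exact: (@polymap_zmap _ _ h i1).
- exact: (@polymap_sec _ _ h i1).
- exact: (Sp_sec hS).
- exact: (zmap_sec hS).
- exact: (zmap_act n_ge2 T_max eps_coord hS Th eps_ad i1E omega1P chi_char chiT).
- exact: (zmap_torus hS Th).
- move=> k W f Wo Wsat fr fa ft y Wy.
  exact: (invariant_factor n_ge2 T_max eps_coord hS Th eps_ad i1E omega1P chi_char chiT Wo Wsat fr fa ft).
Qed.

Theorem proposition1p3
  (R : realType) (n : nat) (n_ge2 : (2 <= n)%N)
  (T : set 'M[R[i]]_(n + n)) (T_max : maximal_torus T)
  (eps : 'I_n -> 'M[R[i]]_(n + n) -> R[i]) (eps_coord : bourbaki_coordinates T eps)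
  (i1 : 'I_n) (i1E : i1 = 0%N :> nat)
  (omega1 : 'rV[int]_n) (omega1P : fundamental_weight i1 omega1)
  (chi : 'M[R[i]]_(n + n) -> R[i])
  (chi_char : is_character (parabolic T eps i1) chi)
  (chiT : forall t, T t -> chi t = weight_char eps (omega1 *+ 2) t) :
  let P := parabolic T eps i1 in
  let TG : set (@Sp R[i] n) := [set t | T (val t)] in
  let L := hom_bundle P chi in
  let Z := git_quotient (L := L) (@flag_lin _ _ P chi) TG in
  let descent := fun M : bundle Z => is_descent (L := L) M in
  (exists M : bundle Z, descent M) /\
  (forall M : bundle Z, descent M ->
     projectively_normal M /\ polarized_isomorphic M (O1 R[i] n)).
Proof.
have n_gt0 : (0 < n)%N by exact: leq_trans n_ge2.
have [zm [sc D]] := parabolic_git_data n_ge2 T_max eps_coord i1E omega1P chi_char chiT.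
split; first by exists (M0 n_gt0 D); exact: M0_is_descent.
move=> M [M_line [pi [psi [pi_map _ psi_iso psi_eq]]]].
have piE := (git_mapE n_gt0 D pi).1 pi_map.
have [theta [theta_iso _]] := theta_ex M_line piE psi_iso psi_eq.
split; first exact: (descent_projectively_normal M_line theta_iso).
by exists (piso n_gt0 D); [exact: piso_isomorphism|exists theta].
Qed.
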